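(* Let $m\in\{1,2,\dots,N\}$ and $\alpha>0$. There exists a self-similar solution $V(t,x)=t^{-1/\alpha}g\big(\tfrac{x}{\sqrt t}\big)$ of the equation $u_t-\Delta u+|u|^\alpha u=0$ on $(0,\infty)\times\mathbb R^N$ such that $g\in C^{b,u}(\mathbb R^N)$, $g$ is antisymmetric in $x_1,x_2,\dots,x_m$, and $$\alpha^{-1/\alpha}e^{\Delta}h(x)\le g(x)\le(\alpha\epsilon)^{-1/\alpha}e^{(1-\epsilon)\Delta}h(x),\qquad x\in\Omega_m,$$ for all $0<\epsilon<1$, where $h\in L^\infty(\mathbb R^N)$ is the antisymmetric function (with respect to $x_1,\dots,x_m$) such that $h(x)=1$ for $x\in\Omega_m$. The self-similar solution $V$ is characterized by $$V=\lim_{\lambda\to\infty}\Gamma_\lambda^{2/\alpha}v,$$ where $v$ is the solution of the same equation on $\mathbb R^N$ with initial value $v_0=h$, and where the limit is uniform on compact subsets of $(0,\infty)\times\mathbb R^N$.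
   Context: $N\ge1$ is an integer. $\Omega_m=\{x\in\mathbb R^N: x_1>0,\dots,x_m>0\}$. $C^{b,u}(\mathbb R^N)$ is the space of bounded uniformly continuous functions on $\mathbb R^N$. A function is antisymmetric in $x_1,\dots,x_m$ if it changes sign under each reflection $x_i\mapsto-x_i$, $1\le i\le m$. The heat semigroup on $\mathbb R^N$ is $e^{t\Delta}\varphi=G_t\star\varphi$, $G_t(x)=(4\pi t)^{-N/2}e^{-|x|^2/4t}$; $e^\Delta$ means $t=1$. For $v_0\in L^\infty(\mathbb R^N)$, the solution with initial value $v_0$ is the unique $v\in C((0,\infty);C^{b,u}(\mathbb R^N))$ satisfying $v(t)=e^{t\Delta}v_0-\int_0^te^{(t-s)\Delta}(|v(s)|^\alpha v(s))\,ds$ for $t>0$ (existence and uniqueness known); it is a classical solution on $(0,\infty)\times\mathbb R^N$ and $\|v(t)-e^{t\Delta}v_0\|_{L^\infty(\mathbb R^N)}\to0$ as $t\to0$. Dilations: $\Gamma_\lambda^{2/\alpha}v(t,x)=\lambda^{2/\alpha}v(\lambda^2t,\lambda x)$, $\lambda>0$. A solution $V$ is self-similar if $\Gamma_\lambda^{2/\alpha}V=V$ for all $\lambda>0$, equivalently $V(t,x)=t^{-1/\alpha}g(x/\sqrt t)$ with profile $g=V(1,\cdot)$. *)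

(* Defs.v *)
From HB Require Import structures.
From mathcomp Require Import all_boot all_order all_algebra.
From mathcomp Require Import all_classical all_reals all_analysis.

Set Implicit Arguments.
Unset Strict Implicit.
Unset Printing Implicit Defensive.

Import Order.TTheory GRing.Theory Num.Theory.
Import numFieldNormedType.Exports.

Local Open Scope classical_set_scope.
Local Open Scope ring_scope.

(* The sigma-algebra on 'rV[T]_n generated by the coordinate maps (the same
   construction as the library's one on n.-tuple T); for T a realType it is
   the Borel sigma-algebra of R^n. *)
Section rV_measurable.
Context {d} {T : sigmaRingType d} (n : nat).

Definition rV_coord (i : 'I_n) (x : 'rV[T]_n) : T := x ord0 i.

Let rV_set0 : g_sigma_preimage rV_coord set0.
Proof. exact: sigma_algebra0. Qed.

Let rV_setC A : g_sigma_preimage rV_coord A -> g_sigma_preimage rV_coord (~` A).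
Proof. exact: sigma_algebraC. Qed.

Let rV_bigcup (F : (set 'rV[T]_n)^nat) :
  (forall i, g_sigma_preimage rV_coord (F i)) ->
  g_sigma_preimage rV_coord (\bigcup_i (F i)).
Proof. exact: sigma_algebra_bigcup. Qed.

HB.instance Definition _ := @isMeasurable.Build (measure_tuple_display d)
  'rV[T]_n (g_sigma_preimage rV_coord) rV_set0 rV_setC rV_bigcup.

End rV_measurable.

Section lebesgue_rV.
Local Open Scope ereal_scope.
Context (R : realType) (n : nat).

Definition rV_cons (xy : measurableTypeR R * 'rV[R]_n) : 'rV[R]_n.+1 :=
  \row_i (if unlift ord0 i is Some j then xy.2 ord0 j else xy.1).

Definition rV_uncons (z : 'rV[R]_n.+1) : measurableTypeR R * 'rV[R]_n :=
  (z ord0 ord0, \row_j z ord0 (lift ord0 j)).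

Lemma rV_consK : cancel rV_cons rV_uncons.
Proof.
case=> x y; rewrite /rV_uncons /rV_cons !mxE unlift_none; congr pair.
by apply/rowP => j; rewrite !mxE liftK.
Qed.

Lemma rV_unconsK : cancel rV_uncons rV_cons.
Proof.
by move=> z; apply/rowP => i; rewrite mxE; case: unliftP => [j|] -> //=; rewrite mxE.
Qed.

Lemma measurable_coord_rV k (i : 'I_k) :
  measurable_fun [set: 'rV[R]_k] (fun x : 'rV[R]_k => x ord0 i).
Proof.
move=> _ Y mY; rewrite setTI; apply: sub_sigma_algebra => /=.
rewrite -bigcup_seq/=; exists i => /=; first by rewrite mem_index_enum.
by exists Y => //; rewrite setTI.
Qed.

Lemma measurable_fun_rV d (T : measurableType d) k (f : T -> 'rV[R]_k) :
  (forall i, measurable_fun [set: T] (fun t => f t ord0 i)) ->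
  measurable_fun [set: T] f.
Proof.
move=> mf _ A mA; rewrite setTI.
have : preimage_set_system [set: T] f (@measurable _ 'rV[R]_k) (f @^-1` A).
  by exists A => //; rewrite setTI.
rewrite -[X in preimage_set_system _ _ X]/(g_sigma_preimage (@rV_coord _ R k)).
rewrite -g_sigma_preimage_comp; apply: smallest_sub.
  exact: sigma_algebra_measurable.
apply: (big_ind (fun X : set (set T) => X `<=` measurable)).
- exact: sub0set.
- by move=> X Y hX hY Z [/hX|/hY].
- by move=> i _ Z [B mB <-]; apply: mf => //; exact: measurableT.
Qed.

Lemma measurable_rV_cons : measurable_fun setT rV_cons.
Proof.
apply: measurable_fun_rV => i.
under eq_fun do rewrite mxE.
case: (unlift ord0 i) => [j|]; last exact: measurable_fst.
exact: (measurableT_comp (measurable_coord_rV j) measurable_snd).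
Qed.

Lemma measurable_rV_uncons : measurable_fun setT rV_uncons.
Proof.
apply: measurable_fun_pair; first exact: measurable_coord_rV.
apply: measurable_fun_rV => i.
under eq_fun do rewrite mxE.
exact: measurable_coord_rV.
Qed.

Variable mu : {sigma_finite_measure set 'rV[R]_n -> \bar R}.

(* Image under (x, y) |-> (x, y_1, ..., y_n) of the product of the Lebesgue
   measure of R with mu. *)
Definition lebesgue_rVS : set 'rV[R]_n.+1 -> \bar R :=
  pushforward (@lebesgue_measure R \x mu)%E rV_cons.

Let lebesgue_rVS0 : lebesgue_rVS set0 = 0%E.
Proof. by rewrite /lebesgue_rVS /pushforward preimage_set0 measure0. Qed.

Let lebesgue_rVS_ge0 A : (0 <= lebesgue_rVS A)%E.
Proof. exact: (measure_ge0 (@lebesgue_measure R \x mu)). Qed.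

Let lebesgue_rVS_sigma_additive : semi_sigma_additive lebesgue_rVS.
Proof.
move=> F mF tF mUF; rewrite /lebesgue_rVS /pushforward preimage_bigcup.
have mP (A : set 'rV[R]_n.+1) : measurable A -> measurable (rV_cons @^-1` A).
  by move=> mA; rewrite -[X in measurable X]setTI; exact: measurable_rV_cons.
apply: measure_semi_sigma_additive.
- by move=> i; exact: mP.
- apply/trivIsetP => /= i j _ _ ij; rewrite -preimage_setI.
  by move/trivIsetP : tF => /(_ _ _ _ _ ij) ->//; rewrite preimage_set0.
- by rewrite -preimage_bigcup; exact: mP.
Qed.

HB.instance Definition _ := isMeasure.Build _ _ _ lebesgue_rVS
  lebesgue_rVS0 lebesgue_rVS_ge0 lebesgue_rVS_sigma_additive.

Let lebesgue_rVS_sigma_finite : sigma_finite setT lebesgue_rVS.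
Proof.
have /sigma_finiteP[F [TF ndF Foo]] := sigma_finiteT (@lebesgue_measure R).
have /sigma_finiteP[G [TG ndG Goo]] := sigma_finiteT mu.
exists (fun k => rV_uncons @^-1` (F k `*` G k)).
  apply/seteqP; split=> // z _.
  have [i _ Fi] : (\bigcup_i F i) (rV_uncons z).1 by rewrite -TF.
  have [j _ Gj] : (\bigcup_i G i) (rV_uncons z).2 by rewrite -TG.
  exists (maxn i j) => //; split.
  - by move: Fi; exact/subsetPset/ndF/leq_maxl.
  - by move: Gj; exact/subsetPset/ndG/leq_maxr.
move=> k; have [mF Fk] := Foo k; have [mG Gk] := Goo k; split.
  rewrite -[X in measurable X]setTI.
  by apply: measurable_rV_uncons => //; exact: measurableX.
rewrite /lebesgue_rVS /pushforward -comp_preimage.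
rewrite (_ : rV_uncons \o rV_cons = id); last first.
  by apply/funext => z /=; rewrite rV_consK.
rewrite preimage_id product_measure1E// lte_mul_pinfty//.
by rewrite ge0_fin_numE.
Qed.

HB.instance Definition _ := Measure_isSigmaFinite.Build _ _ _ lebesgue_rVS
  lebesgue_rVS_sigma_finite.

End lebesgue_rV.

(* Lebesgue measure on R^n. *)
Fixpoint lebesgue_rV (R : realType) (n : nat) :
    {sigma_finite_measure set 'rV[R]_n -> \bar R} :=
  match n with
  | 0 => @dirac _ 'rV[R]_0 0 R
  | k.+1 => lebesgue_rVS (lebesgue_rV R k)
  end.

Section heat.
Context (R : realType) (N : nat).
Implicit Types (f g : 'rV[R]_N -> R) (u v : R -> 'rV[R]_N -> R).
Implicit Types (x y : 'rV[R]_N) (t s a : R).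

(* The norm of 'rV[R]_N is the sup norm, so |x|^2 is written explicitly. *)
Definition heat_kernel t x : R :=
  (4 * pi * t) `^ (- (N%:R / 2)) *
  expR (- (\sum_(i < N) x ord0 i ^+ 2) / (4 * t)).

Definition heat_semigroup t f x : R :=
  \int[lebesgue_rV R N]_y (heat_kernel t (x - y) * f y).

Definition orthant (m : nat) : set 'rV[R]_N :=
  [set x | forall i : 'I_N, (i < m)%N -> 0 < x ord0 i].

Definition reflection (i : 'I_N) x : 'rV[R]_N :=
  \row_j (if j == i then - x ord0 j else x ord0 j).

Definition antisymmetric_upto (m : nat) f :=
  forall i : 'I_N, (i < m)%N -> forall x, f (reflection i x) = - f x.

Definition Cbu f := bounded_fun f /\ unif_continuous f.

Definition continuous_Cbu u := forall t, 0 < t ->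
  Cbu (u t) /\ {uniform, u s @[s --> t] --> u t}.

Definition nonlinearity a (r : R) : R := `|r| `^ a * r.

(* v0 stands for a representative of a class in L^oo(R^N). The last clause is
   the sense in which v0 is the initial value; it makes v bounded near t = 0,
   so that the time integral is absolutely convergent in the sup norm and its
   value at x is the integral of the values at x. *)
Definition mild_solution a (v0 : 'rV[R]_N -> R) v :=
  [/\ continuous_Cbu v,
      forall t x, 0 < t ->
        (@lebesgue_measure R).-integrable `]0, t[
          (fun s => (heat_semigroup (t - s) (nonlinearity a \o v s) x)%:E) /\
        v t x = heat_semigroup t v0 x -
          \int[lebesgue_measure]_(s in `]0, t[)
            heat_semigroup (t - s) (nonlinearity a \o v s) x &
      {uniform, (fun x => v t x - heat_semigroup t v0 x) @[t --> 0^'+]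
        --> (fun=> 0)}].

Definition basis_rV (i : 'I_N) : 'rV[R]_N := delta_mx ord0 i.

Definition dt u t x : R := 'D_1 (u ^~ x) t.
Definition dx (i : 'I_N) u t x : R := 'D_(basis_rV i) (u t) x.
Definition laplacian u t x : R := \sum_(i < N) dx i (dx i u) t x.

Definition continuous_pos u := forall t x, 0 < t ->
  {for (t, x), continuous (fun p : R * 'rV[R]_N => u p.1 p.2)}.

(* u is of class C^{1,2} on (0, oo) x R^N. *)
Definition C12 u :=
  [/\ continuous_pos u,
      continuous_pos (dt u) /\
        forall t x, 0 < t -> derivable (u ^~ x) t 1,
      forall i, continuous_pos (dx i u) /\
        forall t x, 0 < t -> derivable (u t) x (basis_rV i) &
      forall i j, continuous_pos (dx j (dx i u)) /\
        forall t x, 0 < t -> derivable (dx i u t) x (basis_rV j)].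

Definition classical_solution a u := C12 u /\
  forall t x, 0 < t -> dt u t x - laplacian u t x + `|u t x| `^ a * u t x = 0.

Definition dilation a (lam : R) u : R -> 'rV[R]_N -> R :=
  fun t x => lam `^ (2 / a) * u (lam ^+ 2 * t) (lam *: x).

Definition self_similar a u := forall lam, 0 < lam ->
  forall t x, 0 < t -> dilation a lam u t x = u t x.

Definition cvg_loc_unif (uu : R -> R -> 'rV[R]_N -> R) u :=
  forall K : set (R * 'rV[R]_N), compact K -> K `<=` [set p | 0 < p.1] ->
    {uniform K, (fun p => uu lam p.1 p.2) @[lam --> +oo] -->
      (fun p => u p.1 p.2)}.

End heat.

(* Main.v *)
(* On the orthant, the heat semigroup and the Duhamel integral preserve the
   order of antisymmetric functions: symmetrizing the Gaussian kernel turns the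
   factors exp (x_i y_i / 2t) into sinh (x_i y_i / 2t), which are positive there.
   Since r |-> L r - |r|^a r is increasing on bounded intervals for L large,
   monotone iteration of the equation for exp (L t) v yields a solution v with
   data h, squeezed on the orthant between p(t) e^(t Delta) h and
   p(t) = (1 + a t)^(-1/a), the solution of p' = - p^(a+1) with p(0) = 1; the
   same order structure gives a comparison principle for mild solutions.

   The rescalings W l of v have data l^(2/a) h, hence increase with l on the
   orthant, and are bounded by (a t)^(-1/a).  Their limit V is self-similar by
   construction, and the two bounds on v become the two bounds on g = V(1).
   At time l^-2 / a the bound (a t)^(-1/a) equals l^(2/a), so comparison from
   that time on gives V(t + l^-2 / a) <= W l (t) <= V(t) on the orthant, and
   continuity of V makes the convergence locally uniform.

   V restarted at a positive time is a bounded mild solution, so it is C^2 in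
   space by differentiating the kernel twice, one derivative being put on the
   bounded field f'(V) dV.  Self-similarity then makes V of class C^{1,2}, and
   the equation follows by dividing the mild formula on [t, t + s] by s, where
   (e^(s Delta) w - w) / s -> Delta w by Taylor's formula and the second moments
   of the Gaussian. *)
From HB Require Import structures.
Require Import Defs.
From mathcomp Require Import all_boot all_order all_algebra.
From mathcomp Require Import all_classical all_reals all_analysis.
From mathcomp Require Import measurable_realfun.
From mathcomp Require Import ring lra.
Import Order.TTheory GRing.Theory Num.Theory.
Import numFieldNormedType.Exports.
Local Open Scope classical_set_scope.
Local Open Scope ring_scope.

Set Implicit Arguments.
Unset Strict Implicit.
Unset Printing Implicit Defensive.

(** * Integration on R^n *)

(** Order is available only on the orthant. A positive constant is not antisymmetric, so majorants
    are multiples of [h], and estimates found on the orthant reach the other points through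
    [antisymmetric_reduce]. The damping L has to dominate f' on the range of the solutions; the
    supremum of f' on [-M, M] is (a + 1) M^a, the constant met throughout. The bound (a t)^(-1/a) on
    V degenerates at time 0, so V is studied from a time tau > 0 on. Two derivatives on the heat
    kernel cost (t - s)^(-1), which is not integrable; this forces the shift of one derivative onto
    the source. Continuity of the resulting derivatives comes from a Hoelder bound of weight (t -
    s)^(-3/4), the geometric mean of the weights (t - s)^(-1/2) and (t - s)^(-1). The limit is
    stated for every mild solution v, whereas the iteration builds one of them; a uniqueness proof
    closes this gap, and it first has to bound v on ]0, T]. *)

Section lebesgue_rV_integral.
Context {R : realType}.
Implicit Types n : nat.

Lemma ge0_integral_rVS n (F : 'rV[R]_n.+1 -> \bar R) :
  measurable_fun setT F -> (forall z, 0 <= F z)%E ->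
  (\int[lebesgue_rV R n.+1]_z F z =
   \int[lebesgue_measure]_x \int[lebesgue_rV R n]_y F (rV_cons (x, y)))%E.
Proof.
move=> mF F0.
rewrite -[LHS]/(\int[pushforward (lebesgue_measure \x lebesgue_rV R n)%E
   (@rV_cons R n)]_z F z)%E.
rewrite ge0_integral_pushforward//; last exact: measurable_rV_cons.
rewrite preimage_setT fubini_tonelli1//; last by move=> x /=.
by apply: measurableT_comp => //; exact: measurable_rV_cons.
Qed.

(** Uniqueness of Lebesgue measure: the weighted image measure has the right value on the intervals
    ]l, u]. For a < 0 their preimages are closed on the left instead of the right, which does not
    affect the length. *)
Lemma lebesgue_measure_affine (a b : R) (A : set R) : a != 0 -> measurable A ->
  (`|a|%:E * lebesgue_measure ((fun x : R => a * x + b)%R @^-1` A) =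
   lebesgue_measure A)%E.
Proof.
move=> a0 mA.
have mf : measurable_fun setT (fun x : measurableTypeR R => a * x + b : measurableTypeR R).
  by apply: measurable_funD => //; exact: measurable_funM.
pose phi : {mfun measurableTypeR R >-> measurableTypeR R} :=
  HB.pack (fun x : measurableTypeR R => a * x + b : measurableTypeR R)
    (isMeasurableFun.Build _ _ _ _ _ mf).
pose nu : {measure set (measurableTypeR R) -> \bar R} :=
  mscale (NngNum (normr_ge0 a)) (pushforward lebesgue_measure phi).
rewrite -[LHS]/(nu mf A); apply/esym/lebesgue_measure_unique => // _ [[l u]] _ <- /=.
rewrite /nu /= /mscale /= /pushforward lebesgue_measure_itv/= lte_fin -!EFinB.
have [ha|ha|/eqP] := ltgtP a 0; last by rewrite (negbTE a0).
- have -> : phi @^-1` `]l, u]%classic = `[(u - b) / a, (l - b) / a[%classic.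
    by apply/seteqP; split => x /=; rewrite !in_itv/= andbC ltr_ndivlMr// ler_ndivrMr// ltrBlDr lerBrDr mulrC.
  rewrite lebesgue_measure_itv/= lte_fin ltr_nM2r ?invr_lt0// ltrD2r.
  case: ifPn => _; last by rewrite mule0.
  by rewrite -EFinD -EFinM ltr0_norm//; congr EFin; field.
- have -> : phi @^-1` `]l, u]%classic = `](l - b) / a, (u - b) / a]%classic.
    by apply/seteqP; split => x /=; rewrite !in_itv/= ltr_pdivrMr// ler_pdivlMr// ltrBlDr lerBrDr mulrC.
  rewrite lebesgue_measure_itv/= lte_fin ltr_pM2r ?invr_gt0// ltrD2r.
  case: ifPn => _; last by rewrite mule0.
  by rewrite -EFinD -EFinM gtr0_norm//; congr EFin; field.
Qed.

Lemma ge0_integral_affine (a b : R) (F : R -> \bar R) : a != 0 ->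
  measurable_fun setT F -> (forall x, 0 <= F x)%E ->
  (`|a|%:E * \int[lebesgue_measure]_x F (a * x + b)%R =
  \int[lebesgue_measure]_x F x)%E.
Proof.
move=> a0 mF F0.
have mf : measurable_fun setT (fun x : measurableTypeR R => a * x + b : measurableTypeR R).
  by apply: measurable_funD => //; exact: measurable_funM.
pose phi : {mfun measurableTypeR R >-> measurableTypeR R} :=
  HB.pack (fun x : measurableTypeR R => a * x + b : measurableTypeR R)
    (isMeasurableFun.Build _ _ _ _ _ mf).
pose nu : {measure set (measurableTypeR R) -> \bar R} :=
  mscale (NngNum (normr_ge0 a)) (pushforward lebesgue_measure phi).
rewrite [RHS](@eq_measure_integral _ _ _ _ (nu mf))/=; last first.
  by move=> A mA _; rewrite -(lebesgue_measure_affine b a0).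
by rewrite ge0_integral_mscale//= ge0_integral_pushforward//= preimage_setT.
Qed.

(** Diagonal affine maps cover the changes of variable in R^n used later: y -> x - y, dilations,
    reflections and the stretching of one coordinate. Tonelli on the recursive definition of the
    measure treats the coordinates one at a time. *)
Lemma ge0_integral_rV_affine n (a b : 'I_n -> R) (F : 'rV[R]_n -> \bar R) :
  (forall i, a i != 0) -> measurable_fun setT F -> (forall z, 0 <= F z)%E ->
  ((\prod_i `|a i|)%:E * \int[lebesgue_rV R n]_y F (\row_i (a i * y ord0 i + b i))%R =
  \int[lebesgue_rV R n]_y F y)%E.
Proof.
elim: n a b F => [|n IH] a b F a0 mF F0.
  rewrite big_ord0 mul1e; apply: eq_integral => y _; congr F.
  by apply/rowP => -[].
have mG : measurable_fun setT (fun y : 'rV[R]_n.+1 => (\row_i (a i * y ord0 i + b i) : 'rV[R]_n.+1)).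
  apply: measurable_fun_rV => i; under eq_fun do rewrite mxE.
  by apply: measurable_funD => //; apply: measurable_funM => //; exact: measurable_coord_rV.
have mc (H : 'rV[R]_n.+1 -> \bar R) x : measurable_fun setT H -> measurable_fun setT (fun y : 'rV[R]_n => H (rV_cons (x, y))).
  move=> mH; apply: (measurableT_comp mH).
  apply: (measurableT_comp (@measurable_rV_cons R n)).
  exact: pair1_measurable.
have mI (H : 'rV[R]_n.+1 -> \bar R) : measurable_fun setT H -> (forall z, 0 <= H z)%E ->
   measurable_fun setT (fun x : R => \int[lebesgue_rV R n]_y H (rV_cons (x, y)))%E.
  move=> mH H0; apply: (measurable_fun_fubini_tonelli_F (H \o (@rV_cons R n))) => /=.
    by apply: measurableT_comp => //; exact: measurable_rV_cons.
  by move=> x /=.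
rewrite !ge0_integral_rVS//; last exact: measurableT_comp.
rewrite -[RHS](@ge0_integral_affine (a ord0) (b ord0))//; last 2 first.
- exact: mI.
- by move=> x; exact: integral_ge0.
rewrite big_ord_recl EFinM -muleA; congr (_ * _)%E.
have p0 : 0 <= \prod_(i < n) `|a (lift ord0 i)| by exact: prodr_ge0.
rewrite -ge0_integralZl//; last 2 first.
- exact: (mI (fun z => F (\row_i (a i * z ord0 i + b i)%R)) (measurableT_comp mF mG)).
- by move=> x _; exact: integral_ge0.
apply: eq_integral => x _.
rewrite -(IH (a \o lift ord0) (b \o lift ord0) (fun y => F (rV_cons (a ord0 * x + b ord0, y))))//=; last exact: mc.
congr (_ * _)%E; apply: eq_integral => y _; congr F; apply/rowP => i; rewrite !mxE.
by case: unliftP => [j|] ->; rewrite ?liftK ?unlift_none ?mxE.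
Qed.
End lebesgue_rV_integral.

Section continuous_measurable_rV.
Context {R : realType}.

Lemma le_coord_norm n (x : 'rV[R]_n) i : `|x ord0 i| <= `|x|.
Proof.
rewrite [leRHS]/Num.norm/= mx_normE.
rewrite -[leLHS]/((NngNum (normr_ge0 (x ord0 i)))%:num) num_le.
by apply/bigmax_geP; right; exists (ord0, i) => //; rewrite -num_le.
Qed.

Lemma norm_rV_le n (x : 'rV[R]_n) e : 0 <= e -> (forall i, `|x ord0 i| <= e) -> `|x| <= e.
Proof.
move=> e0 xe; rewrite [leLHS]/Num.norm/= mx_normE -[e]/((NngNum e0)%:num).
rewrite num_le; apply/bigmax_leP; split => // -[i0 i] _ /=.
by rewrite -num_le/= (ord1 i0).
Qed.

(* A ball of 'rV is a box, and balls with rational data form a countable base. *)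
Lemma open_measurable_rV n (U : set 'rV[R]_n) : open U -> measurable U.
Proof.
move=> oU.
pose box (q : 'rV[rat]_n * nat) : set 'rV[R]_n :=
  [set y | forall i, `|ratr (q.1 ord0 i) - y ord0 i| < q.2.+1%:R^-1].
have mbox q : measurable (box q).
  rewrite (_ : box q = \bigcap_(i in [set: 'I_n]) [set y | `|ratr (q.1 ord0 i) - y ord0 i| < q.2.+1%:R^-1]); last first.
    by apply/seteqP; split => y /= yq i => [_|]; exact: yq.
  apply: fin_bigcap_measurable => //= i _.
  have mf : measurable_fun setT (fun y : 'rV[R]_n => `|ratr (q.1 ord0 i) - y ord0 i|).
    by apply: measurableT_comp => //; apply: measurable_funB => //; exact: measurable_coord_rV.
  rewrite [X in measurable X](_ : _ = (fun y : 'rV[R]_n => `|ratr (q.1 ord0 i) - y ord0 i|) @^-1` `]-oo, q.2.+1%:R^-1[%classic).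
    by rewrite -[X in measurable X]setTI; exact: mf.
  by apply/seteqP; split => y /=; rewrite in_itv.
pose Q q := box q `<=` U.
(* A box that is not contained in U contributes the empty set, so that the union is indexed by a
   countable type. *)
rewrite (_ : U = \bigcup_q (if pselect (Q q) then box q else set0)); last first.
  apply/seteqP; split => [x Ux|x [q _]]; last by case: pselect => // Qq; exact: Qq.
  have /nbhs_ballP[e /= e0 xeU] : nbhs x U by exact: open_nbhs_nbhs.
  have [k ke] : exists k : nat, k.+1%:R^-1 < e / 2.
    have e20 : 0 < e / 2 by rewrite divr_gt0.
    exists (Num.trunc (e / 2)^-1).
    by rewrite -[ltRHS]invrK ltf_pV2 ?posrE ?invr_gt0// truncnS_gt.
  have k0 : 0 < k.+1%:R^-1 :> R by rewrite invr_gt0.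
  have /choice[q qx] : forall i, exists q, `|ratr q - x ord0 i| < k.+1%:R^-1.
    move=> i; have : x ord0 i - k.+1%:R^-1 < x ord0 i + k.+1%:R^-1.
      by rewrite ltrBlDr -addrA ltrDl addr_gt0.
    move=> /rat_in_itvoo[r]; rewrite in_itv/= -ltr_distl => rx; by exists r.
  exists (\row_i q i, k) => //; case: (pselect _) => [Qq|nQ].
    by move=> i /=; rewrite mxE.
  exfalso; apply: nQ => y /= yq; apply: xeU; rewrite mx_norm_ball /ball_/=.
  apply: (@le_lt_trans _ _ (k.+1%:R^-1 + k.+1%:R^-1)); last by rewrite [ltRHS]splitr ltrD.
  apply: norm_rV_le => [|i]; first by rewrite addr_ge0// ltW.
  rewrite !mxE (le_trans (ler_distD (ratr (q i)) _ _))// lerD//.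
    by rewrite distrC ltW.
  by have := yq i; rewrite mxE => /ltW.
apply: countable_bigcupT_measurable => [|q]; first exact: countableP.
by case: ifP => _; [exact: mbox|exact: measurable0].
Qed.

Lemma continuous_measurable_rV n (f : 'rV[R]_n -> R) : continuous f -> measurable_fun setT f.
Proof.
move=> cf; apply: (measurability _ (RGenOpens.measurableE R)) => _ [_ [a [b ->] <-]].
rewrite setTI; apply: open_measurable_rV.
apply: open_comp => [x _|]; [exact: cf|exact: interval_open].
Qed.

End continuous_measurable_rV.

(** * Domination, dominated convergence and Fubini for real-valued integrals *)

Section Rintegral_lemmas.
Context d (T : measurableType d) {R : realType} (mu : {measure set T -> \bar R}).
Variables (D : set T) (mD : measurable D).
Implicit Types f g : T -> R.

Lemma integrable_le f g : measurable_fun D f -> mu.-integrable D (EFin \o g) ->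
  (forall x, D x -> `|f x| <= g x) -> mu.-integrable D (EFin \o f).
Proof.
move=> mf ig fg; apply: (le_integrable mD _ _ ig) => [|x Dx /=].
  exact/measurable_EFinP.
by rewrite lee_fin (le_trans (fg _ Dx))// ler_norm.
Qed.

Lemma integrable_scale c f : mu.-integrable D (EFin \o f) ->
  mu.-integrable D (EFin \o (fun x => c * f x)).
Proof.
move=> fi; rewrite (_ : EFin \o _ = (fun x => c%:E * (EFin \o f) x)%E)//.
exact: integrableZl.
Qed.

Lemma integrable_add f g : mu.-integrable D (EFin \o f) -> mu.-integrable D (EFin \o g) ->
  mu.-integrable D (EFin \o (fun x => f x + g x)).
Proof.
move=> fi gi; rewrite (_ : EFin \o _ = (EFin \o f) \+ (EFin \o g))%E//.
exact: integrableD.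
Qed.

Lemma integrable_bounded f M : measurable_fun D f -> (mu D < +oo)%E ->
  (forall x, D x -> `|f x| <= M) -> mu.-integrable D (EFin \o f).
Proof.
move=> mf muD fM; apply: (@integrable_le f (cst M)) => //.
apply/integrableP; split; first exact/measurable_EFinP.
by rewrite /= integral_cst//= lte_mul_pinfty.
Qed.

Lemma normr_Rintegral_le f g : measurable_fun D f -> mu.-integrable D (EFin \o g) ->
  (forall x, D x -> `|f x| <= g x) ->
  `|\int[mu]_(x in D) f x| <= \int[mu]_(x in D) g x.
Proof.
move=> mf ig fg; have if_ := integrable_le mf ig fg.
rewrite (le_trans (le_normr_Rintegral mD if_))//; apply: le_Rintegral => //.
apply: (@integrable_le _ g) => // [|x Dx]; first exact: measurableT_comp.
by rewrite normr_id fg.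
Qed.

Lemma cvg_Rintegral (f_ : nat -> T -> R) f g : (forall n, measurable_fun D (f_ n)) ->
  mu.-integrable D (EFin \o g) -> (forall n x, D x -> `|f_ n x| <= g x) ->
  (forall x, D x -> f_ n x @[n --> \oo] --> f x) ->
  \int[mu]_(x in D) f_ n x @[n --> \oo] --> \int[mu]_(x in D) f x.
Proof.
move=> mf_ ig fg cf.
have mf : measurable_fun D f.
  apply/measurable_EFinP.
  apply: (emeasurable_fun_cvg (fun n x => (f_ n x)%:E)) => [n|x Dx].
    exact/measurable_EFinP.
  by apply: cvg_EFin; [exact: nearW|exact: cf].
apply: fine_cvg; rewrite fineK; last first.
  apply: integrable_fin_num => //; apply: (@integrable_le _ g) => // x Dx.
  have cfx : `|f_ n x| @[n --> \oo] --> `|f x| by apply: (@cvg_norm _ R^o); exact: cf.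
  rewrite -(cvg_lim (@Rhausdorff R) cfx).
  apply: limr_le; first by apply/cvg_ex; eexists; exact: cfx.
  by apply: nearW => n; exact: fg.
apply: (@dominated_cvg _ _ _ mu _ _ (fun n x => (f_ n x)%:E) _ (EFin \o g)) => //=.
- by move=> n; exact/measurable_EFinP.
- by move=> x Dx; apply: cvg_EFin; [exact: nearW|exact: cf].
Qed.

End Rintegral_lemmas.

Section Rintegral_product.
Context d1 d2 (T1 : measurableType d1) (T2 : measurableType d2) {R : realType}.
Variables (m1 : {sigma_finite_measure set T1 -> \bar R}).
Variables (m2 : {sigma_finite_measure set T2 -> \bar R}).

(** Tonelli applies to the positive and to the negative part, and [fine] is measurable, so
    parameters where the integral diverges do no harm. This makes heat semigroups and Duhamel
    integrals jointly measurable in their parameters. *)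
Lemma measurable_fun_Rintegral (f : T1 -> T2 -> R) :
  measurable_fun setT (fun z : T1 * T2 => f z.1 z.2) ->
  measurable_fun setT (fun x => \int[m2]_y f x y).
Proof.
move=> mf; apply: (measurableT_comp (fine_measurable measurableT)).
under eq_fun do rewrite integralE.
have mEf : measurable_fun setT (fun z : T1 * T2 => (f z.1 z.2)%:E).
  exact/measurable_EFinP.
apply: emeasurable_funB.
- rewrite [X in measurable_fun _ X](_ : _ =
    fubini_F m2 (fun z : T1 * T2 => (f z.1 z.2)%:E)^\+%E); last first.
    by apply/funext => x; apply: eq_integral => y _; rewrite !funeposE.
  by apply: measurable_fun_fubini_tonelli_F; [exact: measurable_funepos|exact: funepos_ge0].
- rewrite [X in measurable_fun _ X](_ : _ =
    fubini_F m2 (fun z : T1 * T2 => (f z.1 z.2)%:E)^\-%E); last first.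
    by apply/funext => x; apply: eq_integral => y _; rewrite !funenegE.
  by apply: measurable_fun_fubini_tonelli_F; [exact: measurable_funeneg|exact: funeneg_ge0].
Qed.

Lemma Rintegral_fubini (f : T1 -> T2 -> R) (a : T1 -> R) :
  measurable_fun setT (fun z : T1 * T2 => f z.1 z.2) ->
  m1.-integrable setT (EFin \o a) ->
  (forall x, \int[m2]_y `|(f x y)%:E| <= (a x)%:E)%E ->
  (forall y, m1.-integrable setT (fun x => (f x y)%:E)) ->
  \int[m1]_x \int[m2]_y f x y = \int[m2]_y \int[m1]_x f x y.
Proof.
move=> mf ia fa if1.
have mEf : measurable_fun setT (fun z : T1 * T2 => (f z.1 z.2)%:E).
  exact/measurable_EFinP.
have i12 : (m1 \x m2)%E.-integrable setT (fun z : T1 * T2 => (f z.1 z.2)%:E).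
  apply/integrable12ltyP => //=.
  have /integrableP[mEa aoo] := ia.
  apply: le_lt_trans aoo; apply: ge0_le_integral => //=.
  - by move=> x _; exact: integral_ge0.
  - apply: (measurable_fun_fubini_tonelli_F (fun z : T1 * T2 => `|(f z.1 z.2)%:E|%E)) => //.
    exact: measurableT_comp.
  - exact: (measurableT_comp (abse_measurable (D := setT)) mEa).
  - by move=> x _; rewrite (le_trans (fa x))// lee_fin ler_norm.
have if2 x : m2.-integrable setT (fun y => (f x y)%:E).
  apply/integrableP; split; last exact: le_lt_trans (fa x) (ltry _).
  exact: measurableT_comp mEf (pair1_measurable x).
rewrite /Rintegral; congr fine.
have := Fubini i12.
(* Each inner integral is finite by [if2], so the iterated integral of reals agrees with the
   extended-real one. *)
rewrite /=; under eq_integral do rewrite -(fineK (integrable_fin_num measurableT (if2 _))).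
move=> ->.
by apply: eq_integral => y _; rewrite fineK//; exact: integrable_fin_num.
Qed.

Lemma Rintegral_fubini_prod (f : T1 -> T2 -> R) (a : T1 -> R) (b : T2 -> R) :
  measurable_fun setT (fun z : T1 * T2 => f z.1 z.2) ->
  m1.-integrable setT (EFin \o a) -> m2.-integrable setT (EFin \o b) ->
  (forall x y, `|f x y| <= a x * b y) ->
  \int[m1]_x \int[m2]_y f x y = \int[m2]_y \int[m1]_x f x y.
Proof.
move=> mf ia ib fab.
have mfx x : measurable_fun setT (f x).
  exact: (measurableT_comp mf (pair1_measurable x)).
apply: (@Rintegral_fubini _ (fun x => \int[m2]_y b y * a x)) => //.
- exact: integrable_scale.
- move=> x; have iabx : m2.-integrable setT (fun y => (a x * b y)%:E).
    exact: integrable_scale.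
  rewrite mulrC -RintegralZl// /Rintegral fineK; last exact: integrable_fin_num.
  apply: ge0_le_integral => //=.
  + by apply/measurable_EFinP; exact: measurableT_comp.
  + by have /integrableP[] := iabx.
  + by move=> y _; rewrite lee_fin.
- move=> y; apply: (@integrable_le _ _ _ _ _ measurableT _ (fun x => b y * a x)).
  + exact: (measurableT_comp mf (pair2_measurable y)).
  + exact: integrable_scale.
  + by move=> x _; rewrite mulrC.
Qed.

End Rintegral_product.

(** * The heat kernel *)

Section heat_kernel.
Context {R : realType}.
Implicit Types (N : nat) (t s : R).

Definition sqnorm N (x : 'rV[R]_N) : R := \sum_(i < N) x ord0 i ^+ 2.

Lemma sqnorm_ge0 N (x : 'rV[R]_N) : 0 <= sqnorm x.
Proof. by apply: sumr_ge0 => i _; exact: sqr_ge0. Qed.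

Lemma sqr_coord_le N (x : 'rV[R]_N) i : x ord0 i ^+ 2 <= sqnorm x.
Proof.
by rewrite /sqnorm (bigD1 i)//= lerDl; apply: sumr_ge0 => j _; exact: sqr_ge0.
Qed.

Lemma heat_kernelE N t (x : 'rV[R]_N) :
  heat_kernel t x = (4 * pi * t) `^ (- (N%:R / 2)) * expR (- sqnorm x / (4 * t)).
Proof. by []. Qed.

Lemma heat_kernel_ge0 N t (x : 'rV[R]_N) : 0 <= heat_kernel t x.
Proof. by rewrite mulr_ge0 ?powR_ge0 ?expR_ge0. Qed.

Lemma normr_heat_kernel N t (x : 'rV[R]_N) : `|heat_kernel t x| = heat_kernel t x.
Proof. by rewrite ger0_norm// heat_kernel_ge0. Qed.

Lemma sqnormN N (x : 'rV[R]_N) : sqnorm (- x) = sqnorm x.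
Proof. by apply: eq_bigr => i _; rewrite mxE sqrrN. Qed.

Lemma heat_kernelN N t (x : 'rV[R]_N) : heat_kernel t (- x) = heat_kernel t x.
Proof. by rewrite !heat_kernelE sqnormN. Qed.

Lemma heat_kernelBC N t (x y : 'rV[R]_N) : heat_kernel t (x - y) = heat_kernel t (y - x).
Proof. by rewrite -heat_kernelN opprB. Qed.

Lemma measurable_fun_sum_ord d (T : measurableType d) n (F : 'I_n -> T -> R) :
  (forall i, measurable_fun setT (F i)) -> measurable_fun setT (fun x => \sum_(i < n) F i x).
Proof.
move=> mF; elim: n F mF => [|n IH] F mF.
  by rewrite [X in measurable_fun _ X](_ : _ = cst 0)//; apply/funext => x; rewrite big_ord0.
by under eq_fun do rewrite big_ord_recr; apply: measurable_funD => //; exact: IH.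
Qed.

Lemma measurable_sqnorm N : measurable_fun setT (@sqnorm N).
Proof.
apply: measurable_fun_sum_ord => i.
by apply: measurable_funX; exact: measurable_coord_rV.
Qed.

(** Inversion is discontinuous at 0. It is written as x (x^2)^(-1) with a real power, which is
    measurable on the whole line; at 0 both sides take the default value 0. *)
Lemma measurable_invr_fun : measurable_fun setT (fun x : R => x^-1).
Proof.
rewrite [X in measurable_fun _ X](_ : _ = (fun x => x * (x ^+ 2) `^ (-1))); last first.
  apply/funext => x; have [->|x0] := eqVneq x 0; first by rewrite invr0 mul0r.
  by rewrite powR_inv1 ?sqr_ge0// expr2 invfM mulrA divff ?mul1r.
apply: measurable_funM => //.
by apply: (measurableT_comp (measurable_powR _)) => //; exact: measurable_funX.
Qed.

Lemma measurable_heat_kernel N :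
  measurable_fun setT (fun z : R * 'rV[R]_N => heat_kernel z.1 z.2).
Proof.
apply: measurable_funM.
  apply: (measurableT_comp (measurable_powR _)) => //.
  by apply: measurable_funM => //.
apply: measurableT_comp => //; apply: measurable_funM => //.
  apply: measurableT_comp => //.
  exact: (measurableT_comp (@measurable_sqnorm N) measurable_snd).
apply: (measurableT_comp measurable_invr_fun) => //.
by apply: measurable_funM => //.
Qed.

Lemma measurable_heat_kernel_comp N d (T : measurableType d) (a : T -> R) (b : T -> 'rV[R]_N) :
  measurable_fun setT a -> measurable_fun setT b ->
  measurable_fun setT (fun z => heat_kernel (a z) (b z)).
Proof.
by move=> ma mb; exact: (measurableT_comp (@measurable_heat_kernel N) (measurable_fun_pair ma mb)).
Qed.

Definition gauss1 t (x : R) : R := (4 * pi * t) `^ (- 2^-1) * expR (- x ^+ 2 / (4 * t)).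

(** Splitting off the first coordinate yields the mass of the kernel by induction on the
    dimension. *)
Lemma heat_kernel_cons N t x (y : 'rV[R]_N) : 0 < t ->
  heat_kernel t (rV_cons (x, y)) = gauss1 t x * heat_kernel t y.
Proof.
move=> t0; rewrite !heat_kernelE /gauss1 mulrACA -powRD; last first.
  by apply/implyP => _; rewrite gt_eqF// mulr_gt0// mulr_gt0// pi_gt0.
congr (_ * _); first by congr powR; rewrite -natr1; field.
rewrite -expRD; congr expR; rewrite /sqnorm big_ord_recl mxE unlift_none/=.
rewrite opprD mulrDl; congr (_ + - _ / _).
by apply: eq_bigr => i _; rewrite mxE liftK.
Qed.

(** [gauss1 t] is the normal density of mean 0 and variance 2t. *)
Lemma integral_gauss1 t : 0 < t -> (\int[lebesgue_measure]_x (gauss1 t x)%:E = 1)%E.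
Proof.
move=> t0; rewrite -[RHS](@integral_normal_pdf R 0 (Num.sqrt (2 * t))).
have s0 : Num.sqrt (2 * t) != 0 by rewrite gt_eqF// sqrtr_gt0 mulr_gt0.
apply: eq_integral => x _; rewrite normal_pdfE//; congr EFin; rewrite /gauss1.
rewrite /normal_peak /normal_fun sqr_sqrtr ?mulr_ge0 ?(ltW t0)// subr0.
congr (_ * expR _).
  rewrite powRN powR12_sqrt; last by rewrite mulr_ge0 ?(ltW t0)// mulr_ge0// ltW// pi_gt0.
  by congr (Num.sqrt _)^-1; ring.
by congr (_ / _); ring.
Qed.

Lemma integral_heat_kernel N t : 0 < t ->
  (\int[lebesgue_rV R N]_x (heat_kernel t x)%:E = 1)%E.
Proof.
move=> t0.
have mK n : measurable_fun setT (fun x : 'rV[R]_n => (heat_kernel t x)%:E).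
  apply/measurable_EFinP.
  exact: (measurableT_comp (@measurable_heat_kernel n) (pair1_measurable t)).
elim: N => [|N IH].
  rewrite integral_dirac//; last exact: mK.
  rewrite diracT mul1e heat_kernelE /sqnorm big_ord0; congr EFin.
  rewrite [- 0 / _](_ : _ = 0) ?expR0 ?mul0r ?oppr0 ?powRr0 ?mulr1//.
  by rewrite ?oppr0 mul0r.
rewrite ge0_integral_rVS//; last by move=> z; rewrite lee_fin heat_kernel_ge0.
under eq_integral => x _.
  under eq_integral do rewrite heat_kernel_cons// EFinM.
  rewrite ge0_integralZl//; last 3 first.
  - exact: mK.
  - by move=> y _; rewrite lee_fin heat_kernel_ge0.
  - by rewrite lee_fin mulr_ge0 ?powR_ge0 ?expR_ge0.
  rewrite IH mule1; over.
exact: integral_gauss1.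
Qed.

(** Completing the square in y: the product is again a Gaussian in y, centred at a convex
    combination of x and z. Integrating y away then gives the semigroup law. *)
Lemma heat_kernel_mul N t s (x y z : 'rV[R]_N) : 0 < t -> 0 < s ->
  heat_kernel t (x - y) * heat_kernel s (y - z) =
  heat_kernel (t + s) (x - z) *
  heat_kernel (t * s / (t + s)) (y - ((s / (t + s)) *: x + (t / (t + s)) *: z)).
Proof.
move=> t0 s0; rewrite !heat_kernelE.
have ts0 : 0 < t + s by rewrite addr_gt0.
have pi0 := @pi_gt0 R.
have p4 (r : R) : 0 < r -> 0 <= 4 * pi * r.
  by move=> r0; rewrite mulr_ge0 ?(ltW r0)// mulr_ge0// ltW.
rewrite mulrACA -powRM ?p4// [RHS]mulrACA -powRM ?p4 ?divr_gt0 ?mulr_gt0//.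
congr (_ * _); first by congr powR; field; rewrite gt_eqF.
rewrite -!expRD; congr expR.
rewrite /sqnorm !mulNr -!opprD !mulr_suml -!big_split/=; congr (- _).
apply: eq_bigr => i _; rewrite !mxE; field.
by rewrite !gt_eqF.
Qed.

(** The ratio of the prefactors (4 pi t)^(-N/2) at times t and 2t: the price of giving up half of
    the Gaussian exponent to absorb a polynomial factor or a shift. *)
Definition dimc N : R := 2 `^ (N%:R / 2).

Lemma dimc_ge0 N : 0 <= dimc N. Proof. exact: powR_ge0. Qed.

Lemma heat_kernel_double N t (x : 'rV[R]_N) : 0 < t ->
  heat_kernel t x = dimc N * expR (- sqnorm x / (8 * t)) * heat_kernel (2 * t) x.
Proof.
move=> t0; rewrite !heat_kernelE mulrACA -expRD; congr (_ * expR _); last first.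
  by field; rewrite gt_eqF.
have -> : 4 * pi * (2 * t) = 2 * (4 * pi * t) :> R by ring.
rewrite [in RHS]powRM//; last by rewrite mulr_ge0 ?(ltW t0)// mulr_ge0// ltW// pi_gt0.
rewrite mulrA /dimc -powRD; last by rewrite implybE pnatr_eq0 orbT.
by rewrite subrr powRr0 mul1r.
Qed.

Lemma expRN_le_inv (u : R) : 0 <= u -> expR (- u) <= (1 + u)^-1.
Proof.
move=> u0; rewrite expRN lef_pV2 ?posrE ?expR_gt0//; first exact: expR_ge1Dx.
by rewrite ltr_pwDl.
Qed.

(** With u = |x|^2 / (8t), half of the Gaussian exponent is spent on u exp(-u) <= u / (1 + u) <= 1,
    and the other half is that of the kernel at time 2t. *)
Lemma sqnorm_heat_kernel_le N t (x : 'rV[R]_N) : 0 < t ->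
  sqnorm x * heat_kernel t x <= 8 * t * dimc N * heat_kernel (2 * t) x.
Proof.
move=> t0; rewrite (heat_kernel_double _ t0) 2!mulrA; apply: ler_wpM2r; first exact: heat_kernel_ge0.
rewrite mulrAC; apply: ler_wpM2r; first exact: dimc_ge0.
have u0 : 0 <= sqnorm x / (8 * t) by rewrite divr_ge0 ?sqnorm_ge0// mulr_ge0// ltW.
have t8 : 0 < 8 * t by rewrite mulr_gt0.
rewrite -[X in X * _](divfK (lt0r_neq0 t8)) mulrAC ler_piMl ?(ltW t8)//.
rewrite mulNr (le_trans (ler_wpM2l u0 (expRN_le_inv u0)))// ler_pdivrMr ?ltr_pwDl// mul1r.
by rewrite lerDr.
Qed.

Lemma coord_heat_kernel_le N t (x : 'rV[R]_N) i : 0 < t ->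
  `|x ord0 i| * heat_kernel t x <= dimc N * 2 * Num.sqrt t * heat_kernel (2 * t) x.
Proof.
move=> t0; rewrite (heat_kernel_double _ t0) mulrA.
rewrite ler_wpM2r ?heat_kernel_ge0// mulrCA -!mulrA.
rewrite ler_wpM2l ?dimc_ge0//.
set u := `|x ord0 i| / Num.sqrt t.
have st0 : 0 < Num.sqrt t by rewrite sqrtr_gt0.
have u0 : 0 <= u by rewrite divr_ge0// ltW.
have -> : `|x ord0 i| = u * Num.sqrt t by rewrite divfK ?gt_eqF.
rewrite mulrAC ler_wpM2r ?(ltW st0)//.
have uE : u ^+ 2 / 8 <= sqnorm x / (8 * t).
  rewrite invfM mulrA ler_pdivlMr// mulrAC ler_wpM2r//.
  rewrite /u exprMn exprVn sqr_sqrtr ?(ltW t0)// divfK ?gt_eqF//.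
  by rewrite real_normK ?num_real// sqr_coord_le.
have : expR (- sqnorm x / (8 * t)) <= (1 + u ^+ 2 / 8)^-1.
  apply: le_trans (expRN_le_inv _); last by rewrite divr_ge0 ?sqr_ge0.
  by rewrite ler_expR mulNr lerN2.
move=> /(ler_wpM2l u0)/le_trans; apply.
rewrite ler_pdivrMr; last by rewrite ltr_pwDl// divr_ge0 ?sqr_ge0.
(* The maximum of u / (1 + u^2 / 8) is below 2, because 2 (1 + u^2 / 8) - u is a square plus 1. *)
rewrite -subr_ge0 (_ : _ - _ = (u / 2 - 1) ^+ 2 + 1); last by field.
by rewrite addr_ge0 ?sqr_ge0.
Qed.

(** This is |x|^2 / 2 <= |x + w|^2 + |w|^2 in the exponent. One integrable function thus dominates
    the kernel for all shifts w of bounded size, as differentiation under the integral requires. *)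
Lemma heat_kernel_shift N t (x w : 'rV[R]_N) : 0 < t ->
  heat_kernel t (x + w) <= dimc N * expR (sqnorm w / (4 * t)) * heat_kernel (2 * t) x.
Proof.
move=> t0; rewrite !heat_kernelE mulrACA -expRD.
have -> : 4 * pi * (2 * t) = 2 * (4 * pi * t) :> R by ring.
rewrite [in leRHS]powRM//; last by rewrite mulr_ge0 ?(ltW t0)// mulr_ge0// ltW// pi_gt0.
rewrite [X in _ <= X * _](_ : _ = (4 * pi * t) `^ (- (N%:R / 2))); last first.
  rewrite mulrA /dimc -powRD; last by rewrite implybE pnatr_eq0 orbT.
  by rewrite subrr powRr0 mul1r.
rewrite ler_wpM2l ?powR_ge0// ler_expR.
have -> : sqnorm w / (4 * t) + - sqnorm x / (4 * (2 * t)) = (sqnorm w - sqnorm x / 2) / (4 * t).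
  by field; rewrite gt_eqF.
rewrite ler_wpM2r ?invr_ge0 ?mulr_ge0 ?(ltW t0)//.
rewrite lerNl opprB lerBlDr ler_pdivrMr// /sqnorm -big_split/= mulr_suml.
apply: ler_sum => i _; rewrite !mxE.
have := sqr_ge0 (x ord0 i + 2 * w ord0 i); lra.
Qed.

End heat_kernel.

(* Otherwise unification unfolds the kernel, which makes rewriting very slow. *)
Opaque heat_kernel.

(** * Changes of variable for real-valued integrals *)

Section change_of_variable.
Context d (T : measurableType d) {R : realType} (mu : {measure set T -> \bar R}).
Variables (h : T -> T) (c : R).
Hypotheses (mh : measurable_fun setT h) (c0 : 0 < c).
Hypothesis ge0_cov : forall F : T -> \bar R, measurable_fun setT F ->
  (forall x, 0 <= F x)%E -> (c%:E * \int[mu]_y F (h y) = \int[mu]_y F y)%E.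

Lemma integrable_change_of_variable (G : T -> R) :
  mu.-integrable setT (EFin \o G) -> mu.-integrable setT (EFin \o (G \o h)).
Proof.
move=> /integrableP[mG Goo]; apply/integrableP; split.
  exact: (measurableT_comp mG).
rewrite -ge0_cov// in Goo; last exact: measurableT_comp.
rewrite ltey; apply/eqP => Ioo; move: Goo.
by rewrite [X in (_ * X)%E](_ : _ = +oo%E)// gt0_muley ?ltxx// lte_fin.
Qed.

Lemma Rintegral_change_of_variable (G : T -> R) : mu.-integrable setT (EFin \o G) ->
  \int[mu]_y G y = c * \int[mu]_y G (h y).
Proof.
move=> iG; have iGT := integrable_change_of_variable iG.
rewrite /Rintegral -[c in RHS]/(fine c%:E) -fineM//; last exact: integrable_fin_num.
congr fine; have /integrableP[mG _] := iG; have /integrableP[mGT _] := iGT.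
rewrite [LHS]integralE [in RHS]integralE muleBr//; last first.
  apply: fin_num_adde_defl; rewrite fin_numN.
  exact: integrable_neg_fin_num iGT.
congr (_ - _)%E; rewrite -ge0_cov//.
- by congr (_ * _)%E; apply: eq_integral => y _; rewrite !funeposE.
- exact: measurable_funepos.
- by congr (_ * _)%E; apply: eq_integral => y _; rewrite !funenegE.
- exact: measurable_funeneg.
Qed.
End change_of_variable.

Section affine_change_of_variable.
Context {R : realType}.

Lemma integrable_rV_affine N (a b : 'I_N -> R) (G : 'rV[R]_N -> R) :
  (forall i, a i != 0) -> (lebesgue_rV R N).-integrable setT (EFin \o G) ->
  (lebesgue_rV R N).-integrable setT
    (EFin \o (fun y => G (\row_i (a i * y ord0 i + b i)))).
Proof.
move=> a0; apply: (@integrable_change_of_variable _ _ _ _ _ (\prod_i `|a i|)).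
- apply: measurable_fun_rV => i; under eq_fun do rewrite mxE.
  by apply: measurable_funD => //; apply: measurable_funM => //; exact: measurable_coord_rV.
- by apply: prodr_gt0 => i _; rewrite normr_gt0.
- by move=> F mF F0; exact: ge0_integral_rV_affine.
Qed.

Lemma Rintegral_rV_affine N (a b : 'I_N -> R) (c : R) (G : 'rV[R]_N -> R) :
  (forall i, a i != 0) -> \prod_i `|a i| = c ->
  (lebesgue_rV R N).-integrable setT (EFin \o G) ->
  \int[lebesgue_rV R N]_y G y =
  c * \int[lebesgue_rV R N]_y G (\row_i (a i * y ord0 i + b i)).
Proof.
move=> a0 <-; apply: Rintegral_change_of_variable.
- apply: measurable_fun_rV => i; under eq_fun do rewrite mxE.
  by apply: measurable_funD => //; apply: measurable_funM => //; exact: measurable_coord_rV.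
- by apply: prodr_gt0 => i _; rewrite normr_gt0.
- by move=> F mF F0; exact: ge0_integral_rV_affine.
Qed.

Lemma Rintegral_affine (a b : R) (G : R -> R) : a != 0 ->
  lebesgue_measure.-integrable setT (EFin \o G) ->
  \int[lebesgue_measure]_y G y = `|a| * \int[lebesgue_measure]_y G (a * y + b).
Proof.
move=> a0; apply: Rintegral_change_of_variable.
- by apply: measurable_funD => //; exact: measurable_funM.
- by rewrite normr_gt0.
- by move=> F mF F0; exact: ge0_integral_affine.
Qed.
End affine_change_of_variable.

(** * The heat semigroup on bounded measurable functions *)

Section heat_semigroup_bounded.
Context {R : realType} (N : nat).
Notation leb := (lebesgue_rV R N).
Implicit Types (f g : 'rV[R]_N -> R) (x y : 'rV[R]_N) (t s M : R).

Lemma measurable_rVB x : measurable_fun setT (fun y : 'rV[R]_N => x - y).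
Proof.
apply: measurable_fun_rV => i; under eq_fun do rewrite !mxE.
by apply: measurable_funB => //; exact: measurable_coord_rV.
Qed.

Lemma integrable_rVB x (G : 'rV[R]_N -> R) : leb.-integrable setT (EFin \o G) ->
  leb.-integrable setT (EFin \o (fun y => G (x - y))).
Proof.
move=> iG; have n0 (i : 'I_N) : -1 != 0 :> R by rewrite oppr_eq0 oner_neq0.
have := @integrable_rV_affine R N (fun=> -1) (fun i => x ord0 i) _ n0 iG.
congr (_.-integrable _ _); apply/funext => y /=; congr (G _)%:E.
by apply/rowP => i; rewrite !mxE mulN1r addrC.
Qed.

Lemma Rintegral_rVB x (G : 'rV[R]_N -> R) : leb.-integrable setT (EFin \o G) ->
  \int[leb]_y G (x - y) = \int[leb]_y G y.
Proof.
move=> iG; have n0 (i : 'I_N) : -1 != 0 :> R by rewrite oppr_eq0 oner_neq0.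
rewrite (@Rintegral_rV_affine R N (fun=> -1) (fun i => x ord0 i) 1 _ n0 _ iG); last first.
  by rewrite big1// => i _; rewrite normrN1.
rewrite mul1r; apply: eq_Rintegral => y _; congr G.
by apply/rowP => i; rewrite !mxE mulN1r addrC.
Qed.

Lemma integrable_heat_kernel t : 0 < t ->
  leb.-integrable setT (fun y => (heat_kernel t y)%:E).
Proof.
move=> t0; have mK : measurable_fun setT (fun x : 'rV[R]_N => (heat_kernel t x)%:E).
  apply/measurable_EFinP.
  exact: (measurableT_comp (@measurable_heat_kernel R N) (pair1_measurable t)).
apply/integrableP; split => //.
under eq_integral do rewrite /= ger0_norm ?heat_kernel_ge0//.
by rewrite integral_heat_kernel// ltry.
Qed.

Lemma integrable_heat_kernelB t x : 0 < t ->
  leb.-integrable setT (fun y => (heat_kernel t (x - y))%:E).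
Proof. by move=> t0; exact: (integrable_rVB x (integrable_heat_kernel t0)). Qed.

Lemma Rintegral_heat_kernel t : 0 < t -> \int[leb]_y heat_kernel t y = 1.
Proof. by move=> t0; rewrite /Rintegral integral_heat_kernel. Qed.

Lemma Rintegral_heat_kernelB t x : 0 < t -> \int[leb]_y heat_kernel t (x - y) = 1.
Proof.
move=> t0; rewrite (@Rintegral_rVB x (heat_kernel t)) ?Rintegral_heat_kernel//.
exact: integrable_heat_kernel.
Qed.

Lemma measurable_heat_kernelB t x :
  measurable_fun setT (fun y : 'rV[R]_N => heat_kernel t (x - y)).
Proof.
by apply: measurable_heat_kernel_comp => //; exact: measurable_rVB.
Qed.

Lemma integrable_heat t x f M : 0 < t -> measurable_fun setT f -> (forall y, `|f y| <= M) ->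
  leb.-integrable setT (fun y => (heat_kernel t (x - y) * f y)%:E).
Proof.
move=> t0 mf fM; apply: (@integrable_le _ _ _ _ _ measurableT _ (fun y => M * heat_kernel t (x - y))) => //.
- by apply: measurable_funM => //; exact: measurable_heat_kernelB.
- by apply: integrable_scale => //; exact: integrable_heat_kernelB.
- by move=> y _; rewrite normrM normr_heat_kernel mulrC ler_wpM2r ?heat_kernel_ge0.
Qed.

Lemma heat_semigroupD t f g M : 0 < t -> measurable_fun setT f -> (forall y, `|f y| <= M) ->
  measurable_fun setT g -> (forall y, `|g y| <= M) ->
  forall x, heat_semigroup t (fun y => f y + g y) x = heat_semigroup t f x + heat_semigroup t g x.
Proof.
move=> t0 mf fM mg gM x; rewrite /heat_semigroup -RintegralD//.
- by apply: eq_Rintegral => y _; rewrite mulrDr.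
- exact: integrable_heat fM.
- exact: integrable_heat gM.
Qed.

Lemma heat_semigroupB t f g M : 0 < t -> measurable_fun setT f -> (forall y, `|f y| <= M) ->
  measurable_fun setT g -> (forall y, `|g y| <= M) ->
  forall x, heat_semigroup t (fun y => f y - g y) x = heat_semigroup t f x - heat_semigroup t g x.
Proof.
move=> t0 mf fM mg gM x; rewrite /heat_semigroup -RintegralB//.
- by apply: eq_Rintegral => y _; rewrite mulrBr.
- exact: integrable_heat fM.
- exact: integrable_heat gM.
Qed.

Lemma heat_semigroupZ t f c M : 0 < t -> measurable_fun setT f -> (forall y, `|f y| <= M) ->
  forall x, heat_semigroup t (fun y => c * f y) x = c * heat_semigroup t f x.
Proof.
move=> t0 mf fM x; rewrite /heat_semigroup -RintegralZl//; last exact: integrable_heat fM.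
by apply: eq_Rintegral => y _; rewrite mulrCA.
Qed.

Lemma heat_semigroup_cst t c x : 0 < t -> heat_semigroup t (fun=> c) x = c.
Proof.
move=> t0; rewrite /heat_semigroup RintegralZr//.
  by rewrite Rintegral_heat_kernelB// mul1r.
exact: integrable_heat_kernelB.
Qed.

Lemma normr_heat_semigroup_le t f M : 0 < t -> measurable_fun setT f -> (forall y, `|f y| <= M) ->
  forall x, `|heat_semigroup t f x| <= M.
Proof.
move=> t0 mf fM x.
rewrite -[leRHS](heat_semigroup_cst M x t0); apply: normr_Rintegral_le => //.
- by apply: measurable_funM => //; exact: measurable_heat_kernelB.
- apply: (@integrable_heat _ _ _ `|M|) => // y; exact: lexx.
- by move=> y _; rewrite normrM normr_heat_kernel ler_wpM2l ?heat_kernel_ge0.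
Qed.

Lemma measurable_heat_semigroup_param d (T : measurableType d) (a : T -> R)
    (b : T -> 'rV[R]_N) (F : T -> 'rV[R]_N -> R) :
  measurable_fun setT a -> measurable_fun setT b ->
  measurable_fun setT (fun z : T * 'rV[R]_N => F z.1 z.2) ->
  measurable_fun setT (fun z => heat_semigroup (a z) (F z) (b z)).
Proof.
move=> ma mb mF; apply: (@measurable_fun_Rintegral _ _ _ _ _ _ (fun z y => heat_kernel (a z) (b z - y) * F z y)).
apply: measurable_funM => //.
apply: measurable_heat_kernel_comp; first exact: (measurableT_comp ma).
apply: measurable_fun_rV => i; under eq_fun do rewrite !mxE.
apply: measurable_funB.
  exact: (measurableT_comp (measurable_coord_rV i) (measurableT_comp mb measurable_fst)).
exact: (measurableT_comp (measurable_coord_rV i) measurable_snd).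
Qed.

Lemma measurable_heat_semigroup t f : measurable_fun setT f ->
  measurable_fun setT (heat_semigroup t f).
Proof.
move=> mf; apply: (@measurable_heat_semigroup_param _ _ (fun=> t) id (fun=> f)) => //.
exact: (measurableT_comp mf).
Qed.

(** [heat_kernel_mul] confines the intermediate variable to a kernel of mass 1, and Fubini allows
    integrating it first. *)
Lemma heat_semigroup_add t s f M : 0 < t -> 0 < s -> measurable_fun setT f ->
  (forall y, `|f y| <= M) ->
  forall x, heat_semigroup t (heat_semigroup s f) x = heat_semigroup (t + s) f x.
Proof.
move=> t0 s0 mf fM x; rewrite {1}/heat_semigroup.
have ts0 : 0 < t + s by rewrite addr_gt0.
have iKf y : leb.-integrable setT (fun z => (heat_kernel s (y - z) * f z)%:E).
  exact: integrable_heat fM.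
rewrite (@eq_Rintegral _ _ _ _ _ (fun y => \int[leb]_z
  (heat_kernel t (x - y) * (heat_kernel s (y - z) * f z)))); last first.
  by move=> y _; rewrite RintegralZl//; exact: iKf.
have mKf : measurable_fun setT (fun z : 'rV[R]_N * 'rV[R]_N =>
    heat_kernel t (x - z.1) * (heat_kernel s (z.1 - z.2) * f z.2)).
  have mB1 : measurable_fun setT (fun z : 'rV[R]_N * 'rV[R]_N => x - z.1).
    exact: (measurableT_comp (measurable_rVB x)).
  have mB2 : measurable_fun setT (fun z : 'rV[R]_N * 'rV[R]_N => z.1 - z.2).
    apply: measurable_fun_rV => i; under eq_fun do rewrite !mxE.
    apply: measurable_funB.
      exact: (measurableT_comp (measurable_coord_rV i) measurable_fst).
    exact: (measurableT_comp (measurable_coord_rV i) measurable_snd).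
  apply: measurable_funM; first exact: measurable_heat_kernel_comp.
  apply: measurable_funM; first exact: measurable_heat_kernel_comp.
  exact: (measurableT_comp mf).
have kE y z : heat_kernel t (x - y) * (heat_kernel s (y - z) * f z) =
   heat_kernel (t + s) (x - z) * f z * heat_kernel (t * s / (t + s))
     ((s / (t + s)) *: x + (t / (t + s)) *: z - y).
  by rewrite mulrA heat_kernel_mul// mulrAC; congr (_ * _); exact: heat_kernelBC.
have tts0 : 0 < t * s / (t + s) by rewrite divr_gt0// mulr_gt0.
rewrite (@Rintegral_fubini _ _ _ _ _ leb leb
   (fun y z => heat_kernel t (x - y) * (heat_kernel s (y - z) * f z))
   (fun y => `|M| * heat_kernel t (x - y)))//.
- apply: eq_Rintegral => z _.
  under eq_Rintegral do rewrite kE.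
  rewrite RintegralZl//; last exact: integrable_heat_kernelB.
  by rewrite Rintegral_heat_kernelB// mulr1.
- by apply: integrable_scale => //; exact: integrable_heat_kernelB.
- move=> y.
  rewrite (@eq_integral _ _ _ _ _ (fun z : 'rV[R]_N => ((heat_kernel t (x - y))%:E * (heat_kernel s (y - z) * `|f z|)%:E)%E)); last first.
    by move=> z _; rewrite -EFinM /= normrM (normrM (heat_kernel s _)) !normr_heat_kernel.
  have mfs : measurable_fun setT (fun z : 'rV[R]_N => heat_kernel s (y - z) * `|f z|).
    apply: measurable_funM; first exact: measurable_heat_kernelB.
    exact: measurableT_comp.
  rewrite ge0_integralZl//; last 3 first.
  + exact/measurable_EFinP.
  + by move=> z _; rewrite lee_fin mulr_ge0// heat_kernel_ge0.
  + by rewrite lee_fin heat_kernel_ge0.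
  have mnf : measurable_fun setT (fun z : 'rV[R]_N => `|f z|) by exact: measurableT_comp.
  have nfM z : `| `|f z| | <= `|M| by rewrite normr_id (le_trans (fM z))// ler_norm.
  rewrite -[X in (_ * X <= _)%E]fineK; last exact/integrable_fin_num/(integrable_heat _ s0 mnf nfM).
  rewrite -EFinM lee_fin [leRHS]mulrC ler_wpM2l ?heat_kernel_ge0//.
  rewrite (le_trans _ (normr_heat_semigroup_le s0 mnf nfM y))//.
  exact: ler_norm.
- move=> z; under eq_fun do rewrite kE.
  by apply: integrable_scale => //; exact: integrable_heat_kernelB.
Qed.

Lemma heat_semigroup_scale t (l : R) f M : 0 < t -> 0 < l -> measurable_fun setT f ->
  (forall y, `|f y| <= M) -> forall x,
  heat_semigroup (l ^+ 2 * t) f (l *: x) = heat_semigroup t (fun y => f (l *: y)) x.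
Proof.
move=> t0 l0 mf fM x; rewrite /heat_semigroup.
have l2t : 0 < l ^+ 2 * t by rewrite mulr_gt0// exprn_gt0.
rewrite (@Rintegral_rV_affine R N (fun=> l) (fun=> 0) (l ^+ N)); first last.
- exact: integrable_heat fM.
- rewrite -[in RHS](card_ord N) -prodr_const; apply: eq_bigr => i _; exact: gtr0_norm.
- by move=> i; rewrite gt_eqF.
have lE (y : 'rV[R]_N) : \row_i (l * y ord0 i + 0) = l *: y.
  by apply/rowP => i; rewrite !mxE addr0.
under eq_Rintegral do rewrite lE -scalerBr.
have kE (y : 'rV[R]_N) : heat_kernel t y = l ^+ N * heat_kernel (l ^+ 2 * t) (l *: y).
  have l0' : l != 0 by rewrite gt_eqF.
  have t0' : t != 0 by rewrite gt_eqF.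
  have pt : 0 <= 4 * pi * t by rewrite mulr_ge0 ?(ltW t0)// mulr_ge0// ltW// pi_gt0.
  rewrite !heat_kernelE mulrA; congr (_ * expR _); last first.
    rewrite /sqnorm; under [in RHS]eq_bigr do rewrite mxE exprMn.
    by rewrite -mulr_sumr; field; rewrite l0' t0'.
  have -> : 4 * pi * (l ^+ 2 * t) = l ^+ 2 * (4 * pi * t) by ring.
  rewrite [in RHS]powRM ?sqr_ge0// mulrA -!powR_mulrn ?(ltW l0)// -powRrM -powRD.
    by rewrite [X in l `^ X](_ : _ = 0) ?powRr0 ?mul1r//; field.
  by rewrite l0' implybT.
under [in RHS]eq_Rintegral do rewrite kE -mulrA.
rewrite RintegralZl//.
have n0 (i : 'I_N) : l != 0 by rewrite gt_eqF.
have := @integrable_rV_affine R N (fun=> l) (fun=> 0) _ n0 (@integrable_heat _ (l *: x) _ _ l2t mf fM).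
congr (_.-integrable _ _); apply/funext => y /=.
by rewrite lE -scalerBr.
Qed.

End heat_semigroup_bounded.

(** * Antisymmetric functions *)

Section antisymmetry.
Context {R : realType} (N : nat).
Notation leb := (lebesgue_rV R N).
Implicit Types (f g : 'rV[R]_N -> R) (x y : 'rV[R]_N) (t s M : R) (m : nat).

Lemma reflectionB i x y : reflection i (x - y) = reflection i x - reflection i y.
Proof. by apply/rowP => j; rewrite !mxE; case: eqP => // _; rewrite opprB opprK addrC. Qed.

Lemma sqnorm_reflection i x : sqnorm (reflection i x) = sqnorm x.
Proof. by apply: eq_bigr => j _; rewrite mxE; case: eqP => // _; rewrite sqrrN. Qed.

Lemma heat_kernel_reflection t i x : heat_kernel t (reflection i x) = heat_kernel t x.
Proof. by rewrite !heat_kernelE sqnorm_reflection. Qed.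

Let rslope (i j : 'I_N) : R := if j == i then -1 else 1.

Let rslope0 i j : rslope i j != 0.
Proof. by rewrite /rslope; case: ifP => _; rewrite -normr_gt0 ?normrN1 ?normr1. Qed.

Let reflectionE i x : \row_j (rslope i j * x ord0 j + 0) = reflection i x.
Proof. by apply/rowP => j; rewrite !mxE addr0 /rslope; case: eqP; rewrite ?mulN1r ?mul1r. Qed.

Lemma integrable_reflection i (G : 'rV[R]_N -> R) :
  leb.-integrable setT (EFin \o G) ->
  leb.-integrable setT (EFin \o (G \o reflection i)).
Proof.
move=> iG; have := @integrable_rV_affine R N (rslope i) (fun=> 0) _ (rslope0 i) iG.
by congr (_.-integrable _ _); apply/funext => y /=; rewrite reflectionE.
Qed.

Lemma Rintegral_reflection i (G : 'rV[R]_N -> R) :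
  leb.-integrable setT (EFin \o G) ->
  \int[leb]_y G (reflection i y) = \int[leb]_y G y.
Proof.
move=> iG; rewrite (@Rintegral_rV_affine R N (rslope i) (fun=> 0) 1 _ (rslope0 i) _ iG).
  by rewrite mul1r; apply: eq_Rintegral => y _; rewrite reflectionE.
by rewrite big1// => j _; rewrite /rslope; case: eqP; rewrite ?normrN1 ?normr1.
Qed.

Lemma antisymmetric_heat_semigroup m t f M : 0 < t -> measurable_fun setT f ->
  (forall y, `|f y| <= M) -> antisymmetric_upto m f ->
  antisymmetric_upto m (heat_semigroup t f).
Proof.
move=> t0 mf fM af i im x; rewrite /heat_semigroup.
have iKf := integrable_heat (reflection i x) t0 mf fM.
rewrite -(@Rintegral_reflection i _ iKf) -mulN1r -RintegralZl//; last exact: integrable_heat fM.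
apply: eq_Rintegral => y _.
by rewrite -reflectionB heat_kernel_reflection af// mulN1r mulrN.
Qed.

(** This is the function [h] of the theorem in closed form, with value 0 on the first m coordinate
    hyperplanes. *)
Definition sgprod m y : R := \prod_(i < N | (i < m)%N) Num.sg (y ord0 i).

(* An antisymmetric function is determined by its values on the orthant. *)
Lemma antisymmetric_reduce m y :
  (sgprod m y = 0 /\ forall f, antisymmetric_upto m f -> f y = 0) \/
  exists2 z, orthant m z & (forall i : 'I_N, (i < m)%N -> z ord0 i = Num.sg (y ord0 i) * y ord0 i) /\
    (sgprod m y != 0 /\ forall f, antisymmetric_upto m f -> f y = sgprod m y * f z).
Proof.
have [/existsP[i /andP[im /eqP y0]]|] := boolP [exists i : 'I_N, (i < m)%N && (y ord0 i == 0)].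
  (* A point with i-th coordinate 0 is fixed by the reflection in that coordinate, hence f y = - f
     y. *)
  left; split; first by rewrite /sgprod (bigD1 i)//= y0 sgr0 mul0r.
  move=> f /(_ i im y); rewrite (_ : reflection i y = y); first by move=> h; lra.
  by apply/rowP => j; rewrite mxE; case: eqP => // ->; rewrite y0 oppr0.
rewrite negb_exists => /forallP y0; right.
(* Coordinates are made positive one index at a time: passing from k to k + 1 costs at most one
   reflection, hence at most one sign, and [z N] lies in the orthant. *)
pose z k : 'rV[R]_N := \row_i (if ((i < k) && (i < m))%N then Num.sg (y ord0 i) * y ord0 i else y ord0 i).
have yn0 (i : 'I_N) : (i < m)%N -> y ord0 i != 0 by move=> im; have := y0 i; rewrite im.
have zf f k : antisymmetric_upto m f ->
    f y = (\prod_(i < N | (i < m)%N && (i < k)%N) Num.sg (y ord0 i)) * f (z k).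
  move=> af; elim: k => [|k IH].
    rewrite big_pred0 => [|i]; last by rewrite ltn0 andbF.
    by rewrite mul1r; congr f; apply/rowP => i; rewrite mxE ltn0.
  have [/andP[kN km]|kNm] := boolP ((k < N) && (k < m))%N; last first.
    have iltk (i : 'I_N) : ((i < k.+1) && (i < m) = (i < k) && (i < m))%N.
      rewrite ltnS leq_eqVlt; case: eqP => //= ik; move: kNm.
      by rewrite -ik ltn_ord/= => /negbTE ->; rewrite andbF.
    rewrite IH; congr (_ * f _).
      by apply: eq_bigl => i; rewrite andbC -iltk andbC.
    by apply/rowP => i; rewrite !mxE iltk.
  pose i0 := Ordinal kN.
  rewrite IH (bigD1 (P := fun i : 'I_N => (i < m)%N && (i < k.+1)%N) i0) /=; last by rewrite km ltnSn.
  rewrite [in RHS](eq_bigl (fun i : 'I_N => (i < m)%N && (i < k)%N)); last first.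
    move=> i; rewrite ltnS -andbA; congr (_ && _).
    have [->|ii0] := eqVneq i i0; first by rewrite /= ltnn andbF.
    by rewrite andbT (ltn_neqAle i k) (_ : i != k :> nat).
  rewrite -mulrA mulrCA; congr (_ * _).
  have iltk (i : 'I_N) : i != i0 -> (i < k.+1)%N = (i < k)%N.
    by move=> ii0; rewrite ltnS (ltn_neqAle i k) (_ : i != k :> nat).
  have [yneg|ypos|/eqP] := ltgtP (y ord0 i0) 0; last by rewrite (negbTE (yn0 i0 km)).
    rewrite ltr0_sg// mulN1r -(af i0 km); congr f; apply/rowP => i; rewrite !mxE.
    have [->/=|/iltk ->//] := eqVneq i i0.
    by rewrite ltnn ltnSn /= km/= ltr0_sg// mulN1r opprK.
  rewrite gtr0_sg// mul1r; congr f; apply/rowP => i; rewrite !mxE.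
  have [->/=|/iltk ->//] := eqVneq i i0.
  by rewrite ltnn ltnSn/= km/= gtr0_sg// mul1r.
exists (z N).
  by move=> i im; rewrite mxE ltn_ord im/= -normrEsg normr_gt0 yn0.
split; first by move=> i im; rewrite mxE ltn_ord im.
split; first by apply/prodf_neq0 => i im; rewrite sgr_eq0 yn0.
move=> f af; rewrite (zf f N af); congr (_ * _).
by apply: eq_bigl => i; rewrite ltn_ord andbT.
Qed.

(** The odd factors c_i and the antisymmetric f change sign together, so the product is even under
    each reflection and inherits its sign from the orthant. *)
Lemma antisymmetric_cone m f : antisymmetric_upto m f ->
  (forall y, orthant m y -> 0 <= f y) ->
  forall c : 'I_N -> R -> R,
  (forall (i : 'I_N) r, (i < m)%N -> 0 < r -> 0 <= c i r) -> (forall i r, c i (- r) = - c i r) ->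
  forall y, 0 <= (\prod_(i < N | (i < m)%N) c i (y ord0 i)) * f y.
Proof.
move=> af f0 c c0 cN y.
have [[_ ->//]|[z zm [zy [_ ->//]]]] := antisymmetric_reduce m y; first by rewrite mulr0.
rewrite mulrA mulr_ge0 ?f0// /sgprod -big_split/=; apply: prodr_ge0 => i im.
have := zm i im; rewrite zy//; have [y0|y0|->] := ltgtP (y ord0 i) 0.
- rewrite ltr0_sg// mulN1r => y0'; rewrite mulrN1 -cN; exact: c0.
- by rewrite gtr0_sg// mul1r mulr1 => _; exact: c0.
- by rewrite mulr0 ltxx.
Qed.

(* Symmetrizing the kernel in one coordinate at a time does not change the
   integral against an antisymmetric function, and turns the factors
   exp (x_i y_i / 2t) with i < m into sinh (x_i y_i / 2t). *)
Lemma heat_semigroup_orthant_ge0 m t f M : 0 < t -> measurable_fun setT f ->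
  (forall y, `|f y| <= M) -> antisymmetric_upto m f ->
  (forall y, orthant m y -> 0 <= f y) ->
  forall x, orthant m x -> 0 <= heat_semigroup t f x.
Proof.
move=> t0 mf fM af f0 x xm.
(* Expanding |x - y|^2 in the Gaussian leaves a factor [c], even in each coordinate of y, times the
   product of the exp (a_i y_i). *)
pose a i := x ord0 i / (2 * t).
pose E (k : nat) (y : 'rV[R]_N) (i : 'I_N) : R := if (i < k)%N && (i < m)%N
  then (expR (a i * y ord0 i) - expR (- (a i * y ord0 i))) / 2 else expR (a i * y ord0 i).
pose c (y : 'rV[R]_N) := (4 * pi * t) `^ (- (N%:R / 2)) * expR (- (sqnorm x + sqnorm y) / (4 * t)).
pose W k y := c y * \prod_i E k y i.
have c_ge0 y : 0 <= c y by rewrite mulr_ge0 ?powR_ge0 ?expR_ge0.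
have crefl i y : c (reflection i y) = c y by rewrite /c sqnorm_reflection.
have W0 y : W 0%N y = heat_kernel t (x - y).
  rewrite /W /c heat_kernelE -mulrA; congr (_ * _).
  under eq_bigr do rewrite /E ltn0.
  rewrite -expR_sum -expRD; congr expR.
  rewrite /sqnorm -big_split/= -sumrN mulr_suml -sumrN mulr_suml -big_split/=.
  apply: eq_bigr => i _; rewrite !mxE /a; field.
  by rewrite gt_eqF.
clearbody c.
have WS (k : 'I_N) y : (k < m)%N -> W k.+1 y = (W k y - W k (reflection k y)) / 2.
  move=> km; rewrite /W crefl -mulrBr -mulrA; congr GRing.mul.
  rewrite !(bigD1 (P := predT) k)//= /E ltnSn ltnn/= km/= mxE eqxx mulrN.
  set p1 := \prod_(i < N | _) _; set p2 := \prod_(i < N | _) _; set p3 := \prod_(i < N | _) _.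
  have iltk (i : 'I_N) : i != k -> (i < k.+1)%N = (i < k)%N.
    by move=> ik; rewrite [RHS]ltn_neqAle ltnS ik.
  have -> : p2 = p1 by apply: eq_bigr => i ik; rewrite iltk.
  have -> : p3 = p1 by apply: eq_bigr => i ik; rewrite mxE (negbTE ik) iltk.
  by rewrite -mulrBl mulrAC.
have WSN (k : nat) y : ~~ ((k < N) && (k < m))%N -> W k.+1 y = W k y.
  move=> kNm; congr (_ * _); apply: eq_bigr => i _; rewrite /E ltnS leq_eqVlt.
  case: eqP => //= ik; move: kNm; rewrite -ik ltn_ord/= => /negbTE ->.
  by rewrite andbF.
have iW k : leb.-integrable setT (EFin \o (fun y => W k y * f y)) /\
    \int[leb]_y (W k y * f y) = heat_semigroup t f x.
  elim: k => [|k [IH1 IH2]].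
    split; first by rewrite /comp; under eq_fun do rewrite W0; exact: integrable_heat fM.
    by apply: eq_Rintegral => y _; rewrite W0.
  have [/andP[kN km]|kNm] := boolP ((k < N) && (k < m))%N; last first.
    by split; [rewrite /comp; under eq_fun do rewrite WSN//|rewrite -IH2; apply: eq_Rintegral => y _; rewrite WSN].
  pose i := Ordinal kN.
  (* The new integrand is the mean of the old one and of its reflection, so the integral does not
     change. *)
  have WE y : W k.+1 y * f y = 2^-1 * (W k y * f y + W k (reflection i y) * f (reflection i y)).
    by rewrite (WS i)//= (af i)//; field.
  have ir := integrable_reflection i IH1.
  split.
    rewrite /comp; under eq_fun do rewrite WE.
    apply: integrable_scale => //; exact: integrable_add.
  under eq_Rintegral do rewrite WE.
  rewrite RintegralZl//; last exact: integrable_add.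
  rewrite RintegralD// (@Rintegral_reflection i (fun y => W k y * f y))// IH2.
  by field.
have [_ <-] := iW N; apply: Rintegral_ge0 => y _; rewrite /W -mulrA mulr_ge0//.
pose cc (r : R) := (expR r - expR (- r)) / 2.
have cc_ge0 r : 0 < r -> 0 <= cc r.
  by move=> r0; rewrite divr_ge0// subr_ge0 ler_expR; lra.
rewrite (bigID (fun i : 'I_N => (i < m)%N))/= mulrAC mulr_ge0//; last first.
  by apply: prodr_ge0 => i im; rewrite /E (negbTE im) andbF expR_ge0.
have a0 (i : 'I_N) : (i < m)%N -> 0 < a i by move=> im; rewrite divr_gt0 ?mulr_gt0// xm.
rewrite (eq_bigr (fun i => cc (a i * y ord0 i))); last first.
  by move=> i im; rewrite /E ltn_ord im.
apply: (antisymmetric_cone af f0 (c := fun i r => cc (a i * r))).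
  by move=> i r im r0; rewrite cc_ge0// mulr_gt0// a0.
by move=> i r; rewrite mulrN /cc opprK -[RHS]mulNr opprB.
Qed.

End antisymmetry.

Lemma heat_semigroupE {R : realType} N t (f : 'rV[R]_N -> R) x :
  heat_semigroup t f x = \int[lebesgue_rV R N]_y (heat_kernel t (x - y) * f y).
Proof. by []. Qed.

Opaque heat_semigroup.

(** * Integrals over intervals and Duhamel integrals *)

Section interval_integrals.
Context {R : realType}.
Notation mu := (@lebesgue_measure R).
Implicit Types (a b s t r M : R) (g : R -> R).

Lemma Rintegral_itv_if a b g : \int[mu]_(s in `]a, b[) g s =
  \int[mu]_s (if (a < s) && (s < b) then g s else 0).
Proof.
rewrite Rintegral_mkcond; apply: eq_Rintegral => s _.
by rewrite patchE mem_setE in_itv.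
Qed.

Lemma integrable_itv_if a b g : mu.-integrable `]a, b[ (EFin \o g) ->
  mu.-integrable setT (fun s => (if (a < s) && (s < b) then g s else 0)%:E).
Proof.
move=> ig; have := (@integrable_mkcond _ (measurableTypeR R) R mu `]a, b[ (EFin \o g)
  (measurable_itv `]a, b[)).1 ig.
congr (_.-integrable _ _); apply/funext => s.
by rewrite patchE mem_setE in_itv/=; case: ifP.
Qed.

Lemma integrable_itv_bounded a b g M : measurable_fun setT g ->
  (forall s, a < s < b -> `|g s| <= M) -> mu.-integrable `]a, b[ (EFin \o g).
Proof.
move=> mg gM; apply: (@integrable_bounded _ _ _ _ _ _ _ M) => //.
- exact: measurable_funTS.
- by rewrite [X in (X < _)%E]lebesgue_measure_itv/=; case: ifP => _; rewrite ?ltry// -EFinB ltry.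
Qed.

Lemma Rintegral_itv_cst a b c : a <= b -> \int[mu]_(s in `]a, b[) c = c * (b - a).
Proof.
move=> ab; rewrite Rintegral_cst//= lebesgue_measure_itv/= lte_fin.
move: ab; rewrite le_eqVlt => /predU1P[->|->//].
by rewrite ltxx subrr.
Qed.

Lemma normr_Rintegral_itv_le a b g M : a <= b -> measurable_fun setT g ->
  (forall s, a < s < b -> `|g s| <= M) -> `|\int[mu]_(s in `]a, b[) g s| <= M * (b - a).
Proof.
move=> ab mg gM; rewrite -Rintegral_itv_cst//; apply: normr_Rintegral_le => //.
- exact: measurable_funTS.
- exact: (@integrable_itv_bounded _ _ (cst M) `|M|).
Qed.

Lemma eq_Rintegral_itv a b (g1 g2 : R -> R) : (forall s, a < s < b -> g1 s = g2 s) ->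
  \int[mu]_(s in `]a, b[) g1 s = \int[mu]_(s in `]a, b[) g2 s.
Proof. by move=> g12; apply: eq_Rintegral => s; rewrite inE/= in_itv/=; exact: g12. Qed.

Lemma measurable_if_itv d (T : measurableType d) (a b c g : T -> R) :
  measurable_fun setT a -> measurable_fun setT b -> measurable_fun setT c ->
  measurable_fun setT g ->
  measurable_fun setT (fun z => if (a z < b z) && (b z < c z) then g z else 0).
Proof.
move=> ma mb mc mg; apply: measurable_fun_ifT => //.
by apply: measurable_and; exact: measurable_fun_ltr.
Qed.

Lemma measurable_Rintegral_itv d (T : measurableType d) (a b : T -> R) (g : T -> R -> R) :
  measurable_fun setT a -> measurable_fun setT b ->
  measurable_fun setT (fun z : T * R => g z.1 z.2) ->
  measurable_fun setT (fun z => \int[mu]_(s in `]a z, b z[) g z s).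
Proof.
move=> ma mb mg; under eq_fun do rewrite Rintegral_itv_if.
apply: (@measurable_fun_Rintegral _ _ T (measurableTypeR R) R mu
  (fun z s => if (a z < s) && (s < b z) then g z s else 0)).
by apply: measurable_if_itv => //; exact: measurableT_comp.
Qed.

Lemma Rintegral_FTC (f F : R -> R) a b : a <= b ->
  (forall x, a <= x <= b -> {for x, continuous f}) ->
  (forall x, a <= x <= b -> is_derive x 1 F (f x)) ->
  mu.-integrable `]a, b[ (EFin \o f) /\ \int[mu]_(s in `]a, b[) f s = F b - F a.
Proof.
move=> ab cf dF.
have cff : {within `[a, b], continuous f}.
  by apply: continuous_in_subspaceT => x; rewrite inE/= in_itv/=; exact: cf.
have fi : mu.-integrable `[a, b] (EFin \o f).
  by apply: continuous_compact_integrable; first exact: segment_compact.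
split; first by apply: integrableS fi => //; exact: subset_itv_oo_cc.
move: (ab); rewrite le_eqVlt => /predU1P[->|ab'].
  by rewrite subrr set_itvoo0 Rintegral_set0.
have cF x : a <= x <= b -> {for x, continuous F}.
  move=> axb; apply/differentiable_continuous/derivable1_diffP.
  by have h := dF x axb; exact: (@ex_derive _ _ _ _ _ _ _ h).
have := @continuous_FTC2 R f F a b ab'.
rewrite (@Rintegral_itv_obnd_cbnd _ a (BSide true b)); last first.
  by apply: integrableS fi => //; exact: subset_itv_oo_cc.
rewrite (@Rintegral_itv_bndo_bndc _ (BSide true a) b); last first.
  by apply: integrableS fi => //; exact: subset_itv_co_cc.
rewrite /Rintegral => ->//.
- split.
  + move=> x; rewrite in_itv/= => /andP[ax xb].
    have h := dF x; rewrite (ltW ax) (ltW xb) in h.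
    exact: (@ex_derive _ _ _ _ _ _ _ (h isT)).
  + by apply: cvg_at_right_filter; apply: cF; rewrite lexx.
  + by apply: cvg_at_left_filter; apply: cF; rewrite lexx andbT.
- move=> x; rewrite in_itv/= => /andP[ax xb]; rewrite derive1E.
  have h := dF x; rewrite (ltW ax) (ltW xb) in h.
  exact: (@derive_val _ _ _ _ _ _ _ (h isT)).
Qed.

Lemma Rintegral_triangle (k : R -> R -> R) M t : 0 <= t ->
  measurable_fun setT (fun z : R * R => k z.1 z.2) ->
  (forall s r, 0 < r -> r < s -> s < t -> `|k s r| <= M) ->
  \int[mu]_(s in `]0, t[) \int[mu]_(r in `]0, s[) k s r =
  \int[mu]_(r in `]0, t[) \int[mu]_(s in `]r, t[) k s r.
Proof.
move=> t0 mk kM.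
(* The bound on [k] holds in the triangle 0 < r < s < t only, so [k] is cut off outside it before
   Fubini is applied on the plane. *)
pose f s r := if (0 < r) && (r < s) then (if (r < s) && (s < t) then k s r else 0) else 0.
have M0 : 0 <= `|M| by [].
have fM s r : `|f s r| <= `|M|.
  rewrite /f; case: ifP => [/andP[r0 rs]|_]; last by rewrite normr0.
  case: ifP => [/andP[_ st]|_]; last by rewrite normr0.
  by rewrite (le_trans (kM _ _ r0 rs st))// ler_norm.
have mf : measurable_fun setT (fun z : R * R => f z.1 z.2).
  by do 2 apply: measurable_if_itv => //.
transitivity (\int[mu]_s \int[mu]_r f s r).
  rewrite Rintegral_itv_if; apply: eq_Rintegral => s _.
  case: ifPn => [/andP[s0 st]|st].
    rewrite Rintegral_itv_if; apply: eq_Rintegral => r _; rewrite /f.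
    by case: ifPn => // /andP[_ ->]; rewrite st.
  rewrite (@eq_Rintegral _ _ _ _ _ (cst 0)) ?Rintegral_cst ?mul0r// => r _ /=; rewrite /f.
  case: ifP => // /andP[r0 rs]; case: ifP => // /andP[_ st'].
  by rewrite st' (lt_trans r0 rs) in st.
transitivity (\int[mu]_r \int[mu]_s f s r).
  pose I s : R := if (0 < s) && (s < t) then 1 else 0.
  have iI : mu.-integrable setT (EFin \o I).
    apply: integrable_itv_if; apply: (@integrable_itv_bounded _ _ (cst 1) 1) => // s _.
    by rewrite normr1.
  apply: (@Rintegral_fubini_prod _ _ (measurableTypeR R) (measurableTypeR R) R mu mu f
    (fun s => `|M| * I s) I) => //; first exact: integrable_scale.
  move=> s r; rewrite /f /I.
  have [/andP[r0 rs]|_] := ifP; last by rewrite normr0 !mulr_ge0//; case: ifP.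
  have [/andP[_ st]|_] := ifP; last by rewrite normr0 !mulr_ge0//; case: ifP.
  rewrite (lt_trans r0 rs) st r0 (lt_trans rs st) !mulr1.
  by rewrite (le_trans (kM _ _ r0 rs st))// ler_norm.
rewrite [RHS]Rintegral_itv_if; apply: eq_Rintegral => r _.
case: ifPn => [/andP[r0 rt]|rt].
  rewrite Rintegral_itv_if; apply: eq_Rintegral => s _; rewrite /f r0/=.
  by case: (r < s).
rewrite (@eq_Rintegral _ _ _ _ _ (cst 0)) ?Rintegral_cst ?mul0r// => s _ /=; rewrite /f.
case: ifP => // /andP[r0 rs]; case: ifP => // /andP[_ st'].
by rewrite r0 (lt_trans rs st') in rt.
Qed.

End interval_integrals.

(** * Duhamel integrals with damping *)

Section duhamel.
Context {R : realType} (N : nat).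
Notation mu := (@lebesgue_measure R).
Notation leb := (lebesgue_rV R N).
Implicit Types (f g : 'rV[R]_N -> R) (F G u : R -> 'rV[R]_N -> R) (x y : 'rV[R]_N)
  (t s r M L : R).

(** Measurability is joint in time and space, as Fubini requires. The bound concerns positive times,
    the only ones over which Duhamel integrals run. *)
Definition bounded_field M F :=
  measurable_fun setT (fun z : R * 'rV[R]_N => F z.1 z.2) /\
  forall s y, 0 < s -> `|F s y| <= M.

(** The contribution of the source F to u_t = Delta u - L u + F; rate 0 is that of the undamped
    equation. *)
Definition duhamel L F t x := \int[mu]_(s in `]0, t[)
  (expR (- (L * (t - s))) * heat_semigroup (t - s) (F s) x).

Lemma bounded_field_measurable M F s : bounded_field M F -> measurable_fun setT (F s).
Proof. by move=> [mF _]; exact: (measurableT_comp mF (pair1_measurable s)). Qed.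

Lemma bounded_field_ge0 M F : bounded_field M F -> 0 <= M.
Proof. by move=> [_ FM]; exact: le_trans (FM 1 0 ltr01). Qed.

Lemma bounded_fieldD M1 M2 F G : bounded_field M1 F -> bounded_field M2 G ->
  bounded_field (M1 + M2) (fun s y => F s y + G s y).
Proof.
move=> [mF FM] [mG GM]; split; first exact: measurable_funD.
by move=> s y s0; rewrite (le_trans (ler_normD _ _))// lerD ?FM ?GM.
Qed.

Lemma bounded_fieldZ M c F : bounded_field M F ->
  bounded_field (`|c| * M) (fun s y => c * F s y).
Proof.
move=> [mF FM]; split; first exact: measurable_funM.
by move=> s y s0; rewrite normrM ler_wpM2l// FM.
Qed.

Lemma measurable_heat_field F d (T' : measurableType d) (a c : T' -> R) (b : T' -> 'rV[R]_N) :
  measurable_fun setT (fun z : R * 'rV[R]_N => F z.1 z.2) ->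
  measurable_fun setT a -> measurable_fun setT b -> measurable_fun setT c ->
  measurable_fun setT (fun z => heat_semigroup (a z) (F (c z)) (b z)).
Proof.
move=> mF ma mb mc; apply: (measurable_heat_semigroup_param ma mb).
have mp : measurable_fun setT (fun z : T' * 'rV[R]_N => (c z.1, z.2)).
  by apply: measurable_fun_pair => //; exact: measurableT_comp.
exact: (measurableT_comp mF mp).
Qed.

Lemma measurable_expR_lin d (T : measurableType d) L (a : T -> R) :
  measurable_fun setT a -> measurable_fun setT (fun z => expR (- (L * a z))).
Proof.
by move=> ma; apply: measurableT_comp => //; apply: measurableT_comp => //; exact: measurable_funM.
Qed.

Section integrand.
Variables (M L : R) (F : R -> 'rV[R]_N -> R) (FM : bounded_field M F) (L0 : 0 <= L).

Lemma measurable_duhamel_integrand t x :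
  measurable_fun setT (fun s => expR (- (L * (t - s))) * heat_semigroup (t - s) (F s) x).
Proof.
apply: measurable_funM; first by apply: measurable_expR_lin; exact: measurable_funB.
by apply: (@measurable_heat_field F _ _ (fun s => t - s) id (cst x)) FM.1 _ _ _ => //;
  exact: measurable_funB.
Qed.

Lemma normr_heat_field_le t s x : 0 < s -> s < t -> `|heat_semigroup (t - s) (F s) x| <= M.
Proof.
move=> s0 st; apply: normr_heat_semigroup_le; first by rewrite subr_gt0.
- exact: bounded_field_measurable FM.
- by move=> y; exact: FM.2.
Qed.

Lemma normr_duhamel_integrand_le t s x : 0 < s -> s < t ->
  `|expR (- (L * (t - s))) * heat_semigroup (t - s) (F s) x| <= M.
Proof.
move=> s0 st; rewrite normrM ger0_norm ?expR_ge0// -[leRHS]mul1r.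
rewrite ler_pM ?expR_ge0 ?normr_heat_field_le//.
by rewrite -expR0 ler_expR oppr_le0 mulr_ge0// subr_ge0 ltW.
Qed.

Lemma integrable_duhamel t x : mu.-integrable `]0, t[
  (EFin \o (fun s => expR (- (L * (t - s))) * heat_semigroup (t - s) (F s) x)).
Proof.
apply: (@integrable_itv_bounded _ _ _ _ M); first exact: measurable_duhamel_integrand.
by move=> s /andP[s0 st]; exact: normr_duhamel_integrand_le.
Qed.

Lemma normr_duhamel_le t x : 0 <= t -> `|duhamel L F t x| <= M * t.
Proof.
move=> t0; rewrite -[t in leRHS]subr0; apply: normr_Rintegral_itv_le => //.
  exact: measurable_duhamel_integrand.
by move=> s /andP[s0 st]; exact: normr_duhamel_integrand_le.
Qed.

Lemma measurable_duhamel :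
  measurable_fun setT (fun z : R * 'rV[R]_N => duhamel L F z.1 z.2).
Proof.
apply: (@measurable_Rintegral_itv _ _ _ (cst 0) fst
  (fun z s => expR (- (L * (z.1 - s))) * heat_semigroup (z.1 - s) (F s) z.2)) => //.
have mts : measurable_fun setT (fun z : (R * 'rV[R]_N) * R => z.1.1 - z.2).
  by apply: measurable_funB => //; exact: measurableT_comp.
apply: measurable_funM; first exact: measurable_expR_lin.
apply: (@measurable_heat_field F _ _ 
  (fun z : (R * 'rV[R]_N) * R => z.1.1 - z.2) snd (fun z => z.1.2)) => //.
- exact: FM.1.
- exact: measurableT_comp.
Qed.

(** Fubini brings the heat flow inside the time integral and the semigroup law adds the two times.
    Both the restart of a solution and the change of its damping rate rest on this. *)
Lemma heat_semigroup_duhamel a t x : 0 < a -> 0 <= t ->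
  heat_semigroup a (duhamel L F t) x =
  \int[mu]_(s in `]0, t[) (expR (- (L * (t - s))) * heat_semigroup (a + (t - s)) (F s) x).
Proof.
move=> a0 t0; rewrite [LHS]heat_semigroupE /duhamel.
pose I s : R := if (0 < s) && (s < t) then 1 else 0.
have iI : mu.-integrable setT (EFin \o I).
  apply: integrable_itv_if; apply: (@integrable_itv_bounded _ _ _ (cst 1) 1) => // s _.
  by rewrite normr1.
pose k y s := if (0 < s) && (s < t) then
  heat_kernel a (x - y) * (expR (- (L * (t - s))) * heat_semigroup (t - s) (F s) y) else 0.
transitivity (\int[leb]_y \int[mu]_s k y s).
  apply: eq_Rintegral => y _; rewrite -RintegralZl//; last exact: integrable_duhamel.
  by rewrite Rintegral_itv_if.
transitivity (\int[mu]_s \int[leb]_y k y s).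
  apply: (@Rintegral_fubini_prod _ _ _ (measurableTypeR R) R leb mu k
    (fun y => M * heat_kernel a (x - y)) I) => //.
  - have mts : measurable_fun setT (fun z : 'rV[R]_N * R => t - z.2).
      by apply: measurable_funB => //; exact: measurableT_comp.
    apply: (@measurable_if_itv _ _ _ (cst 0) snd (cst t)) => //.
    apply: measurable_funM.
      apply: measurable_heat_kernel_comp => //.
      exact: (measurableT_comp (measurable_rVB x)).
    apply: measurable_funM; first exact: measurable_expR_lin.
    by apply: (@measurable_heat_field F _ _ (fun z : 'rV[R]_N * R => t - z.2) snd fst) => //; exact: FM.1.
  - by apply: integrable_scale => //; exact: integrable_heat_kernelB.
  - move=> y s; rewrite /k /I; case: ifPn => [/andP[s0 st]|_]; last by rewrite normr0 mulr0.
    rewrite mulr1 normrM normr_heat_kernel mulrC ler_wpM2r ?heat_kernel_ge0//.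
    exact: normr_duhamel_integrand_le.
rewrite [RHS]Rintegral_itv_if; apply: eq_Rintegral => s _; rewrite /k.
case: ifPn => [/andP[s0 st]|_]; last by rewrite Rintegral_cst// mul0r.
have ts0 : 0 < t - s by rewrite subr_gt0.
have mFs := bounded_field_measurable s FM.
rewrite -(heat_semigroup_add a0 ts0 mFs (fun y => FM.2 s y s0)).
rewrite [in RHS]heat_semigroupE -RintegralZl//.
  by apply: eq_Rintegral => y _; rewrite mulrCA.
apply: (@integrable_heat _ _ _ _ _ M) => //; first exact: measurable_heat_semigroup.
by move=> y; exact: normr_heat_field_le.
Qed.

End integrand.

Lemma duhamelE L F t x : duhamel L F t x = \int[mu]_(s in `]0, t[)
  (expR (- (L * (t - s))) * heat_semigroup (t - s) (F s) x).
Proof. by []. Qed.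

End duhamel.

Opaque duhamel.

Section exponential_integrals.
Context {R : realType}.
Notation mu := (@lebesgue_measure R).
Implicit Types (a b c d s t r M L : R) (g : R -> R).

Lemma normrM_le1l (c e M : R) : `|c| <= 1 -> `|e| <= M -> `|c * e| <= M.
Proof. by move=> c1 eM; rewrite normrM -[leRHS]mul1r ler_pM. Qed.

Lemma normr_expRN_le1 (a : R) : 0 <= a -> `|expR (- a)| <= 1.
Proof. by move=> a0; rewrite ger0_norm ?expR_ge0// -expR0 ler_expR oppr_le0. Qed.

Lemma is_derive_expR_affine a b (x : R) :
  is_derive x 1 (fun s => expR (a * s + b)) (a * expR (a * x + b)).
Proof.
have h : is_derive x 1 (fun s : R => a * s + b) a.
  rewrite -[a in is_derive _ _ _ a]mulr1 -[X in is_derive _ _ _ X]addr0.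
  by apply: is_deriveD; apply: is_deriveZ.
rewrite mulrC; exact: (@is_derive1_comp R expR (fun s : R => a * s + b) x (expR (a * x + b)) a).
Qed.

Lemma continuous_expR_affine a b : continuous (fun s : R => expR (a * s + b)).
Proof.
move=> x; apply/differentiable_continuous/derivable1_diffP.
exact: (@ex_derive _ _ _ _ _ _ _ (is_derive_expR_affine a b x)).
Qed.

Lemma Rintegral_expR_mix L L' r t : r <= t ->
  (L' - L) * \int[mu]_(s in `]r, t[) (expR (- (L' * (t - s))) * expR (- (L * (s - r)))) =
  expR (- (L * (t - r))) - expR (- (L' * (t - r))).
Proof.
move=> rt; pose b := L * r - L' * t.
have eE s : expR (- (L' * (t - s))) * expR (- (L * (s - r))) = expR ((L' - L) * s + b).
  by rewrite -expRD; congr expR; rewrite /b; ring.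
rewrite (eq_Rintegral_itv (g2 := fun s => expR ((L' - L) * s + b))) => [|s _]; last exact: eE.
have ce := @continuous_expR_affine (L' - L) b.
rewrite -RintegralZl//; last first.
  apply: (@integrableS _ _ _ mu `[r, t]) => //; first exact: subset_itv_oo_cc.
  apply: continuous_compact_integrable; first exact: segment_compact.
  exact: continuous_subspaceT.
have ce' : continuous (fun s => (L' - L) * expR ((L' - L) * s + b)).
  by move=> x; apply: cvgM; [exact: cvg_cst|exact: ce].
have [_ ->] := Rintegral_FTC rt (fun x _ => ce' x) (fun x _ => is_derive_expR_affine (L' - L) b x).
by rewrite -!eE !subrr !mulr0 oppr0 expR0 mul1r mulr1.
Qed.

Lemma Rintegral_itv_split a b c g : a <= b -> b <= c -> mu.-integrable `]a, c[ (EFin \o g) ->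
  \int[mu]_(s in `]a, c[) g s = \int[mu]_(s in `]a, b[) g s + \int[mu]_(s in `]b, c[) g s.
Proof.
move=> ab bc ig; move: bc; rewrite le_eqVlt => /predU1P[->|bc].
  by rewrite set_itvoo0 Rintegral_set0 addr0.
have ax : (BRight a <= BRight b)%O by rewrite bnd_simp.
have xc : (BRight b <= BLeft c)%O by rewrite bnd_simp.
have := @Rintegral_itvB R g _ _ b ig ax xc => <-.
rewrite (@Rintegral_itv_bndo_bndc R (BRight a) b g); first by rewrite addrC subrK.
by apply: integrableS ig => //; apply: subset_itvl; rewrite bnd_simp ltW.
Qed.

Lemma Rintegral_itv_affine a b c d g : 0 < c -> mu.-integrable `]c * a + d, c * b + d[ (EFin \o g) ->
  \int[mu]_(s in `]c * a + d, c * b + d[) g s = c * \int[mu]_(s in `]a, b[) g (c * s + d).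
Proof.
move=> c0 ig; rewrite !Rintegral_itv_if.
rewrite (@Rintegral_affine _ c d); last exact: integrable_itv_if; last by rewrite gt_eqF.
rewrite gtr0_norm//; congr (_ * _); apply: eq_Rintegral => s _.
by rewrite !ltrD2r !ltr_pM2l.
Qed.
End exponential_integrals.

Section duhamel_properties.
Context {R : realType} (N : nat).
Notation mu := (@lebesgue_measure R).
Notation leb := (lebesgue_rV R N).
Implicit Types (f g : 'rV[R]_N -> R) (F G u : R -> 'rV[R]_N -> R) (x y : 'rV[R]_N)
  (t s r M L : R) (m : nat).

Lemma duhamelD M1 M2 L F G t x : 0 <= L -> bounded_field M1 F -> bounded_field M2 G ->
  duhamel L (fun s y => F s y + G s y) t x = duhamel L F t x + duhamel L G t x.
Proof.
move=> L0 FM GM; rewrite !duhamelE -RintegralD//; last 2 first.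
- exact: integrable_duhamel FM L0 _ _.
- exact: integrable_duhamel GM L0 _ _.
apply: eq_Rintegral_itv => s /andP[s0 st].
rewrite (@heat_semigroupD _ _ _ _ _ (Num.max M1 M2)) ?subr_gt0 ?mulrDr//.
- exact: bounded_field_measurable FM.
- by move=> y; rewrite le_max FM.2.
- exact: bounded_field_measurable GM.
- by move=> y; rewrite le_max GM.2 ?orbT.
Qed.

Lemma duhamelZ M c L F t x : 0 <= L -> bounded_field M F ->
  duhamel L (fun s y => c * F s y) t x = c * duhamel L F t x.
Proof.
move=> L0 FM; rewrite !duhamelE -RintegralZl//; last exact: integrable_duhamel FM L0 _ _.
apply: eq_Rintegral_itv => s /andP[s0 st].
rewrite (@heat_semigroupZ _ _ _ _ _ M) ?subr_gt0//; first by rewrite mulrCA.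
- exact: bounded_field_measurable FM.
- by move=> y; exact: FM.2.
Qed.

Lemma eq_duhamel L F G t x : (forall s y, 0 < s -> F s y = G s y) ->
  duhamel L F t x = duhamel L G t x.
Proof.
move=> FG; rewrite !duhamelE; apply: eq_Rintegral_itv => s /andP[s0 st].
by congr (_ * heat_semigroup _ _ _); apply/funext => y; exact: FG.
Qed.

(* The exponentially weighted Duhamel formula with rate L is the plain one for
   the equation with an extra damping term L u; only F changes with L. *)
Lemma duhamel_shift M0 M M1 L L' (f0 : 'rV[R]_N -> R) F u : 0 <= L -> 0 <= L' ->
  measurable_fun setT f0 -> (forall y, `|f0 y| <= M0) ->
  bounded_field M F -> bounded_field M1 u ->
  (forall t x, 0 < t ->
    u t x = expR (- (L * t)) * heat_semigroup t f0 x + duhamel L F t x) ->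
  forall t x, 0 < t -> u t x = expR (- (L' * t)) * heat_semigroup t f0 x +
    duhamel L' (fun s y => F s y + (L' - L) * u s y) t x.
Proof.
move=> L0 L'0 mf0 f0M FM uM uE t x t0.
pose H r := heat_semigroup (t - r) (F r) x.
pose A := heat_semigroup t f0 x.
have mH : measurable_fun setT H.
  by apply: (@measurable_heat_field _ _ F _ _ (fun r => t - r) id (cst x)) => //;
    [exact: FM.1|exact: measurable_funB].
have HM r : 0 < r -> r < t -> `|H r| <= M by move=> r0 rt; exact: (normr_heat_field_le FM).
have M_ge0 := bounded_field_ge0 FM.
(* Flowing the formula for [u s] for the further time t - s turns each flow of duration s - r into
   one of duration t - r, so the spatial part [H r] no longer depends on s. *)
have uS s : 0 < s -> s < t -> heat_semigroup (t - s) (u s) x =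
    expR (- (L * s)) * A + \int[mu]_(r in `]0, s[) (expR (- (L * (s - r))) * H r).
  move=> s0 st; have ts0 : 0 < t - s by rewrite subr_gt0.
  have -> : u s = fun y => expR (- (L * s)) * heat_semigroup s f0 y + duhamel L F s y.
    by apply/funext => y; exact: uE.
  have mS := measurable_heat_semigroup s mf0.
  have mD : measurable_fun setT (duhamel L F s).
    exact: (measurableT_comp (measurable_duhamel L FM) (pair1_measurable s)).
  rewrite (@heat_semigroupD _ _ _ _ _ (Num.max M0 (M * s)))//.
  - rewrite (@heat_semigroupZ _ _ _ _ _ M0)// ?(heat_semigroup_add ts0 s0 mf0 f0M) ?subrK//.
      rewrite (heat_semigroup_duhamel FM L0 x ts0 (ltW s0)).
      have Ers : forall r, 0 < r < s ->
          expR (- (L * (s - r))) * heat_semigroup (t - s + (s - r)) (F r) x =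
          expR (- (L * (s - r))) * H r by move=> r _; rewrite /H addrA subrK.
      by rewrite (eq_Rintegral_itv Ers).
    by move=> y; exact: normr_heat_semigroup_le.
  - exact: measurable_funM.
  - move=> y; rewrite le_max; apply/orP; left.
    apply: normrM_le1l; last exact: normr_heat_semigroup_le.
    by rewrite normr_expRN_le1// mulr_ge0// ltW.
  - by move=> y; rewrite le_max (normr_duhamel_le FM)// ?orbT// ltW.
have eL s r : r <= s -> `|expR (- (L * (s - r)))| <= 1.
  by move=> rs; rewrite normr_expRN_le1// mulr_ge0// subr_ge0.
pose E (l : R) s := expR (- (l * (t - s))).
have mE l : measurable_fun setT (E l).
  by apply: measurable_expR_lin; exact: measurable_funB.
have E1 l s : 0 <= l -> s < t -> `|E l s| <= 1.
  by move=> l0 st; rewrite normr_expRN_le1// mulr_ge0// subr_ge0 ltW.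
pose k s r := (L' - L) * (E L' s * (expR (- (L * (s - r))) * H r)).
have kM s r : 0 < r -> r < s -> s < t -> `|k s r| <= `|L' - L| * M.
  move=> r0 rs st; rewrite /k normrM ler_wpM2l//.
  apply: normrM_le1l (E1 _ _ L'0 st) _; apply: normrM_le1l (eL _ _ (ltW rs)) _.
  exact: HM (lt_trans rs st).
have mk : measurable_fun setT (fun z : R * R => k z.1 z.2).
  apply: measurable_funM => //; apply: measurable_funM; first exact: measurableT_comp (mE L') _.
  apply: measurable_funM; last exact: measurableT_comp mH _.
  by apply: measurable_expR_lin; exact: measurable_funB.
have -> : duhamel L' (fun s y => F s y + (L' - L) * u s y) t x =
   \int[mu]_(s in `]0, t[) (E L' s * H s + ((L' - L) * (E L' s * (expR (- (L * (s - 0))) * A))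
     + \int[mu]_(r in `]0, s[) k s r)).
  rewrite duhamelE; apply: eq_Rintegral_itv => s /andP[s0 st].
  have ts0 : 0 < t - s by rewrite subr_gt0.
  have mFs := bounded_field_measurable s FM.
  have mus := bounded_field_measurable s uM.
  have uM' := bounded_fieldZ (L' - L) uM.
  rewrite (@heat_semigroupD _ _ _ _ _ (Num.max M (`|L' - L| * M1)))//.
  - rewrite (@heat_semigroupZ _ _ _ _ _ M1)//; last by move=> y; exact: uM.2.
    have -> : \int[mu]_(r in `]0, s[) k s r = (L' - L) * (E L' s *
        \int[mu]_(r in `]0, s[) (expR (- (L * (s - r))) * H r)).
      rewrite -RintegralZl//; first rewrite -RintegralZl//.
      + apply: (@integrable_itv_bounded _ _ _ _ M).
          apply: measurable_funM => //; apply: measurable_funM => //.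
          by apply: measurable_expR_lin; exact: measurable_funB.
        move=> r /andP[r0 rs]; apply: normrM_le1l (E1 _ _ L'0 st) _.
          by apply: normrM_le1l (eL _ _ (ltW rs)) _; exact: HM (lt_trans rs st).
      + apply: (@integrable_itv_bounded _ _ _ _ M).
          apply: measurable_funM => //.
          by apply: measurable_expR_lin; exact: measurable_funB.
        by move=> r /andP[r0 rs]; apply: normrM_le1l (eL _ _ (ltW rs)) _; exact: HM (lt_trans rs st).
    rewrite uS// -/(E L' s) -/(H s) subr0.
    by move: (E L' s) (H s) (expR _) (\int[mu]_(r in _) _) => e1 h1 e2 i1; ring.
  - by move=> y; rewrite le_max FM.2.
  - exact: measurable_funM.
  - by move=> y; rewrite le_max uM'.2 ?orbT.
have i1 : mu.-integrable `]0, t[ (EFin \o (fun s => E L' s * H s)).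
  exact: (integrable_duhamel FM L'0).
have i2 : mu.-integrable `]0, t[ (EFin \o (fun s => E L' s * (expR (- (L * (s - 0))) * A))).
  apply: (@integrable_itv_bounded _ _ _ _ `|A|).
    apply: measurable_funM => //; apply: measurable_funM => //.
    by apply: measurable_expR_lin; exact: measurable_funB.
  move=> s /andP[s0 st]; apply: normrM_le1l (E1 _ _ L'0 st) _.
  exact: normrM_le1l (eL _ _ (ltW s0)) _.
have i3 : mu.-integrable `]0, t[ (EFin \o (fun s => \int[mu]_(r in `]0, s[) k s r)).
  apply: (@integrable_itv_bounded _ _ _ _ (`|L' - L| * M * t)).
    exact: (@measurable_Rintegral_itv _ _ _ (cst 0) id).
  move=> s /andP[s0 st]; apply: (@le_trans _ _ (`|L' - L| * M * (s - 0))).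
    apply: normr_Rintegral_itv_le; first exact: ltW.
      exact: (measurableT_comp mk (pair1_measurable s)).
    by move=> r /andP[r0 rs]; exact: kM.
  by rewrite subr0 ler_wpM2l ?mulr_ge0// ltW.
rewrite RintegralD//; last first.
  by apply: integrable_add => //; exact: integrable_scale.
rewrite RintegralD//; last exact: integrable_scale.
rewrite RintegralZl//.
have -> : \int[mu]_(s in `]0, t[) (E L' s * (expR (- (L * (s - 0))) * A)) =
  \int[mu]_(s in `]0, t[) (E L' s * expR (- (L * (s - 0)))) * A.
  rewrite -RintegralZr//; first by apply: eq_Rintegral_itv => s _; rewrite mulrA.
  apply: (@integrable_itv_bounded _ _ _ _ 1).
    apply: measurable_funM => //.
    by apply: measurable_expR_lin; exact: measurable_funB.
  by move=> s /andP[s0 st]; exact: normrM_le1l (E1 _ _ L'0 st) (eL _ _ (ltW s0)).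
(* Once the order of integration is exchanged, the integral over s contains exponentials only and
   equals E L r - E L' r. The terms with L' then cancel, which leaves the formula with rate L. *)
rewrite mulrA Rintegral_expR_mix ?(ltW t0)// (Rintegral_triangle (ltW t0) mk kM).
have -> : \int[mu]_(r in `]0, t[) \int[mu]_(s in `]r, t[) k s r =
   \int[mu]_(r in `]0, t[) (E L r * H r - E L' r * H r).
  apply: eq_Rintegral_itv => r /andP[r0 rt].
  rewrite -mulrBl -Rintegral_expR_mix ?(ltW rt)// -RintegralZl//; last first.
    apply: (@integrable_itv_bounded _ _ _ _ 1).
      apply: measurable_funM; first exact: mE.
      by apply: measurable_expR_lin; exact: measurable_funB.
    by move=> s /andP[rs st]; exact: normrM_le1l (E1 _ _ L'0 st) (eL _ _ (ltW rs)).
  rewrite -RintegralZr//; last first.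
    apply: integrable_scale => //; apply: (@integrable_itv_bounded _ _ _ _ 1).
      apply: measurable_funM; first exact: mE.
      by apply: measurable_expR_lin; exact: measurable_funB.
    by move=> s /andP[rs st]; exact: normrM_le1l (E1 _ _ L'0 st) (eL _ _ (ltW rs)).
  by apply: eq_Rintegral_itv => s _; rewrite /k -/(E L' s) !mulrA.
rewrite RintegralB//; last exact: (integrable_duhamel FM L0).
rewrite uE// -/A !subr0.
rewrite -[\int[mu]_(x in `]0, t[) (E L x * H x)]/(\int[mu]_(s in `]0, t[) (expR (- (L * (t - s))) * heat_semigroup (t - s) (F s) x)).
rewrite -duhamelE; ring.
Qed.

End duhamel_properties.

Section duhamel_order.
Context {R : realType} (N : nat).
Notation mu := (@lebesgue_measure R).
Notation leb := (lebesgue_rV R N).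
Implicit Types (f g : 'rV[R]_N -> R) (F G u : R -> 'rV[R]_N -> R) (x y : 'rV[R]_N)
  (t s r tau l M L : R) (m : nat).

Lemma bounded_field_shift M F tau : 0 <= tau -> bounded_field M F ->
  bounded_field M (fun s => F (tau + s)).
Proof.
move=> tau0 [mF FM]; split; last by move=> s y s0; apply: FM; rewrite ltr_wpDl.
have mp : measurable_fun setT (fun z : R * 'rV[R]_N => (tau + z.1, z.2)).
  by apply: measurable_fun_pair => //; exact: measurable_funD.
exact: (measurableT_comp mF mp).
Qed.

(** The time integral is cut at tau: what precedes is the heat flow of the Duhamel integral at time
    tau, and what follows is translated in time. *)
Lemma duhamel_restart M0 M L (f0 : 'rV[R]_N -> R) F u : 0 <= L ->
  measurable_fun setT f0 -> (forall y, `|f0 y| <= M0) -> bounded_field M F ->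
  (forall t x, 0 < t ->
    u t x = expR (- (L * t)) * heat_semigroup t f0 x + duhamel L F t x) ->
  forall tau t x, 0 < tau -> 0 < t ->
    u (tau + t) x = expR (- (L * t)) * heat_semigroup t (u tau) x +
      duhamel L (fun s => F (tau + s)) t x.
Proof.
move=> L0 mf0 f0M FM uE tau t x tau0 t0.
have -> : u tau = fun y => expR (- (L * tau)) * heat_semigroup tau f0 y + duhamel L F tau y.
  by apply/funext => y; exact: uE.
have M00 : 0 <= M0 by exact: le_trans (f0M 0).
have mS := measurable_heat_semigroup tau mf0.
have mD : measurable_fun setT (duhamel L F tau).
  exact: (measurableT_comp (measurable_duhamel L FM) (pair1_measurable tau)).
have taut0 : 0 < tau + t by rewrite addr_gt0.
rewrite (@heat_semigroupD _ _ _ _ _ (Num.max M0 (M * tau)))//; last 3 first.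
- exact: measurable_funM.
- move=> y; rewrite le_max; apply/orP; left.
  apply: normrM_le1l; last exact: normr_heat_semigroup_le.
  by rewrite normr_expRN_le1// mulr_ge0// ltW.
- by move=> y; rewrite le_max (normr_duhamel_le FM)// ?orbT// ltW.
rewrite (@heat_semigroupZ _ _ _ _ _ M0)//; last first.
  by move=> y; exact: normr_heat_semigroup_le.
rewrite (heat_semigroup_add t0 tau0 mf0 f0M) (heat_semigroup_duhamel FM L0 x t0 (ltW tau0)).
rewrite uE// [in RHS]mulrDr [in RHS]mulrA -expRD (_ : - (L * t) - L * tau = - (L * (tau + t))); last by ring.
rewrite (addrC t tau) -addrA; congr (_ * _ + _).
have ig := integrable_duhamel FM L0 (tau + t) x.
rewrite duhamelE (Rintegral_itv_split (ltW tau0) _ ig); last by rewrite lerDl ltW.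
have E1 : \int[mu]_(s in `]0, tau[) (expR (- (L * (tau + t - s))) * heat_semigroup (tau + t - s) (F s) x)
  = expR (- (L * t)) * \int[mu]_(s in `]0, tau[) (expR (- (L * (tau - s))) * heat_semigroup (t + (tau - s)) (F s) x).
  rewrite -RintegralZl//.
    apply: eq_Rintegral_itv => s _; rewrite mulrA -expRD.
    rewrite (_ : tau + t - s = t + (tau - s)); last by ring.
    by rewrite (_ : - (L * t) - L * (tau - s) = - (L * (t + (tau - s)))); last by ring.
  apply: (@integrable_itv_bounded _ _ _ _ M).
    apply: measurable_funM; first by apply: measurable_expR_lin; exact: measurable_funB.
    apply: (@measurable_heat_field _ _ F _ _ (fun s => t + (tau - s)) id (cst x)) => //; first exact: FM.1.
    by apply: measurable_funD => //; exact: measurable_funB.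
  move=> s /andP[s0 st]; apply: normrM_le1l.
    by rewrite normr_expRN_le1// mulr_ge0// subr_ge0 ltW.
  apply: normr_heat_semigroup_le; first by rewrite addr_gt0// subr_gt0.
    exact: bounded_field_measurable FM.
  by move=> y; exact: FM.2.
have itau : mu.-integrable `]1 * 0 + tau, 1 * t + tau[
   (EFin \o (fun s => expR (- (L * (tau + t - s))) * heat_semigroup (tau + t - s) (F s) x)).
  rewrite mulr0 add0r mul1r.
  apply: (@integrable_itv_bounded _ _ _ _ M); first exact: measurable_duhamel_integrand FM _ _.
  move=> s /andP[s0 st]; apply: (normr_duhamel_integrand_le FM L0).
    exact: lt_trans s0.
  by rewrite addrC.
have := Rintegral_itv_affine ltr01 itau.
rewrite mulr0 add0r !mul1r (addrC t tau) => E2.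
rewrite E1 E2; congr (_ + _).
rewrite duhamelE; apply: eq_Rintegral_itv => s _; rewrite mul1r.
by rewrite (_ : tau + t - (s + tau) = t - s) ?(addrC s); last by ring.
Qed.

Lemma duhamel_scale M L F l t x : 0 <= L -> 0 < l -> 0 < t -> bounded_field M F ->
  duhamel L F (l ^+ 2 * t) (l *: x) =
  l ^+ 2 * duhamel (l ^+ 2 * L) (fun s y => F (l ^+ 2 * s) (l *: y)) t x.
Proof.
move=> L0 l0 t0 FM; have l20 : 0 < l ^+ 2 by rewrite exprn_gt0.
have ig : mu.-integrable `]l ^+ 2 * 0 + 0, l ^+ 2 * t + 0[ (EFin \o (fun s =>
  expR (- (L * (l ^+ 2 * t - s))) * heat_semigroup (l ^+ 2 * t - s) (F s) (l *: x))).
  rewrite mulr0 !addr0; exact: integrable_duhamel FM L0 _ _.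
have := Rintegral_itv_affine l20 ig; rewrite mulr0 !addr0 !duhamelE => ->.
congr (_ * _); apply: eq_Rintegral_itv => s /andP[s0 st].
rewrite addr0 -mulrBr mulrA (mulrC L).
have st0 : 0 < t - s by rewrite subr_gt0.
rewrite (@heat_semigroup_scale _ _ _ _ _ M st0 l0 (bounded_field_measurable _ FM))//.
by move=> y; apply: FM.2; rewrite mulr_gt0.
Qed.

Lemma cvg_heat_semigroup M (f_ : nat -> 'rV[R]_N -> R) f t x : 0 < t ->
  (forall n, measurable_fun setT (f_ n)) -> (forall n y, `|f_ n y| <= M) ->
  (forall y, f_ n y @[n --> \oo] --> f y) ->
  heat_semigroup t (f_ n) x @[n --> \oo] --> heat_semigroup t f x.
Proof.
move=> t0 mf fM cf; rewrite heat_semigroupE; under eq_fun do rewrite heat_semigroupE.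
apply: (@cvg_Rintegral _ _ _ leb _ measurableT (fun n y => heat_kernel t (x - y) * f_ n y) _
  (fun y => M * heat_kernel t (x - y))) => //.
- by move=> n; apply: measurable_funM => //; exact: measurable_heat_kernelB.
- by apply: integrable_scale => //; exact: integrable_heat_kernelB.
- by move=> n y _; rewrite normrM normr_heat_kernel mulrC ler_wpM2r ?heat_kernel_ge0.
- by move=> y _; apply: cvgM; [exact: cvg_cst|exact: cf].
Qed.

Lemma cvg_duhamel M L (F_ : nat -> R -> 'rV[R]_N -> R) F t x : 0 <= L -> 0 <= t ->
  (forall n, bounded_field M (F_ n)) ->
  (forall s y, 0 < s -> F_ n s y @[n --> \oo] --> F s y) ->
  duhamel L (F_ n) t x @[n --> \oo] --> duhamel L F t x.
Proof.
move=> L0 t0 FM cF; rewrite duhamelE; under eq_fun do rewrite duhamelE.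
apply: (@cvg_Rintegral _ _ _ mu _ (measurable_itv _)
  (fun n s => expR (- (L * (t - s))) * heat_semigroup (t - s) (F_ n s) x) _ (cst M)).
- by move=> n; apply: measurable_funTS; exact: measurable_duhamel_integrand (FM n) _ _.
- exact: (@integrable_itv_bounded _ _ _ (cst M) `|M|).
- move=> n s; rewrite /= in_itv/= => /andP[s0 st].
  exact: (normr_duhamel_integrand_le (FM n) L0).
- move=> s; rewrite /= in_itv/= => /andP[s0 st]; apply: cvgM; first exact: cvg_cst.
  apply: (@cvg_heat_semigroup M); first by rewrite subr_gt0.
  + by move=> n; exact: bounded_field_measurable (FM n).
  + by move=> n y; exact: (FM n).2.
  + by move=> y; exact: cF.
Qed.

Lemma antisymmetric_duhamel m M L F t : bounded_field M F -> 0 <= L ->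
  (forall s, 0 < s -> antisymmetric_upto m (F s)) ->
  antisymmetric_upto m (duhamel L F t).
Proof.
move=> FM L0 aF i im x; rewrite !duhamelE -mulN1r -RintegralZl//; last first.
  exact: integrable_duhamel FM L0 _ _.
apply: eq_Rintegral_itv => s /andP[s0 st].
rewrite (@antisymmetric_heat_semigroup _ _ m _ (F s) M) ?subr_gt0 ?mulN1r ?mulrN//.
- exact: bounded_field_measurable FM.
- by move=> y; exact: FM.2.
- exact: aF.
Qed.

Lemma heat_semigroup_orthant_le m t f g M : 0 < t -> measurable_fun setT f ->
  (forall y, `|f y| <= M) -> measurable_fun setT g -> (forall y, `|g y| <= M) ->
  antisymmetric_upto m f -> antisymmetric_upto m g ->
  (forall y, orthant m y -> f y <= g y) ->
  forall x, orthant m x -> heat_semigroup t f x <= heat_semigroup t g x.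
Proof.
move=> t0 mf fM mg gM af ag fg x xm; rewrite -subr_ge0.
rewrite -(heat_semigroupB t0 mg gM mf fM).
apply: (@heat_semigroup_orthant_ge0 _ _ m t _ (M + M)) => //.
- exact: measurable_funB.
- by move=> y; rewrite (le_trans (ler_normB _ _))// lerD.
- by move=> i im y; rewrite ag// af// -opprD.
- by move=> y ym; rewrite subr_ge0 fg.
Qed.

Lemma duhamel_orthant_le m M L F G t : bounded_field M F -> bounded_field M G -> 0 <= L ->
  (forall s, 0 < s -> antisymmetric_upto m (F s)) ->
  (forall s, 0 < s -> antisymmetric_upto m (G s)) ->
  (forall s y, 0 < s -> s < t -> orthant m y -> F s y <= G s y) ->
  forall x, orthant m x -> duhamel L F t x <= duhamel L G t x.
Proof.
move=> FM GM L0 aF aG FG x xm; rewrite !duhamelE; apply: le_Rintegral => //.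
- exact: integrable_duhamel FM L0 _ _.
- exact: integrable_duhamel GM L0 _ _.
- move=> s; rewrite /= in_itv/= => /andP[s0 st]; rewrite ler_wpM2l ?expR_ge0//.
  apply: (@heat_semigroup_orthant_le m _ _ _ M) => //.
  + by rewrite subr_gt0.
  + exact: bounded_field_measurable FM.
  + by move=> y; exact: FM.2.
  + exact: bounded_field_measurable GM.
  + by move=> y; exact: GM.2.
  + exact: aF.
  + exact: aG.
  + by move=> y ym; exact: FG.
Qed.

End duhamel_order.

(** * The nonlinearity and the flat solution *)

Section nonlinearity.
Context {R : realType}.
Implicit Types (r s k L t : R).

Lemma is_deriveP (V W : normedModType R) (f : V -> W) x v df :
  h^-1 *: (f (h *: v + x) - f x) @[h --> 0^'] --> df -> is_derive x v f df.
Proof. by move=> fd; apply: DeriveDef; [exact: cvgP fd|exact: cvg_lim fd]. Qed.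

Variables (a : R) (a0 : 0 < a).
Notation f := (nonlinearity a).

Lemma nonlinearityN r : f (- r) = - f r.
Proof. by rewrite /nonlinearity normrN mulrN. Qed.

Lemma nonlinearity0 : f 0 = 0.
Proof. by rewrite /nonlinearity mulr0. Qed.

(** At 0 the difference quotient is |x|^a, which tends to 0 because a > 0; negative points follow
    from oddness. *)
Lemma is_derive_nonlinearity r : is_derive r 1 f ((a + 1) * `|r| `^ a).
Proof.
have pos s : 0 < s -> is_derive s 1 f ((a + 1) * `|s| `^ a).
  move=> s0; apply: (@near_eq_is_derive _ _ _ (fun x => x `^ a * x)).
    near=> x; rewrite /nonlinearity gtr0_norm//.
    near: x; exact: lt_nbhsr.
  have h1 := is_derive1_powR a s0.
  have h2 : is_derive s 1 (@id R) 1 by exact: is_derive_id.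
  have h3 := is_deriveM h1 h2.
  apply: (is_derive_eq h3).
  rewrite gtr0_norm// /GRing.scale/= mulr1.
  have -> : s * (a * s `^ (a - 1)) = a * s `^ a.
    by rewrite mulrCA mulr_powRB1// ltW.
  by ring.
have [r0|r0|->] := ltgtP r 0; last first.
- apply: is_deriveP; rewrite normr0 powR0 ?gt_eqF// mulr0.
  apply: (@cvg_trans _ ((fun x : R => `|x| `^ a) @ 0^')).
    apply: near_eq_cvg; near=> x.
    have x0 : x != 0 by near: x; exact: nbhs_dnbhs_neq.
    by rewrite nonlinearity0 subr0 addr0 /GRing.scale/= mulr1 /nonlinearity mulrCA mulVf// mulr1.
  apply: cvg_within_filter; apply/cvgrPdist_lt => e e0; near=> x.
  rewrite sub0r normrN ger0_norm ?powR_ge0//.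
  rewrite -[ltRHS](@powRr1 R) ?ltW// -(mulVf (lt0r_neq0 a0)) powRrM.
  apply: gt0_ltr_powR => //; rewrite ?nnegrE ?powR_ge0//.
  near: x; exists (e `^ a^-1) => //=; first exact: powR_gt0.
  by move=> z /=; rewrite sub0r normrN.
- exact: pos.
- have h : is_derive (- r) 1 f ((a + 1) * `|- r| `^ a) by apply: pos; rewrite oppr_gt0.
  have h2 : is_derive r 1 (-%R : R -> R) (-1) by exact: is_deriveNid.
  have h3 := is_deriveN (is_derive1_comp h h2).
  apply: (@near_eq_is_derive _ _ _ (- (f \o -%R))).
    by near=> x; rewrite -[RHS]opprK -nonlinearityN.
  by apply: (is_derive_eq h3); rewrite normrN; ring.
Unshelve. all: by end_near. Qed.

Lemma continuous_nonlinearity : continuous f.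
Proof.
move=> r; apply/differentiable_continuous/derivable1_diffP.
exact: (@ex_derive _ _ _ _ _ _ _ (is_derive_nonlinearity r)).
Qed.

Lemma measurable_nonlinearity : measurable_fun setT f.
Proof. by apply: continuous_measurable_fun; exact: continuous_nonlinearity. Qed.

(** Mean value theorem, with the supremum of f' on [-k, k] as constant. The rates L chosen later are
    instances of this constant. *)
Lemma nonlinearity_incr k r s : - k <= s -> s <= r -> r <= k ->
  0 <= f r - f s <= (a + 1) * k `^ a * (r - s).
Proof.
move=> ks; rewrite le_eqVlt => /predU1P[->|sr] rk; first by rewrite !subrr mulr0 lexx.
have [c cI ->] := @MVT R f (fun x => (a + 1) * `|x| `^ a) s r sr
  (fun x _ => is_derive_nonlinearity x) (continuous_subspaceT continuous_nonlinearity).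
move: cI; rewrite in_itv/= => /andP[sc cr].
have rs0 : 0 <= r - s by rewrite subr_ge0 ltW.
have a1 : 0 <= a + 1 by rewrite addr_ge0// ltW.
apply/andP; split; first by apply: mulr_ge0 => //; apply: mulr_ge0 => //; exact: powR_ge0.
apply: ler_wpM2r => //; apply: ler_wpM2l => //.
have ck : `|c| <= k.
  by rewrite ler_norml (le_trans ks (ltW sc)) (le_trans (ltW cr)).
by apply: ge0_ler_powR; rewrite ?nnegrE ?(ltW a0)//; exact: le_trans ck.
Qed.

Lemma normr_nonlinearity_le k r : `|r| <= k -> `|f r| <= k `^ a * k.
Proof.
move=> rk; rewrite normrM ger0_norm ?powR_ge0// ler_pM ?powR_ge0//.
apply: ge0_ler_powR; rewrite ?nnegrE ?(ltW a0)//; exact: le_trans rk.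
Qed.

Lemma nonlinearity_lipschitz k r s : `|r| <= k -> `|s| <= k ->
  `|f r - f s| <= (a + 1) * k `^ a * `|r - s|.
Proof.
move=> rk' sk'; have := rk'; have := sk'; rewrite ler_norml => /andP[ks sk].
rewrite ler_norml => /andP[kr rk].
have [sr|rs] := leP s r.
  have /andP[fr0 frs] := nonlinearity_incr ks sr rk.
  by rewrite (ger0_norm fr0) ger0_norm// subr_ge0.
have /andP[fr0 frs] := nonlinearity_incr kr (ltW rs) sk.
by rewrite distrC (ger0_norm fr0) distrC ger0_norm// subr_ge0 ltW.
Qed.

Lemma nonlinearity_ge0 r : 0 <= r -> 0 <= f r.
Proof. by move=> r0; rewrite mulr_ge0 ?powR_ge0. Qed.

Definition profile t : R := (1 + a * t) `^ (- a^-1).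

Lemma profile_gt0 t : 0 <= t -> 0 < profile t.
Proof. by move=> t0; rewrite powR_gt0// ltr_wpDr// mulr_ge0// ltW. Qed.

Lemma profile_le1 t : 0 <= t -> profile t <= 1.
Proof.
move=> t0; have at1 : 1 <= 1 + a * t by rewrite lerDl mulr_ge0// ltW.
rewrite /profile powRN invf_le1 ?powR_gt0 ?(lt_le_trans _ at1)//.
have h1 : 1 `^ a^-1 = 1 :> R by rewrite powR1.
rewrite -[X in X <= _]h1; apply: ge0_ler_powR; rewrite ?nnegrE ?invr_ge0 ?(ltW a0)//.
exact: le_trans at1.
Qed.

Lemma profile_powR t : 0 <= t -> profile t `^ a = (1 + a * t)^-1.
Proof.
move=> t0; rewrite /profile -powRrM mulNr mulVf ?gt_eqF// powR_inv1//.
by rewrite addr_ge0// mulr_ge0// ltW.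
Qed.

Lemma nonlinearity_profile t : 0 <= t -> f (profile t) = (1 + a * t)^-1 * profile t.
Proof. by move=> t0; rewrite /nonlinearity ger0_norm ?(ltW (profile_gt0 t0))// profile_powR. Qed.

Lemma is_derive_profile t : 0 <= t -> is_derive t 1 profile (- f (profile t)).
Proof.
move=> t0; have at0 : 0 < 1 + a * t by rewrite ltr_wpDr// mulr_ge0// ltW.
have h1 := is_derive1_powR (- a^-1) at0.
have h2 : is_derive t 1 (fun s => 1 + a * s) a.
  rewrite -[a in is_derive _ _ _ a]mulr1 -[X in is_derive _ _ _ X]add0r.
  by apply: is_deriveD; apply: is_deriveZ.
have h3 := @is_derive1_comp R (@powR R ^~ (- a^-1)) (fun s => 1 + a * s) t _ _ h1 h2.
apply: (is_derive_eq h3); rewrite nonlinearity_profile// /profile.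
rewrite -[X in _ = - (X * _)]powR_inv1 ?(ltW at0)// -powRD ?(gt_eqF at0) ?implybT//.
by rewrite (addrC (-1)) mulrAC mulNr mulVf ?gt_eqF// mulN1r.
Qed.

(** Variation of constants for p' = -f(p) with damping L, that is, the fundamental theorem applied
    to exp (L s) p(s). It evaluates the Duhamel integrals of the two barriers. *)
Lemma profile_integral L t : 0 <= t ->
  lebesgue_measure.-integrable `]0, t[ (EFin \o
    (fun s => expR (- (L * (t - s))) * (L * profile s - f (profile s)))) /\
  \int[lebesgue_measure]_(s in `]0, t[)
    (expR (- (L * (t - s))) * (L * profile s - f (profile s))) =
  profile t - expR (- (L * t)).
Proof.
move=> t0; pose F s := expR (L * s - L * t) * profile s.
have eE s : expR (- (L * (t - s))) = expR (L * s - L * t).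
  by congr expR; ring.
have cp s : 0 <= s <= t -> {for s, continuous profile}.
  move=> /andP[s0 st]; apply/differentiable_continuous/derivable1_diffP.
  exact: (@ex_derive _ _ _ _ _ _ _ (is_derive_profile s0)).
have [||i1 i2] := @Rintegral_FTC R
   (fun s => expR (L * s - L * t) * (L * profile s - f (profile s))) F _ _ t0.
- move=> s st; apply: cvgM; first exact: (@continuous_expR_affine R L (- (L * t))).
  apply: cvgB; first by apply: cvgM; [exact: cvg_cst|exact: cp].
  apply: (@continuous_comp _ _ _ profile f s); first exact: cp.
  exact: continuous_nonlinearity.
- move=> s /andP[s0 st].
  have h := is_deriveM (is_derive_expR_affine L (- (L * t)) s) (is_derive_profile s0).
  by apply: (is_derive_eq h); rewrite /GRing.scale/=; ring.
split.
  by move: i1; congr (_.-integrable _ _); apply/funext => s /=; rewrite eE.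
transitivity (F t - F 0); last first.
  by rewrite /F subrr expR0 mul1r mulr0 add0r /profile mulr0 addr0 powR1 mulr1.
by rewrite -i2; apply: eq_Rintegral_itv => s _; rewrite eE.
Qed.

End nonlinearity.

(** * Bounded mild solutions and comparison *)

Lemma Rintegral_expR_itv {R : realType} (L t : R) : 0 <= t ->
  L * \int[lebesgue_measure]_(s in `]0, t[) expR (- (L * (t - s))) = 1 - expR (- (L * t)).
Proof.
move=> t0; have := @Rintegral_expR_mix R 0 L 0 t t0.
rewrite !subr0 mul0r oppr0 expR0 => <-; congr (_ * _); apply: eq_Rintegral_itv => s _.
by rewrite mul0r oppr0 expR0 mulr1.
Qed.

Section antisymmetric_bounds.
Context {R : realType} (N m : nat).
Implicit Types (f g : 'rV[R]_N -> R).

Lemma normr_sgprod_le1 (y : 'rV[R]_N) : `|sgprod m y| <= 1.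
Proof.
rewrite normr_prod; apply: prodr_ile1 => i _.
by rewrite normr_ge0/= normr_sg lern1 leq_b1.
Qed.

(** Both functions at y are the same factor, of modulus at most 1, times their values at one point
    of the orthant; on the hyperplanes f vanishes. *)
Lemma antisymmetric_normr_le f g c : antisymmetric_upto m f -> antisymmetric_upto m g ->
  (forall y, orthant m y -> `|f y| <= `|g y| + c) -> 0 <= c -> forall y, `|f y| <= `|g y| + c.
Proof.
move=> af ag fg c0 y.
have [[_ e]|[z zm [_ [_ e]]]] := antisymmetric_reduce m y.
  by rewrite (e _ af) normr0 addr_ge0.
rewrite (e _ af) (e _ ag) !normrM; have := fg z zm; have := normr_sgprod_le1 y.
set s := `|sgprod m y| => s1 fgz; have s0 : 0 <= s by exact: normr_ge0.
by have := normr_ge0 (f z); have := normr_ge0 (g z); nra.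
Qed.

Lemma antisymmetric_bound f c : antisymmetric_upto m f -> 0 <= c ->
  (forall y, orthant m y -> `|f y| <= c) -> forall y, `|f y| <= c.
Proof.
move=> af c0 fc y; rewrite -[leRHS]add0r -(normr0 R).
apply: (@antisymmetric_normr_le f (fun=> 0)) => //.
  by move=> i im x; rewrite oppr0.
by move=> z zm; rewrite normr0 add0r fc.
Qed.

Lemma antisymmetric_eq f g : antisymmetric_upto m f -> antisymmetric_upto m g ->
  (forall y, orthant m y -> f y = g y) -> f = g.
Proof.
move=> af ag fg; apply/funext => y.
have [[_ e]|[z zm [_ [_ e]]]] := antisymmetric_reduce m y; first by rewrite (e _ af) (e _ ag).
by rewrite (e _ af) (e _ ag) fg.
Qed.

Lemma antisymmetricZ c f : antisymmetric_upto m f -> antisymmetric_upto m (fun y => c * f y).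
Proof. by move=> af i im x; rewrite af// mulrN. Qed.

Lemma antisymmetricD f g : antisymmetric_upto m f -> antisymmetric_upto m g ->
  antisymmetric_upto m (fun y => f y + g y).
Proof. by move=> af ag i im x; rewrite af// ag// opprD. Qed.

Lemma antisymmetric_odd (k : R -> R) f : (forall r, k (- r) = - k r) ->
  antisymmetric_upto m f -> antisymmetric_upto m (fun y => k (f y)).
Proof. by move=> kN af i im x; rewrite af. Qed.

Lemma antisymmetric_lim (f_ : nat -> 'rV[R]_N -> R) f :
  (forall n, antisymmetric_upto m (f_ n)) ->
  (forall y, f_ n y @[n --> \oo] --> f y) -> antisymmetric_upto m f.
Proof.
move=> af ff i im x.
have h : f_ n (reflection i x) @[n --> \oo] --> - f x.
  by under eq_fun do rewrite (af _ _ im); exact: cvgN.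
exact: (cvg_unique _ (ff _) h).
Qed.

(** Monotonicity is available on the orthant only; elsewhere the sequence is 0 or a fixed multiple
    of one taken at a point of the orthant. *)
Lemma antisymmetric_monotone_cvg (f_ : nat -> 'rV[R]_N -> R) c :
  (forall n, antisymmetric_upto m (f_ n)) ->
  (forall y, orthant m y -> forall n, f_ n y <= f_ n.+1 y) ->
  (forall y, orthant m y -> forall n, f_ n y <= c) ->
  forall y, f_ n y @[n --> \oo] --> lim (f_ n y @[n --> \oo]).
Proof.
move=> af fS fc y; apply/cvg_ex.
have [[_ e]|[z zm [_ [_ e]]]] := antisymmetric_reduce m y.
  by exists 0; under eq_fun do rewrite (e _ (af _)); exact: cvg_cst.
have /cvg_ex[l fl] : cvg (f_ n z @[n --> \oo]).
  apply: nondecreasing_is_cvgn; first by apply/nondecreasing_seqP => n; exact: fS.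
  by exists c => _ [n _ <-]; exact: fc.
exists (sgprod m y * l); under eq_fun do rewrite e//.
by apply: cvgM => //; exact: cvg_cst.
Qed.

End antisymmetric_bounds.

Section mild.
Context {R : realType} (N m : nat).
Variables (a : R) (a0 : 0 < a).
Notation f := (nonlinearity a).
Notation mu := (@lebesgue_measure R).
Implicit Types (u w : R -> 'rV[R]_N -> R) (phi psi : 'rV[R]_N -> R) (t s L M : R) (x y : 'rV[R]_N).

(** A single M bounds data and solution, so that one damping rate serves both solutions in a
    comparison. *)
Definition bounded_mild M phi u :=
  [/\ measurable_fun setT phi, forall y, `|phi y| <= M, bounded_field M u &
    forall t x, 0 < t ->
      u t x = heat_semigroup t phi x + duhamel 0 (fun s y => - f (u s y)) t x].

Lemma bounded_field_nonlinearity M u : bounded_field M u ->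
  bounded_field (M `^ a * M) (fun s y => - f (u s y)).
Proof.
move=> [mu' uM]; split.
  by apply: measurable_funN; exact: (measurableT_comp (measurable_nonlinearity a0) mu').
by move=> s y s0; rewrite normrN; apply: normr_nonlinearity_le => //; exact: uM.
Qed.

Lemma bounded_field_shifted M L u : 0 <= L -> bounded_field M u ->
  bounded_field (L * M + M `^ a * M) (fun s y => L * u s y - f (u s y)).
Proof.
move=> L0 uM; rewrite -{1}(ger0_norm L0).
exact: (bounded_fieldD (bounded_fieldZ L uM) (bounded_field_nonlinearity uM)).
Qed.

Lemma bounded_mild_shift M phi u L : 0 <= L -> bounded_mild M phi u -> forall t x, 0 < t ->
  u t x = expR (- (L * t)) * heat_semigroup t phi x +
    duhamel L (fun s y => L * u s y - f (u s y)) t x.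
Proof.
move=> L0 [mf0 phiM uM uE] t x t0.
have uE' t' x' : 0 < t' -> u t' x' = expR (- (0 * t')) * heat_semigroup t' phi x' +
    duhamel 0 (fun s y => - f (u s y)) t' x'.
  by move=> t0'; rewrite mul0r oppr0 expR0 mul1r; exact: uE.
have E := duhamel_shift (lexx 0) L0 mf0 phiM (bounded_field_nonlinearity uM) uM uE' x t0.
apply: (etrans E); congr (_ + _).
by apply: eq_duhamel => s y s0; rewrite subr0 addrC.
Qed.

(** The way back from the damped iteration: changing the rate from L to 0 removes the term L u from
    the source. *)
Lemma bounded_mild_unshift M phi u L : 0 <= L -> measurable_fun setT phi ->
  (forall y, `|phi y| <= M) -> bounded_field M u ->
  (forall t x, 0 < t -> u t x = expR (- (L * t)) * heat_semigroup t phi x +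
    duhamel L (fun s y => L * u s y - f (u s y)) t x) -> bounded_mild M phi u.
Proof.
move=> L0 mf0 phiM uM uE; split=> // t x t0.
have E := duhamel_shift L0 (lexx 0) mf0 phiM (bounded_field_shifted L0 uM) uM uE x t0.
apply: (etrans E).
rewrite mul0r oppr0 expR0 mul1r; congr (_ + _); apply: eq_duhamel => s y s0.
by rewrite sub0r mulNr addrAC subrr add0r.
Qed.

Lemma bounded_mild_restart M phi u tau : 0 < tau -> bounded_mild M phi u ->
  bounded_mild M (u tau) (fun s => u (tau + s)).
Proof.
move=> tau0 [mf0 phiM uM uE]; split.
- exact: bounded_field_measurable uM.
- by move=> y; exact: uM.2.
- exact: bounded_field_shift (ltW tau0) uM.
move=> t x t0.
have := @duhamel_restart R N M _ 0 phi _ u (lexx 0) mf0 phiM (bounded_field_nonlinearity uM) _ tau t x tau0 t0.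
rewrite mul0r oppr0 expR0 mul1r; apply => t' x' t0'.
by rewrite mul0r oppr0 expR0 mul1r; exact: uE.
Qed.

Lemma antisymmetric_mild M phi u t : bounded_mild M phi u -> 0 < t ->
  (forall s, 0 < s -> antisymmetric_upto m (u s)) -> forall L,
  forall s, 0 < s -> antisymmetric_upto m (fun y => L * u s y - f (u s y)).
Proof.
move=> _ _ au L s s0; apply: antisymmetricD; first exact/antisymmetricZ/au.
by apply: (@antisymmetric_odd _ _ _ (fun r => - f r)) => [r|]; [rewrite nonlinearityN|exact: au].
Qed.

Lemma shifted_incr M r s : - M <= s -> s <= r -> r <= M ->
  0 <= (a + 1) * M `^ a * r - f r - ((a + 1) * M `^ a * s - f s) <= (a + 1) * M `^ a * (r - s).
Proof.
move=> Ms sr rM; have /andP[] := nonlinearity_incr a0 Ms sr rM.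
by set L := (a + 1) * M `^ a => h1 h2; apply/andP; split; lra.
Qed.

Variable (h : 'rV[R]_N -> R).
Hypotheses (mh : measurable_fun setT h) (ah : antisymmetric_upto m h).
Hypothesis hp : forall x, orthant m x -> h x = 1.

Lemma normr_indicator_le1 y : `|h y| <= 1.
Proof. by apply: (antisymmetric_bound ah) => // z zm; rewrite hp// normr1. Qed.

Lemma heat_indicator_le1 t x : 0 < t -> heat_semigroup t h x <= 1.
Proof.
by move=> t0; apply: le_trans (ler_norm _) (normr_heat_semigroup_le t0 mh normr_indicator_le1 x).
Qed.

Lemma heat_indicator_ge0 t x : 0 < t -> orthant m x -> 0 <= heat_semigroup t h x.
Proof.
move=> t0 xm; apply: (heat_semigroup_orthant_ge0 t0 mh normr_indicator_le1 ah) => // y ym.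
by rewrite hp.
Qed.

(** By antisymmetry [h] equals [sgprod m], and positive dilations preserve signs. Hence rescaling a
    solution merely multiplies its data by a constant. *)
Lemma indicator_scale l y : 0 < l -> h (l *: y) = h y.
Proof.
move=> l0.
have hE z : h z = sgprod m z.
  have [[-> e]|[z' z'm [_ [_ e]]]] := antisymmetric_reduce m z; first exact: e.
  by rewrite (e _ ah) hp// mulr1.
by rewrite !hE; apply: eq_bigr => i _; rewrite mxE sgrM gtr0_sg// mul1r.
Qed.

(* With q < 1 the contraction factor of the integral operator on [0, T], the
   positive part of u - w on the orthant is at most 2 M q^n for every n. *)
Lemma mild_comparison M phi psi u w : bounded_mild M phi u -> bounded_mild M psi w ->
  antisymmetric_upto m phi -> antisymmetric_upto m psi ->
  (forall s, 0 < s -> antisymmetric_upto m (u s)) ->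
  (forall s, 0 < s -> antisymmetric_upto m (w s)) ->
  (forall y, orthant m y -> phi y <= psi y) ->
  forall t x, 0 < t -> orthant m x -> u t x <= w t x.
Proof.
move=> Hu Hw af ag au aw fg T x T0 xm.
have [mf0 phiM uM _] := Hu; have [mg0 psiM wM _] := Hw.
have M0 := bounded_field_ge0 uM.
pose L := (a + 1) * M `^ a.
have L0 : 0 <= L by rewrite mulr_ge0 ?powR_ge0// addr_ge0// ltW.
pose q := 1 - expR (- (L * T)).
have q0 : 0 <= q by rewrite subr_ge0 -expR0 ler_expR oppr_le0 mulr_ge0// ltW.
have q1 : q < 1 by rewrite ltrBlDr ltrDl expR_gt0.
have step n : forall t y, 0 < t -> t <= T -> orthant m y -> u t y - w t y <= 2 * M * q ^+ n.
  elim: n => [|n IH] t y t0 tT ym.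
    rewrite expr0 mulr1; apply: le_trans (ler_norm _) _; apply: le_trans (ler_normB _ _) _.
    by rewrite mulr2n mulrDl mul1r lerD//; [exact: uM.2|exact: wM.2].
  rewrite (bounded_mild_shift L0 Hu y t0) (bounded_mild_shift L0 Hw y t0).
  have bu := bounded_field_shifted L0 uM; have bw := bounded_field_shifted L0 wM.
  (* The error carried by the induction hypothesis is added to the source of w as [c * h]: it equals
     c on the orthant and keeps the source antisymmetric, which a constant would not. *)
  pose c := L * (2 * M * q ^+ n).
  have qn0 : 0 <= 2 * M * q ^+ n by apply: mulr_ge0; [exact: mulr_ge0|exact: exprn_ge0].
  have c0 : 0 <= c by exact: mulr_ge0.
  have bh : bounded_field `|c| (fun (_ : R) z => c * h z).
    split; first by apply: measurable_funM => //; exact: (measurableT_comp mh measurable_snd).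
    by move=> s z _; rewrite normrM ler_piMr// normr_indicator_le1.
  have S1 : heat_semigroup t phi y <= heat_semigroup t psi y.
    exact: (heat_semigroup_orthant_le t0 mf0 phiM mg0 psiM af ag).
  have D1 : duhamel L (fun s z => L * u s z - f (u s z)) t y <=
      duhamel L (fun s z => (L * w s z - f (w s z)) + c * h z) t y.
    apply: (duhamel_orthant_le (M := L * M + M `^ a * M + `|c|)) ym => //.
    - split; first by case: bu.
      by move=> s z s0; apply: le_trans (bu.2 _ _ s0) _; rewrite lerDl.
    - exact: bounded_fieldD.
    - exact: (antisymmetric_mild Hu t0 au).
    - move=> s s0; apply: antisymmetricD; last exact: antisymmetricZ.
      exact: (antisymmetric_mild Hw t0 aw).
    move=> s z s0 st zm; rewrite hp// mulr1.
    have := uM.2 s z s0; have := wM.2 s z s0; rewrite !ler_norml => /andP[w1 w2] /andP[u1 u2].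
    (* Where u exceeds w, the sources differ by at most L (u - w), which the induction hypothesis
       bounds by c; elsewhere monotonicity of r -> L r - f r suffices. *)
    have [wu|uw] := leP (w s z) (u s z).
      have /andP[_ ] := shifted_incr w1 wu u2; rewrite -/L => hle.
      have := ler_wpM2l L0 (IH s z s0 (le_trans (ltW st) tT) zm); rewrite -/c; lra.
    have /andP[] := shifted_incr u1 (ltW uw) w2; rewrite -/L => hle _.
    by rewrite -subr_ge0; move: hle c0; lra.
  have D2 : duhamel L (fun s z => (L * w s z - f (w s z)) + c * h z) t y <=
     duhamel L (fun s z => L * w s z - f (w s z)) t y + 2 * M * q ^+ n.+1.
    (* The heat flow of [h] is at most 1, and L times the integral of exp (-L (t - s)) is 1 - exp
       (-L t) <= q: this produces the next power of q. *)
    rewrite (duhamelD t y L0 bw bh) lerD2l duhamelE.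
    apply: (@le_trans _ _ (\int[mu]_(s in `]0, t[) (expR (- (L * (t - s))) * c))).
      apply: le_Rintegral => //; first exact: (integrable_duhamel bh L0 t y).
        apply: (@integrable_itv_bounded _ _ _ _ `|c|).
          apply: measurable_funM => //; apply: measurable_expR_lin.
          by apply: measurable_funB.
        move=> s /andP[s0 st]; rewrite normrM ler_piMl// normr_expRN_le1// mulr_ge0//.
        by rewrite subr_ge0 ltW.
      move=> s; rewrite /= in_itv/= => /andP[s0 st].
      rewrite ler_wpM2l ?expR_ge0// (@heat_semigroupZ R N _ h c 1) ?subr_gt0//; last first.
        exact: normr_indicator_le1.
      by rewrite ler_piMr// heat_indicator_le1 ?subr_gt0.
    under eq_Rintegral do rewrite mulrC.
    rewrite RintegralZl//; last first.
      apply: (@integrable_itv_bounded _ _ _ _ 1); first by apply: measurable_expR_lin; exact: measurable_funB.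
      by move=> s /andP[s0 st]; rewrite normr_expRN_le1// mulr_ge0// subr_ge0 ltW.
    rewrite /c mulrAC (Rintegral_expR_itv L (ltW t0)) mulrC exprSr mulrA.
    apply: ler_wpM2l => //.
    rewrite lerB// ler_expR lerN2; exact: ler_wpM2l.
  have e0 : 0 <= expR (- (L * t)) by exact: expR_ge0.
  rewrite lerBlDr; apply: le_trans (lerD (ler_wpM2l e0 S1) (le_trans D1 D2)) _.
  by rewrite addrA addrC.
rewrite -subr_le0.
have qn : 2 * M * q ^+ n @[n --> \oo] --> (2 * M * 0 : R).
  apply: cvgM; first exact: cvg_cst.
  by apply: cvg_expr; rewrite ger0_norm.
rewrite -(mulr0 (2 * M)); apply: (ler_cvg_to (cvg_cst _) qn); near=> n; exact: step.
Unshelve. all: by end_near. Qed.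

End mild.

(** * Monotone iteration between the two barriers *)

Section limit_solution.
Context {R : realType} (N m : nat).
Variables (a : R) (a0 : 0 < a) (h : 'rV[R]_N -> R).
Notation f := (nonlinearity a).
Notation mu := (@lebesgue_measure R).
Implicit Types (u w : R -> 'rV[R]_N -> R) (t s L M l : R) (x y : 'rV[R]_N).
Hypotheses (mh : measurable_fun setT h) (ah : antisymmetric_upto m h).
Hypothesis hp : forall x, orthant m x -> h x = 1.
Let h1 := normr_indicator_le1 ah hp.

(** The supremum of f' on [-1, 1], the range of all iterates, so that [phi] is nondecreasing
    there. *)
Let L : R := a + 1.
Let L0 : 0 <= L. Proof. by rewrite addr_ge0// ltW. Qed.
Let phi (r : R) := L * r - f r.
Let phiN r : phi (- r) = - phi r.
Proof. by rewrite /phi nonlinearityN mulrN opprD opprK. Qed.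

Let phi_incr r s : -1 <= s -> s <= r -> r <= 1 -> phi s <= phi r.
Proof.
move=> s1 sr r1; have := shifted_incr a0 s1 sr r1.
rewrite powR1 mulr1 => /andP[+ _]; by rewrite subr_ge0.
Qed.

(** The upper barrier is p(s) [h], an antisymmetric function, read on the orthant where [h] is 1;
    the lower one starts from the same data. *)
Definition between u := [/\ measurable_fun setT (fun z : R * 'rV[R]_N => u z.1 z.2),
  forall s, 0 < s -> antisymmetric_upto m (u s) &
  forall s y, 0 < s -> orthant m y -> profile a s * heat_semigroup s h y <= u s y <= profile a s].

(** The value 0 at nonpositive times makes the iterates converge at every point of space-time, so
    that the limit is jointly measurable. *)
Let picard u t x : R := if 0 < t then
  expR (- (L * t)) * heat_semigroup t h x + duhamel L (fun s y => phi (u s y)) t x else 0.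

Lemma between_ge0 u s y : between u -> 0 < s -> orthant m y -> 0 <= u s y.
Proof.
move=> [_ _ uB] s0 ym; have /andP[+ _] := uB s y s0 ym; apply: le_trans.
by rewrite mulr_ge0 ?(ltW (profile_gt0 a0 (ltW s0)))// (heat_indicator_ge0 mh ah hp).
Qed.

Lemma between_profile u s y : between u -> 0 < s -> `|u s y| <= profile a s.
Proof.
move=> bu s0; have [_ au uB] := bu.
have p0 := ltW (profile_gt0 a0 (ltW s0)).
apply: (antisymmetric_bound (au s s0)) => // z zm.
by rewrite ger0_norm ?(between_ge0 bu)//; case/andP: (uB s z s0 zm).
Qed.

Lemma between_bounded u : between u -> bounded_field 1 u.
Proof.
move=> bu; split; first by case: bu.
by move=> s y s0; apply: le_trans (between_profile y bu s0) (profile_le1 a0 (ltW s0)).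
Qed.

Lemma measurable_profile : measurable_fun setT (profile a).
Proof.
apply: (measurableT_comp (measurable_powR (- a^-1))).
apply: measurable_funD; first exact: measurable_cst.
by apply: measurable_funM; [exact: measurable_cst|exact: measurable_id].
Qed.

Lemma measurable_indicator_heat :
  measurable_fun setT (fun z : R * 'rV[R]_N => heat_semigroup z.1 h z.2).
Proof.
apply: (@measurable_heat_semigroup_param R N _ _ fst snd (fun=> h)).
- exact: measurable_fst.
- exact: measurable_snd.
- exact: (measurableT_comp mh measurable_snd).
Qed.

Let phi_bounded u : bounded_field 1 u -> bounded_field (L + 1) (fun s y => phi (u s y)).
Proof. by move=> bu; have := bounded_field_shifted a0 L0 bu; rewrite !mulr1 powR1. Qed.

Let q s := phi (profile a s).

Let mq : measurable_fun setT q.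
Proof.
apply: measurable_funB; first by apply: measurable_funM; [exact: measurable_cst|exact: measurable_profile].
exact: (measurableT_comp (measurable_nonlinearity a0) measurable_profile).
Qed.

Let q_ge0 s : 0 < s -> 0 <= q s.
Proof.
move=> s0; have <- : phi 0 = 0 by rewrite /phi mulr0 nonlinearity0 subrr.
apply: phi_incr; first by rewrite lerN10.
- exact: ltW (profile_gt0 a0 (ltW s0)).
- exact: (profile_le1 a0 (ltW s0)).
Qed.

Let q_le s : 0 < s -> q s <= L.
Proof.
move=> s0; apply: (@le_trans _ _ (phi 1)).
  apply: phi_incr => //; last exact: (profile_le1 a0 (ltW s0)).
  by apply: (@le_trans _ _ 0); [rewrite lerN10|exact: ltW (profile_gt0 a0 (ltW s0))].
by rewrite /phi mulr1 lerBlDr lerDl nonlinearity_ge0.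
Qed.

Let q_bounded w : bounded_field 1 w -> bounded_field L (fun s y => q s * w s y).
Proof.
move=> [mw w1]; split.
  by apply: measurable_funM => //; exact: (measurableT_comp mq measurable_fst).
move=> s y s0; rewrite normrM (ger0_norm (q_ge0 s0)).
by rewrite -[leRHS]mulr1; apply: ler_pM => //; [exact: q_ge0|exact: q_le|exact: w1].
Qed.

Let heat_bounded : bounded_field 1 (fun s y => if 0 < s then heat_semigroup s h y else 0).
Proof.
split.
  apply: measurable_fun_ifT => //; last exact: measurable_indicator_heat.
  exact: (measurable_fun_ltr (measurable_cst (0 : R)) measurable_fst).
by move=> s y s0; rewrite s0; exact: normr_heat_semigroup_le s0 mh h1 y.
Qed.

Let indicator_bounded : bounded_field 1 (fun _ : R => h).
Proof. by split=> [|s y _]; [exact: (measurableT_comp mh measurable_snd)|exact: h1]. Qed.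

(** The flow of duration t - s applied to the flow of [h] at time s is the flow of [h] at time t,
    whatever s is; only the scalar integral of [profile_integral] remains. *)
Let duhamel_heat t x : 0 < t ->
  duhamel L (fun s y => q s * (if 0 < s then heat_semigroup s h y else 0)) t x =
  (profile a t - expR (- (L * t))) * heat_semigroup t h x.
Proof.
move=> t0; have [i1 i2] := profile_integral a0 L (ltW t0).
rewrite -i2 mulrC -RintegralZl// duhamelE; apply: eq_Rintegral_itv => s /andP[s0 st].
under [X in heat_semigroup _ X]eq_fun do rewrite s0.
rewrite (heat_semigroupZ _ _ (measurable_heat_semigroup s mh) (normr_heat_semigroup_le s0 mh h1)) ?subr_gt0//.
rewrite (heat_semigroup_add _ s0 mh h1) ?subr_gt0// subrK /q /phi; ring.
Qed.

Let duhamel_indicator t x : 0 < t -> orthant m x ->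
  duhamel L (fun s y => q s * h y) t x <= profile a t - expR (- (L * t)).
Proof.
move=> t0 xm; have [i1 i2] := profile_integral a0 L (ltW t0).
rewrite -i2 duhamelE; apply: le_Rintegral => //.
  exact: (integrable_duhamel (q_bounded indicator_bounded) L0 t x).
move=> s; rewrite /= in_itv/= => /andP[s0 st].
rewrite ler_wpM2l ?expR_ge0// (heat_semigroupZ _ _ mh h1) ?subr_gt0//.
by rewrite ler_piMr ?q_ge0// (heat_indicator_le1 mh ah hp)// subr_gt0.
Qed.

Let antisym_phi u : (forall s, 0 < s -> antisymmetric_upto m (u s)) ->
  forall s, 0 < s -> antisymmetric_upto m (fun y => phi (u s y)).
Proof. by move=> au s s0; apply: antisymmetric_odd (au s s0). Qed.

Let antisym_heat s : 0 < s -> antisymmetric_upto m (heat_semigroup s h).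
Proof. by move=> s0; apply: antisymmetric_heat_semigroup s0 mh h1 ah. Qed.

Let picard_between u : between u -> between (picard u).
Proof.
move=> bu; have [mu' au uB] := bu; have bp := phi_bounded (between_bounded bu).
split.
- rewrite /picard; apply: measurable_fun_ifT => //.
    exact: (measurable_fun_ltr (measurable_cst (0 : R)) measurable_fst).
  have md := measurable_duhamel L bp.
  apply: (measurable_funD _ md).
  apply: measurable_funM; last exact: measurable_indicator_heat.
  by apply: measurable_expR_lin; exact: measurable_fst.
- move=> s s0; rewrite /picard s0; apply: antisymmetricD.
    exact/antisymmetricZ/antisym_heat.
  by apply: (antisymmetric_duhamel (m := m) s bp L0); exact: antisym_phi.
move=> t x t0 xm; rewrite /picard t0; apply/andP; split.
  have -> : profile a t * heat_semigroup t h x = expR (- (L * t)) * heat_semigroup t h x +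
      (profile a t - expR (- (L * t))) * heat_semigroup t h x.
    by rewrite -mulrDl addrC subrK.
  rewrite lerD2l -duhamel_heat//.
  apply: (duhamel_orthant_le (M := L + 1) _ _ _ _ _ _ xm) => //.
  - have [b1 b2] := q_bounded heat_bounded; split => // s y s0.
    by apply: le_trans (b2 s y s0) _; rewrite lerDl.
  - by move=> s s0; apply: antisymmetricZ; rewrite s0; exact: antisym_heat.
  - exact: antisym_phi.
  move=> s y s0 st ym; rewrite s0.
  have p0 := profile_gt0 a0 (ltW s0); have p1 := profile_le1 a0 (ltW s0).
  have /andP[lo up] := uB s y s0 ym.
  have S0 := heat_indicator_ge0 mh ah hp s0 ym; have S1 := heat_indicator_le1 mh ah hp y s0.
  have pS0 : 0 <= profile a s * heat_semigroup s h y by rewrite mulr_ge0// ltW.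
  apply: (@le_trans _ _ (phi (profile a s * heat_semigroup s h y))); last first.
    apply: phi_incr => //; last exact: le_trans p1.
    by apply: le_trans pS0; rewrite lerN10.
  (* The subsolution property: with S the heat flow of [h], f (p S) = S^a S f(p) <= S f(p), because
     0 <= S <= 1. *)
  rewrite /q /phi mulrBl -mulrA lerB//.
  rewrite /nonlinearity normrM (ger0_norm (ltW p0)) (ger0_norm S0) powRM ?(ltW p0)//.
  rewrite -!mulrA; apply: ler_wpM2l; first exact: powR_ge0.
  have p1a : 1 `^ a = 1 :> R by rewrite powR1.
  rewrite ler_piMl// -[leRHS]p1a.
  by apply: ge0_ler_powR; rewrite ?nnegrE ?(ltW a0).
have -> : profile a t = expR (- (L * t)) + (profile a t - expR (- (L * t))) by rewrite addrC subrK.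
apply: lerD.
  by rewrite ler_piMr ?expR_ge0// (heat_indicator_le1 mh ah hp).
(* The upper barrier enters as the antisymmetric field [q s * h], equal to phi (p(s)) on the
   orthant. *)
apply: le_trans (duhamel_indicator t0 xm).
apply: (duhamel_orthant_le (M := L + 1) _ _ _ _ _ _ xm) => //.
- have [b1 b2] := q_bounded indicator_bounded; split => // s y s0.
  by apply: le_trans (b2 s y s0) _; rewrite lerDl.
- exact: antisym_phi.
- by move=> s s0; exact: antisymmetricZ.
move=> s y s0 st ym; rewrite hp// mulr1; have /andP[lo up] := uB s y s0 ym.
apply: phi_incr => //; last exact: (profile_le1 a0 (ltW s0)).
by apply: le_trans (between_ge0 bu s0 ym); rewrite lerN10.
Qed.

Let picard_le u w : between u -> between w ->
  (forall s y, 0 < s -> orthant m y -> u s y <= w s y) ->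
  forall s y, 0 < s -> orthant m y -> picard u s y <= picard w s y.
Proof.
move=> bu bw uw s y s0 ym; rewrite /picard s0 lerD2l.
have [_ au uB] := bu; have [_ aw wB] := bw.
apply: (duhamel_orthant_le (M := L + 1) _ _ _ _ _ _ ym) => //.
- exact/phi_bounded/between_bounded.
- exact/phi_bounded/between_bounded.
- exact: antisym_phi.
- exact: antisym_phi.
move=> r z r0 rs zm; apply: phi_incr; last 2 first.
- exact: uw.
- have /andP[_ wp] := wB r z r0 zm; exact: le_trans wp (profile_le1 a0 (ltW r0)).
by apply: le_trans (between_ge0 bu r0 zm); rewrite lerN10.
Qed.

(** Starting at the lower barrier makes the first step increasing, since the next iterate lies above
    that barrier; order preservation does the rest. *)
Let base t x : R := if 0 < t then profile a t * heat_semigroup t h x else 0.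

Let base_between : between base.
Proof.
split.
- rewrite /base; apply: measurable_fun_ifT => //.
    exact: (measurable_fun_ltr (measurable_cst (0 : R)) measurable_fst).
  apply: measurable_funM; last exact: measurable_indicator_heat.
  exact: (measurableT_comp measurable_profile measurable_fst).
- by move=> s s0; rewrite /base s0; exact/antisymmetricZ/antisym_heat.
move=> s y s0 ym; rewrite /base s0 lexx/= ler_piMr ?(heat_indicator_le1 mh ah hp)//.
exact: ltW (profile_gt0 a0 (ltW s0)).
Qed.

Let it n := iter n picard base.

Let it_between n : between (it n).
Proof. by elim: n => [|n IH]; [exact: base_between|exact: picard_between]. Qed.

Let it_incr n s y : 0 < s -> orthant m y -> it n s y <= it n.+1 s y.
Proof.
elim: n s y => [|n IH] s y s0 ym; last exact: (picard_le (it_between n) (it_between n.+1)).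
by have [_ _ /(_ s y s0 ym)/andP[+ _]] := it_between 1; rewrite {1}/it /= /base s0.
Qed.

Definition limit_mild t x : R := lim (it n t x @[n --> \oo]).

Let it_neg n t x : t <= 0 -> it n t x = 0.
Proof. by move=> t0; case: n => [|n]; rewrite /it /= /base /picard ltNge t0. Qed.

Let it_cvg t x : it n t x @[n --> \oo] --> limit_mild t x.
Proof.
have [t0|t0] := ltP 0 t.
  apply: (@antisymmetric_monotone_cvg R N m (fun n => it n t) 1).
  - by move=> n; have [_ + _] := it_between n; exact.
  - by move=> y ym n; exact: it_incr.
  move=> y ym n; have [_ _ /(_ t y t0 ym)/andP[_ +]] := it_between n.
  by move=> /le_trans; apply; exact: (profile_le1 a0 (ltW t0)).
have e : (fun n => it n t x) = cst 0 by apply/funext => n; exact: it_neg.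
by rewrite /limit_mild e lim_cst//; exact: cvg_cst.
Qed.

Lemma limit_mild_neg t x : t <= 0 -> limit_mild t x = 0.
Proof.
move=> t0; rewrite /limit_mild (_ : (fun n => it n t x) = cst 0) ?lim_cst//.
by apply/funext => n; exact: it_neg.
Qed.

Lemma limit_mild_between : between limit_mild.
Proof.
split.
- apply: (@measurable_fun_cvg _ _ _ setT (fun n (z : R * 'rV[R]_N) => it n z.1 z.2)).
    by move=> n; case: (it_between n).
  by move=> z _; exact: it_cvg.
- move=> s s0; apply: (@antisymmetric_lim _ _ _ (fun n => it n s)); last exact: it_cvg.
  by move=> n; have [_ + _] := it_between n; exact.
move=> s y s0 ym; apply/andP; split.
  apply: (ler_cvg_to (cvg_cst _) (@it_cvg s y)); near=> n.
  by have [_ _ /(_ s y s0 ym)/andP[]] := it_between n.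
apply: (ler_cvg_to (@it_cvg s y) (cvg_cst _)); near=> n.
by have [_ _ /(_ s y s0 ym)/andP[]] := it_between n.
Unshelve. all: by end_near. Qed.

Lemma limit_mildP : bounded_mild a 1 h limit_mild.
Proof.
have bl := between_bounded limit_mild_between.
apply: (bounded_mild_unshift a0 L0 mh h1 bl) => t x t0.
have c1 : it n.+1 t x @[n --> \oo] --> limit_mild t x.
  by have h2 : it n t x @[n --> \oo] --> limit_mild t x := @it_cvg t x; rewrite (cvg_shiftS (fun n => it n t x)).
apply: (cvg_unique _ c1) => //.
rewrite /it /= {1}/picard; under eq_fun do rewrite t0.
apply: cvgD; first exact: cvg_cst.
apply: (cvg_duhamel (M := L + 1)) => //; first exact: ltW.
  by move=> n; exact/phi_bounded/between_bounded/it_between.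
move=> s y s0; apply: cvgB.
  by apply: cvgM; [exact: cvg_cst|exact: it_cvg].
apply: (@continuous_cvg _ _ _ _ _ (fun n => it n s y) f); last exact: it_cvg.
exact: continuous_nonlinearity.
Qed.

End limit_solution.

(** * Rescaling and the self-similar limit *)

Section rescaling.
Context {R : realType} (N m : nat).
Variables (a : R) (a0 : 0 < a) (h : 'rV[R]_N -> R).
Notation f := (nonlinearity a).
Implicit Types (u w : R -> 'rV[R]_N -> R) (t s L M l : R) (x y : 'rV[R]_N).
Hypotheses (mh : measurable_fun setT h) (ah : antisymmetric_upto m h).
Hypothesis hp : forall x, orthant m x -> h x = 1.
Let h1 := normr_indicator_le1 ah hp.
Notation v := (limit_mild a h).
Notation W l := (dilation a l v).

Let sqr_powR l : 0 < l -> (l `^ (2 / a)) `^ a = l ^+ 2.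
Proof. by move=> l0; rewrite -powRrM divfK ?gt_eqF// powR_mulrn// ltW. Qed.

Let vb := limit_mild_between a0 mh ah hp.

(** The exponent 2 / a is the one for which (l^(2/a))^a = l^2, the factor produced by the rescaling
    of time. *)
Lemma dilation_nonlinearity l r : 0 < l -> f (l `^ (2 / a) * r) = l ^+ 2 * (l `^ (2 / a) * f r).
Proof.
move=> l0; rewrite /nonlinearity normrM (ger0_norm (powR_ge0 _ _)) powRM ?powR_ge0//.
by rewrite sqr_powR//; ring.
Qed.

Lemma dilation_mild l : 0 < l ->
  bounded_mild a (l `^ (2 / a)) (fun y => l `^ (2 / a) * h y) (W l).
Proof.
move=> l0; have [_ _ [mv v1] vE] := limit_mildP a0 mh ah hp.
have c0 : 0 <= l `^ (2 / a) by exact: powR_ge0.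
have l2 : 0 < l ^+ 2 by rewrite exprn_gt0.
have bv : bounded_field 1 (fun s y => v (l ^+ 2 * s) (l *: y)).
  split; last by move=> s y s0; rewrite v1// mulr_gt0.
  apply: (measurableT_comp mv (measurable_fun_pair _ _)).
    by apply: measurable_funM; [exact: measurable_cst|exact: measurable_fst].
  apply: measurable_fun_rV => i; under eq_fun do rewrite mxE.
  apply: measurable_funM; first exact: measurable_cst.
  exact: (measurableT_comp (measurable_coord_rV i) measurable_snd).
split.
- by apply: measurable_funM => //; exact: measurable_cst.
- by move=> y; rewrite normrM ger0_norm// ler_piMr// h1.
- split.
    by rewrite /dilation; apply: measurable_funM; [exact: measurable_cst|case: bv].
  by move=> s y s0; rewrite normrM ger0_norm// ler_piMr// bv.2.
move=> t x t0; rewrite /dilation vE ?mulr_gt0// mulrDr; congr (_ + _).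
  rewrite (heat_semigroup_scale t0 l0 mh h1 x) (heat_semigroupZ _ t0 mh h1).
  by congr (_ * heat_semigroup _ _ _); apply/funext => y; rewrite (indicator_scale ah hp).
rewrite (duhamel_scale x (lexx 0) l0 t0 (bounded_field_nonlinearity a0 (conj mv v1))) mulr0 mulrA.
rewrite -(duhamelZ (l `^ (2 / a) * l ^+ 2) t x (lexx 0) (bounded_field_nonlinearity a0 bv)).
by apply: eq_duhamel => s y s0; rewrite dilation_nonlinearity// mulrN mulrA (mulrC (l ^+ 2) (l `^ _)).
Qed.

Lemma antisymmetric_dilation l s : 0 < l -> 0 < s -> antisymmetric_upto m (W l s).
Proof.
move=> l0 s0 i im x; rewrite /dilation -mulrN; congr (_ * _).
have [_ av _] := vb; have ls0 : 0 < l ^+ 2 * s by rewrite mulr_gt0 ?exprn_gt0.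
rewrite -(av _ ls0 i im (l *: x)); congr limit_mild.
by apply/rowP => j; rewrite !mxE; case: ifP => _ //; rewrite mulrN.
Qed.

Lemma dilation_incr l l' t x : 0 < l -> l <= l' -> 0 < t -> orthant m x -> W l t x <= W l' t x.
Proof.
move=> l0 ll' t0 xm; have l'0 := lt_le_trans l0 ll'.
have cc : l `^ (2 / a) <= l' `^ (2 / a).
  by apply: ge0_ler_powR => //; rewrite ?nnegrE ?(ltW l0) ?(ltW l'0)// divr_ge0// ltW.
have [ml lM [mW WM] WE] := dilation_mild l0.
(* Comparison asks for one common bound, so the smaller solution is given that of the larger. *)
have ml' : bounded_mild a (l' `^ (2 / a)) (fun y => l `^ (2 / a) * h y) (W l).
  split => //; first by move=> y; apply: le_trans (lM y) cc.
  by split=> // s y s0; apply: le_trans (WM s y s0) cc.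
apply: (mild_comparison a0 mh ah hp ml' (dilation_mild l'0)) => //.
- exact: antisymmetricZ.
- exact: antisymmetricZ.
- by move=> s s0; exact: antisymmetric_dilation.
- by move=> s s0; exact: antisymmetric_dilation.
by move=> y ym; rewrite hp// !mulr1.
Qed.

(** The flat solution with initial value l^(2/a). Its limit as l grows is (a t)^(-1/a), the flat
    solution with infinite initial value. *)
Let profileE l t : 0 < l -> 0 <= t ->
  l `^ (2 / a) * profile a (l ^+ 2 * t) = (l ^- 2 + a * t) `^ (- a^-1).
Proof.
move=> l0 t0; have l2 : 0 < l ^+ 2 by rewrite exprn_gt0.
have -> : l `^ (2 / a) = (l ^- 2) `^ (- a^-1).
  rewrite -powR_mulrn ?(ltW l0)// -powRN -powRrM mulrNN.
  by congr (_ `^ _).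
rewrite /profile -powRM ?invr_ge0 ?(ltW l2)//; last by rewrite addr_ge0// !mulr_ge0// ltW.
by congr (_ `^ _); field; rewrite gt_eqF.
Qed.

Let powRN_le r s : 0 < s -> s <= r -> r `^ (- a^-1) <= s `^ (- a^-1).
Proof.
move=> s0 sr; rewrite !powRN lef_pV2 ?posrE ?powR_gt0 ?(lt_le_trans s0)//.
by apply: ge0_ler_powR; rewrite ?nnegrE ?invr_ge0 ?(ltW a0)// ltW// (lt_le_trans s0).
Qed.

Lemma dilation_ge0 l t x : 0 < l -> 0 < t -> orthant m x -> 0 <= W l t x.
Proof.
move=> l0 t0 xm; rewrite /dilation mulr_ge0 ?powR_ge0//.
apply: (between_ge0 a0 mh ah hp vb); first by rewrite mulr_gt0 ?exprn_gt0.
by move=> i im; rewrite mxE mulr_gt0// xm.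
Qed.

Lemma dilation_le l t x : 0 < l -> 0 < t -> `|W l t x| <= (a * t) `^ (- a^-1).
Proof.
move=> l0 t0; rewrite /dilation normrM (ger0_norm (powR_ge0 _ _)).
have lt0 : 0 < l ^+ 2 * t by rewrite mulr_gt0 ?exprn_gt0.
apply: (@le_trans _ _ (l `^ (2 / a) * profile a (l ^+ 2 * t))).
  by rewrite ler_wpM2l ?powR_ge0// (between_profile a0 mh ah hp _ vb).
rewrite profileE ?(ltW t0)//; apply: powRN_le; first exact: mulr_gt0.
by rewrite lerDr invr_ge0 exprn_ge0// ltW.
Qed.

Lemma dilation_ge l t x : 0 < l -> 0 < t -> orthant m x ->
  (l ^- 2 + a * t) `^ (- a^-1) * heat_semigroup t h x <= W l t x.
Proof.
move=> l0 t0 xm; have lt0 : 0 < l ^+ 2 * t by rewrite mulr_gt0 ?exprn_gt0.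
rewrite -profileE ?(ltW t0)// -mulrA /dilation ler_wpM2l ?powR_ge0//.
have xlm : orthant m (l *: x) by move=> i im; rewrite mxE mulr_gt0// xm.
have [_ _ /(_ _ _ lt0 xlm)/andP[+ _]] := vb; rewrite (heat_semigroup_scale t0 l0 mh h1 x).
rewrite (_ : (fun y => h (l *: y)) = h)//.
by apply/funext => y; rewrite (indicator_scale ah hp).
Qed.

(* At time l^-2 / a the bound (a t)^(-1/a) reaches the size l^(2/a) of the initial
   value of W l, so every W k is caught up by W l after that delay. *)
Lemma dilation_delay l k t x : 0 < l -> 0 < k -> 0 < t -> orthant m x ->
  W k (l ^- 2 / a + t) x <= W l t x.
Proof.
move=> l0 k0 t0 xm; set tau := l ^- 2 / a.
have tau0 : 0 < tau by rewrite divr_gt0// invr_gt0 exprn_gt0.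
have tauE : (a * tau) `^ (- a^-1) = l `^ (2 / a).
  have := profileE l0 (lexx 0); rewrite /profile !mulr0 !addr0 powR1 mulr1 => ->.
  by rewrite /tau mulrC divfK// gt_eqF.
have [_ _ [mW _] _] := dilation_mild k0.
have [mt _ bW eW] := bounded_mild_restart a0 tau0 (dilation_mild k0).
have Wtau : bounded_mild a (l `^ (2 / a)) (W k tau) (fun s => W k (tau + s)).
  split => //; first by move=> y; rewrite -tauE; exact: dilation_le.
  split; first by case: bW.
  move=> s y s0; apply: le_trans (dilation_le y k0 (addr_gt0 tau0 s0)) _.
  rewrite -tauE; apply: powRN_le; first exact: mulr_gt0.
  by rewrite ler_pM2l// lerDl ltW.
apply: (mild_comparison a0 mh ah hp Wtau (dilation_mild l0)) => //.
- exact: antisymmetric_dilation.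
- exact: antisymmetricZ.
- by move=> s s0; apply: antisymmetric_dilation => //; exact: addr_gt0.
- by move=> s s0; exact: antisymmetric_dilation.
move=> y ym; rewrite hp// mulr1 -tauE; apply: le_trans (ler_norm _) _.
exact: dilation_le.
Qed.

(** The limit runs over integers so that dominated convergence for sequences applies; monotonicity
    in l recovers real parameters. At times t <= 0 all terms vanish. *)
Definition selfsim t x : R := lim (W n.+1%:R t x @[n --> \oo]).

Let n0 n : 0 < n.+1%:R :> R. Proof. by rewrite ltr0n. Qed.

Let Wneg l t x : 0 < l -> t <= 0 -> W l t x = 0.
Proof.
move=> l0 t0; rewrite /dilation limit_mild_neg ?mulr0//.
by rewrite mulr_ge0_le0// exprn_ge0// ltW.
Qed.

Lemma cvg_selfsim t x : W n.+1%:R t x @[n --> \oo] --> selfsim t x.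
Proof.
have [t0|t0] := ltP 0 t.
  apply: (@antisymmetric_monotone_cvg R N m (fun n => W n.+1%:R t) ((a * t) `^ (- a^-1))).
  - by move=> n; exact: antisymmetric_dilation.
  - by move=> y ym n; apply: dilation_incr; rewrite ?ler_nat.
  by move=> y ym n; apply: le_trans (ler_norm _) _; exact: dilation_le.
rewrite /selfsim (_ : (fun n => W n.+1%:R t x) = cst 0) ?lim_cst//; first exact: cvg_cst.
by apply/funext => n; exact: Wneg.
Qed.

Lemma dilation_le_selfsim l t x : 0 < l -> 0 < t -> orthant m x -> W l t x <= selfsim t x.
Proof.
move=> l0 t0 xm; apply: (ler_cvg_to (cvg_cst _) (@cvg_selfsim t x)); near=> n.
apply: dilation_incr => //; apply: (@le_trans _ _ n%:R); last by rewrite ler_nat.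
by near: n; exact: nbhs_infty_ger.
Unshelve. all: by end_near. Qed.

Lemma selfsim_delay l t x : 0 < l -> 0 < t -> orthant m x ->
  selfsim (l ^- 2 / a + t) x <= W l t x.
Proof.
move=> l0 t0 xm; apply: (ler_cvg_to (@cvg_selfsim _ x) (cvg_cst _)); near=> n.
exact: dilation_delay.
Unshelve. all: by end_near. Qed.

Lemma antisymmetric_selfsim t : 0 < t -> antisymmetric_upto m (selfsim t).
Proof.
move=> t0; apply: (@antisymmetric_lim _ _ _ (fun n => W n.+1%:R t)); last exact: cvg_selfsim.
by move=> n; exact: antisymmetric_dilation.
Qed.

Lemma normr_selfsim_le t x : 0 < t -> `|selfsim t x| <= (a * t) `^ (- a^-1).
Proof.
move=> t0; apply: (ler_cvg_to (cvg_norm (@cvg_selfsim t x)) (cvg_cst _)); near=> n.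
exact: dilation_le.
Unshelve. all: by end_near. Qed.

Lemma selfsim_ge0 t x : 0 < t -> orthant m x -> 0 <= selfsim t x.
Proof.
move=> t0 xm; apply: (ler_cvg_to (cvg_cst _) (@cvg_selfsim t x)); near=> n.
exact: dilation_ge0.
Unshelve. all: by end_near. Qed.

Lemma measurable_selfsim : measurable_fun setT (fun z : R * 'rV[R]_N => selfsim z.1 z.2).
Proof.
apply: (@measurable_fun_cvg _ _ _ setT (fun n (z : R * 'rV[R]_N) => W n.+1%:R z.1 z.2)).
  by move=> n; have [_ _ [+ _] _] := dilation_mild (n0 n).
by move=> z _; exact: cvg_selfsim.
Qed.

(** Dilating W k by l gives W (k l), which lies below the limit on the orthant; this is one
    inequality. The same inequality for the inverse dilation is the other one, and antisymmetry
    extends the equality. *)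
Lemma selfsim_self_similar : self_similar a selfsim.
Proof.
have le l t x : 0 < l -> 0 < t -> orthant m x -> dilation a l selfsim t x <= selfsim t x.
  move=> l0 t0 xm.
  have c1 : W (n.+1%:R * l) t x @[n --> \oo] --> dilation a l selfsim t x.
    rewrite /dilation.
    rewrite (_ : (fun n => _) = (fun n => l `^ (2 / a) * W n.+1%:R (l ^+ 2 * t) (l *: x))).
      by apply: cvgM; [exact: cvg_cst|exact: cvg_selfsim].
    apply/funext => n; rewrite /dilation powRM ?(ltW l0)// exprMn scalerA !mulrA.
    by congr (_ * _); exact: mulrC.
  apply: (ler_cvg_to c1 (cvg_cst _)); near=> n.
  by apply: dilation_le_selfsim => //; rewrite mulr_gt0.
have ad l t : 0 < l -> 0 < t -> antisymmetric_upto m (dilation a l selfsim t).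
  move=> l0 t0 i im x; rewrite /dilation -mulrN -(antisymmetric_selfsim _ im) ?mulr_gt0 ?exprn_gt0//.
  by congr (_ * selfsim _ _); apply/rowP => j; rewrite !mxE; case: ifP => _ //; rewrite mulrN.
move=> l l0 t x t0; move: x; apply/funeqP.
apply: (@antisymmetric_eq _ _ m) => [||y ym]; [exact: ad|exact: antisymmetric_selfsim|].
apply/eqP; rewrite eq_le le//=.
have li0 : 0 < l^-1 by rewrite invr_gt0.
have lt0 : 0 < l ^+ 2 * t by rewrite mulr_gt0 ?exprn_gt0.
have lym : orthant m (l *: y) by move=> i im; rewrite mxE mulr_gt0// ym.
have := le l^-1 (l ^+ 2 * t) (l *: y) li0 lt0 lym.
rewrite /dilation scalerA mulVf ?gt_eqF// scale1r mulrA -exprMn mulVf ?gt_eqF// expr1n mul1r.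
move=> /(ler_wpM2l (powR_ge0 l (2 / a))); apply: le_trans.
by rewrite mulrA -powRM ?(ltW l0) ?(ltW li0)// mulfV ?gt_eqF// powR1 mul1r.
Unshelve. all: by end_near. Qed.

(** From time tau on, all W k share the bound (a tau)^(-1/a), which allows dominated convergence in
    their mild formulas. *)
Lemma selfsim_restart tau : 0 < tau ->
  bounded_mild a ((a * tau) `^ (- a^-1)) (selfsim tau) (fun s => selfsim (tau + s)).
Proof.
move=> tau0; set M := (a * tau) `^ (- a^-1).
have le_M s : 0 < s -> (a * (tau + s)) `^ (- a^-1) <= M.
  move=> s0; apply: powRN_le; first exact: mulr_gt0.
  by rewrite ler_pM2l// lerDl ltW.
have M0 : 0 <= M by exact: powR_ge0.
have bW n : bounded_field M (fun s => W n.+1%:R (tau + s)).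
  have [_ _ bW _] := bounded_mild_restart a0 tau0 (dilation_mild (n0 n)).
  split; first by case: bW.
  by move=> s y s0; apply: le_trans (dilation_le y (n0 n) (addr_gt0 tau0 s0)) (le_M s s0).
have mW n : measurable_fun setT (W n.+1%:R tau).
  by have [+ _ _ _] := bounded_mild_restart a0 tau0 (dilation_mild (n0 n)).
split.
- exact: (measurableT_comp measurable_selfsim (pair1_measurable tau)).
- by move=> y; exact: normr_selfsim_le.
- split.
    apply: (measurableT_comp measurable_selfsim (measurable_fun_pair _ _)).
      by apply: measurable_funD; [exact: measurable_cst|exact: measurable_fst].
    exact: measurable_snd.
  by move=> s y s0; apply: le_trans (normr_selfsim_le y (addr_gt0 tau0 s0)) (le_M s s0).
move=> t x t0.
apply: (cvg_unique _ (@cvg_selfsim (tau + t) x)) => //.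
have eW : (fun n => W n.+1%:R (tau + t) x) = (fun n => heat_semigroup t (W n.+1%:R tau) x +
    duhamel 0 (fun s y => - f (W n.+1%:R (tau + s) y)) t x).
  apply/funext => n; have [_ _ _ +] := bounded_mild_restart a0 tau0 (dilation_mild (n0 n)).
  exact.
rewrite eW; apply: cvgD.
  apply: (@cvg_heat_semigroup R N M) => //; last by move=> y; exact: cvg_selfsim.
  by move=> n y; exact: dilation_le.
apply: (@cvg_duhamel R N (M `^ a * M)) => //; first exact: ltW.
  by move=> n; exact: (bounded_field_nonlinearity a0).
move=> s y s0; apply: cvgN.
apply: (@continuous_cvg _ _ _ _ _ (fun n => W n.+1%:R (tau + s) y) f); last exact: cvg_selfsim.
exact: continuous_nonlinearity.
Qed.

Lemma selfsim_ge x : orthant m x -> a `^ (- a^-1) * heat_semigroup 1 h x <= selfsim 1 x.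
Proof.
move=> xm.
have c1 : (n.+1%:R ^- 2 + a * 1) `^ (- a^-1) * heat_semigroup 1 h x @[n --> \oo] -->
    a `^ (- a^-1) * heat_semigroup 1 h x.
  apply: cvgM; last exact: cvg_cst.
  apply: (@continuous_cvg _ _ _ _ _ (fun n => n.+1%:R ^- 2 + a * 1) (fun r => r `^ (- a^-1))).
    apply/differentiable_continuous/derivable1_diffP.
    exact: (@ex_derive _ _ _ _ _ _ _ (is_derive1_powR (- a^-1) a0)).
  rewrite -[X in _ --> X]add0r; apply: cvgD; last by rewrite mulr1; exact: cvg_cst.
  have hc : harmonic n @[n --> \oo] --> (0 : R) := @cvg_harmonic R.
  have -> : (fun n => n.+1%:R ^- 2) = (fun n => harmonic n * harmonic n : R).
    by apply/funext => n; rewrite /harmonic /= expr2 invfM.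
  by rewrite -[X in _ --> X](mulr0 (0 : R)); exact: cvgM.
apply: (ler_cvg_to c1 (@cvg_selfsim 1 x)); near=> n; exact: dilation_ge.
Unshelve. all: by end_near. Qed.

(** V is restarted at time eps, where it lies below (a eps)^(-1/a) [h] on the orthant. The
    absorption term has a sign there and its Duhamel integral is compared with that of 0. *)
Lemma selfsim_le eps x : 0 < eps < 1 -> orthant m x ->
  selfsim 1 x <= (a * eps) `^ (- a^-1) * heat_semigroup (1 - eps) h x.
Proof.
move=> /andP[e0 e1] xm; have e10 : 0 < 1 - eps by rewrite subr_gt0.
have [mV VM bV VE] := selfsim_restart e0.
have := VE (1 - eps) x e10; rewrite addrC subrK => ->.
have M0 : 0 <= (a * eps) `^ (- a^-1) by exact: powR_ge0.
rewrite -(heat_semigroupZ _ e10 mh h1) -[leRHS]addr0; apply: lerD.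
  apply: (heat_semigroup_orthant_le (M := (a * eps) `^ (- a^-1)) e10 _ _ _ _ _ _ _ xm) => //.
  - by apply: measurable_funM => //; exact: measurable_cst.
  - by move=> y; rewrite normrM ger0_norm// ler_piMr.
  - exact: antisymmetric_selfsim.
  - exact: antisymmetricZ.
  by move=> y ym; rewrite hp// mulr1; apply: le_trans (ler_norm _) (VM y).
have bf := bounded_field_nonlinearity a0 bV.
have d0 : duhamel 0 (fun (_ : R) (_ : 'rV[R]_N) => 0) (1 - eps) x = 0.
  rewrite duhamelE (@eq_Rintegral_itv _ _ _ _ (cst 0)) => [|s /andP[s0 s1]].
    by rewrite Rintegral_itv_cst ?mul0r// ltW.
  by rewrite heat_semigroup_cst ?subr_gt0// mulr0.
rewrite -[leRHS]d0.
apply: (duhamel_orthant_le (M := ((a * eps) `^ (- a^-1)) `^ a * (a * eps) `^ (- a^-1)) _ _ _ _ _ _ xm) => //.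
- by split=> [|s y s0]; [exact: measurable_cst|rewrite normr0 mulr_ge0 ?powR_ge0].
- move=> s s0; apply: (@antisymmetric_odd _ _ _ (fun r => - f r)) => [r|]; first by rewrite nonlinearityN.
  by apply: antisymmetric_selfsim; exact: addr_gt0.
- by move=> s s0 i im y; rewrite oppr0.
move=> s y s0 st ym; rewrite oppr_le0 nonlinearity_ge0//.
by apply: selfsim_ge0 => //; exact: addr_gt0.
Qed.

End rescaling.

(** * Spatial regularity *)

Section integral_derivatives.
Context {R : realType}.
Notation lebm := (@lebesgue_measure R).

Lemma Rintegral_sum_ord d (T : measurableType d) (mu : {measure set T -> \bar R}) (D : set T)
    n (k : 'I_n -> T -> R) : measurable D ->
  (forall i, mu.-integrable D (EFin \o k i)) ->
  mu.-integrable D (EFin \o (fun y => \sum_i k i y)) /\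
  \int[mu]_(y in D) (\sum_i k i y) = \sum_i \int[mu]_(y in D) k i y.
Proof.
move=> mD ik.
have H (s : seq 'I_n) : mu.-integrable D (EFin \o (fun y => \sum_(i <- s) k i y)) /\
    \int[mu]_(y in D) (\sum_(i <- s) k i y) = \sum_(i <- s) \int[mu]_(y in D) k i y.
  elim: s => [|i s [IH1 IH2]].
    have e : (fun y => \sum_(i <- [::]) k i y) = cst 0 by apply/funext => y; rewrite big_nil.
    rewrite e big_nil Rintegral_cst ?mul0r//; split=> //; exact: integrable0.
  have e : (fun y => \sum_(j <- i :: s) k j y) = (fun y => k i y + \sum_(j <- s) k j y).
    by apply/funext => y; rewrite big_cons.
  rewrite e big_cons; split; first exact: integrable_add.
  by rewrite RintegralD// IH2.
exact: H.
Qed.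

Lemma is_derive_Rintegral d (T : measurableType d) (mu : {measure set T -> \bar R}) (D : set T)
    (k dk : R -> T -> R) (G : T -> R) : measurable D ->
  (forall r, -1 < r < 1 -> mu.-integrable D (EFin \o k r)) ->
  (forall (r : R) y, -1 < r < 1 -> D y -> is_derive r (1 : R) (k ^~ y : R -> R) (dk r y)) ->
  (forall y, 0 <= G y) -> mu.-integrable D (EFin \o G) ->
  (forall r y, -1 < r < 1 -> D y -> `|dk r y| <= G y) ->
  is_derive (0 : R) (1 : R) (fun r : R => \int[mu]_(y in D) k r y) (\int[mu]_(y in D) dk 0 y).
Proof.
move=> mD ik dkE G0 iG dkG; apply: is_deriveP.
have dE r y : -1 < r < 1 -> D y -> partial1of2 k r y = dk r y.
  move=> rI Dy; rewrite partial1of2E; have h := dkE r y rI Dy; exact: derive_val.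
have I0 : (`]-1, 1[%classic : set R) 0 by rewrite /= in_itv/= ltrN10 ltr01.
have -> : \int[mu]_(y in D) dk 0 y = \int[mu]_(y in D) partial1of2 k 0 y.
  by apply: eq_Rintegral => y /set_mem Dy; rewrite dE// ltrN10 ltr01.
have h := @cvg_differentiation_under_integral R d T mu k D mD 0 (-1) 1 I0.
have II (r : R) : (`]-1, 1[%classic : set R) r -> -1 < r < 1 by rewrite /= in_itv.
under eq_fun do rewrite /= scaler1.
apply: (h _ _ G) => //.
- by move=> r y rI Dy; exact: (@ex_derive _ _ _ _ _ _ _ (dkE r y (II r rI) Dy)).
by move=> r y rI Dy; rewrite dE ?dkG//; exact: II.
Qed.

(** Directional derivatives become derivatives in one real variable, where the chain rule, the mean
    value theorem and differentiation under the integral are at hand. *)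
Lemma is_derive_line (V : normedModType R) (f : V -> R) (x v : V) (r df : R) :
  is_derive r 1 (fun s : R => f (s *: v + x)) df <-> is_derive (r *: v + x) v f df.
Proof.
have e (h : R) : f ((h *: (1 : R) + r) *: v + x) = f (h *: v + (r *: v + x)).
  by rewrite scaler1 scalerDl addrA.
split=> - [d1 d2].
  apply: DeriveDef.
    by move: d1; rewrite /derivable; under eq_fun do rewrite /= e.
  by move: d2; rewrite /derive; under eq_fun do rewrite /= e.
apply: DeriveDef.
  by rewrite /derivable; under eq_fun do rewrite /= e.
by rewrite /derive; under eq_fun do rewrite /= e.
Qed.

Lemma eq_is_derive (V W : normedModType R) (f g : V -> W) x v df dg :
  f = g -> df = dg -> is_derive x v f df -> is_derive x v g dg.
Proof. by move=> -> ->. Qed.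

Lemma is_derive_unique (V : normedModType R) (f : V -> R) (x v : V) (d1 d2 : R) :
  is_derive x v f d1 -> is_derive x v f d2 -> d1 = d2.
Proof. by move=> [_ <-] [_ <-]. Qed.

Lemma directional_lipschitz (V : normedModType R) (f df : V -> R) v C :
  (forall x, is_derive x v f (df x)) -> (forall x, `|df x| <= C) ->
  forall x, `|f (v + x) - f x| <= C.
Proof.
move=> fd dC x; have d (r : R) : is_derive r (1 : R) (fun s : R => f (s *: v + x)) (df (r *: v + x)).
  by apply/is_derive_line.
have cf : {within `[0, 1], continuous (fun s : R => f (s *: v + x))}.
  apply: continuous_subspaceT => r; apply/differentiable_continuous/derivable1_diffP.
  exact: (@ex_derive _ _ _ _ _ _ _ (d r)).
have [c _] := @MVT R _ (fun r => df (r *: v + x)) 0 1 ltr01 (fun r _ => d r) cf.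
by rewrite scale1r scale0r add0r subr0 mulr1 => ->.
Qed.

(** The singularity at s = t is regularized by adding 1 / (n + 1) to t - s; the integrals are then
    explicit, bounded by (t + 1)^(1 - b) / (1 - b), and monotone convergence concludes. *)
Lemma integrable_powR_singular (b t : R) : 0 < b < 1 -> 0 <= t ->
  lebm.-integrable `]0, t[ (EFin \o (fun s => (t - s) `^ (- b))).
Proof.
move=> /andP[b0 b1] t0.
have b10 : 0 < 1 - b by rewrite subr_gt0.
pose g n s := (t - s + n.+1%:R^-1) `^ (- b).
have mg n : measurable_fun setT (g n).
  apply: (measurableT_comp (measurable_powR (- b))); apply: measurable_funD => //.
  exact: measurable_funB.
pose F n s := - ((1 - b)^-1 * (t - s + n.+1%:R^-1) `^ (1 - b)).
have n0 n : 0 < n.+1%:R^-1 :> R by rewrite invr_gt0 ltr0n.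
have FTC n : lebm.-integrable `]0, t[ (EFin \o g n) /\ \int[lebm]_(s in `]0, t[) g n s = F n t - F n 0.
  have dlin (c s : R) : is_derive s 1 (fun s => t - s + c) (-1).
    apply: (is_derive_eq (is_deriveD (is_deriveB (is_derive_cst t s 1) (is_derive_id s 1)) (is_derive_cst c s 1))).
    by rewrite sub0r addr0.
  apply: Rintegral_FTC => // s /andP[s0 st]; have p0 : 0 < t - s + n.+1%:R^-1.
  - by rewrite ltr_wpDl// subr_ge0.
  - have h := @is_derive1_comp R (@powR R ^~ (- b)) (fun s => t - s + n.+1%:R^-1) s _ _
      (is_derive1_powR (- b) p0) (dlin n.+1%:R^-1 s).
    apply/differentiable_continuous/derivable1_diffP.
    exact: (@ex_derive _ _ _ _ _ _ _ h).
  - by rewrite ltr_wpDl// subr_ge0.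
  have h := @is_derive1_comp R (@powR R ^~ (1 - b)) (fun s => t - s + n.+1%:R^-1) s _ _
      (is_derive1_powR (1 - b) p0) (dlin n.+1%:R^-1 s).
  have h2 := is_deriveN (is_deriveZ (1 - b)^-1 h).
  apply: (is_derive_eq h2); rewrite /GRing.scale/= /g.
  rewrite (_ : 1 - b - 1 = - b); last by ring.
  by field; rewrite gt_eqF.
pose K := (1 - b)^-1 * (t + 1) `^ (1 - b).
have intK n : (\int[lebm]_(s in `]0%R, t[) (g n s)%:E <= K%:E)%E.
  have [ig E] := FTC n; rewrite -[leLHS]fineK; last first.
    by apply: (@integrable_fin_num _ _ _ lebm `]0, t[) => //; exact: ig.
  rewrite lee_fin.
  apply: le_trans (_ : F n t - F n 0 <= _); first by rewrite -E.
  rewrite /F /K opprK addrC subrr add0r -mulrBr ler_wpM2l ?invr_ge0 ?(ltW b10)//.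
  rewrite subr0 lerBlDr -[leLHS]addr0 lerD ?powR_ge0//.
  apply: ge0_ler_powR; rewrite ?nnegrE ?(ltW b10)// ?addr_ge0 ?(ltW (n0 n))// lerD2l.
  by rewrite invf_le1 ?ltr0n// ler1n.
have gP s n : s < t -> 0 < t - s + n.+1%:R^-1 by move=> st; rewrite addr_gt0// subr_gt0.
have powRN_le (r s : R) : 0 < s -> s <= r -> r `^ (- b) <= s `^ (- b).
  move=> s0 sr; rewrite !powRN lef_pV2 ?posrE ?powR_gt0 ?(lt_le_trans s0)//.
  by apply: ge0_ler_powR; rewrite ?nnegrE ?(ltW b0) ?(ltW s0)// (le_trans (ltW s0)).
have cg s : s < t -> g n s @[n --> \oo] --> (t - s) `^ (- b).
  move=> st; have ts0 : 0 < t - s by rewrite subr_gt0.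
  apply: (@continuous_cvg _ _ _ _ _ (fun n => t - s + n.+1%:R^-1) (fun r => r `^ (- b))).
    apply/differentiable_continuous/derivable1_diffP.
    exact: (@ex_derive _ _ _ _ _ _ _ (is_derive1_powR (- b) ts0)).
  rewrite -[X in _ --> X]addr0; apply: cvgD; first exact: cvg_cst.
  exact: cvg_harmonic.
apply/integrableP; split.
  apply/measurable_EFinP; apply: measurable_funTS.
  apply: (measurableT_comp (measurable_powR (- b))); exact: measurable_funB.
have mc := @monotone_convergence _ _ R lebm `]0, t[%classic (measurable_itv _) (fun n s => (g n s)%:E).
have nd : forall s, `]0, t[%classic s ->
    {homo (fun n => (g n s)%:E) : n k / (n <= k)%N >-> (n <= k)%E}.
  move=> s; rewrite /= in_itv/= => /andP[s0 st] n k nk; rewrite lee_fin.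
  apply: powRN_le; first exact: gP.
  by rewrite lerD2l lef_pV2 ?posrE ?ltr0n// ler_nat ltnS.
have {mc} mc := mc _ _ nd.
apply: (@le_lt_trans _ _ (limn (fun n => \int[lebm]_(x in `]0%R, t[) (g n x)%:E)%E)).
  rewrite -mc.
  - rewrite le_eqVlt; apply/orP; left; apply/eqP; apply: eq_integral => s.
    rewrite inE /= in_itv/= => /andP[s0 st]; rewrite ger0_norm ?powR_ge0//.
    by apply/esym/cvg_lim => //; apply: cvg_EFin; [exact: nearW|exact: cg].
  - by move=> n; apply/measurable_EFinP; apply: measurable_funTS; exact: mg.
  - by move=> n s _; rewrite lee_fin powR_ge0.
apply: (@le_lt_trans _ _ K%:E); last by rewrite ltry.
apply: lime_le; last exact: nearW.
apply: ereal_nondecreasing_is_cvgn => n k nk; apply: ge0_le_integral => //=.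
- by move=> s _; rewrite lee_fin powR_ge0.
- by apply/measurable_EFinP; apply: measurable_funTS; exact: mg.
- by apply/measurable_EFinP; apply: measurable_funTS; exact: mg.
by move=> s sI; exact: nd.
Qed.

End integral_derivatives.

(** * Spatial derivatives of the heat semigroup *)

Section heat_kernel_derivative.
Context {R : realType} (N : nat).
Notation leb := (lebesgue_rV R N).
Implicit Types (f G : 'rV[R]_N -> R) (x y z v : 'rV[R]_N) (t s r M : R) (i j : 'I_N).

Definition heat_kernel_dx i t z : R := - (z ord0 i / (2 * t)) * heat_kernel t z.

Definition heat_dx i t f x : R := \int[leb]_y (heat_kernel_dx i t (x - y) * f y).

Definition norm1 v : R := \sum_i `|v ord0 i|.

Lemma norm1_ge0 v : 0 <= norm1 v.
Proof. by apply: sumr_ge0. Qed.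

Lemma is_derive_heat_kernel_line t v z (r : R) : 0 < t -> is_derive r (1 : R)
  (fun s : R => heat_kernel t (s *: v + z)) (\sum_i v ord0 i * heat_kernel_dx i t (r *: v + z)).
Proof.
move=> t0.
have d1 i : is_derive r (1 : R) (fun s : R => (s * v ord0 i + z ord0 i) * (s * v ord0 i + z ord0 i))
    (2 * v ord0 i * (r * v ord0 i + z ord0 i)).
  have h0 : is_derive r (1 : R) (fun s : R => s * v ord0 i + z ord0 i) (v ord0 i).
    have h := is_deriveD (is_deriveM (is_derive_id r (1 : R)) (is_derive_cst (v ord0 i) r (1 : R)))
      (is_derive_cst (z ord0 i) r (1 : R)).
    by apply: (is_derive_eq h); rewrite scaler0 add0r addr0 /GRing.scale/= mulr1.
  by apply: (is_derive_eq (is_deriveM h0 h0)); rewrite /GRing.scale/=; ring.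
have d2 := is_derive_sum d1.
have d3 := is_deriveZ (- (4 * t)^-1) d2.
have d4 := @is_derive1_comp R expR _ r _ _ (is_derive_expR _) d3.
have d5 := is_deriveZ ((4 * pi * t) `^ (- (N%:R / 2))) d4.
have e : (fun s : R => heat_kernel t (s *: v + z)) =
    (4 * pi * t) `^ (- (N%:R / 2)) \*: (expR \o (- (4 * t)^-1 \*:
     (\sum_(i < N) (fun s : R => (s * v ord0 i + z ord0 i) * (s * v ord0 i + z ord0 i))))).
  apply/funext => s; rewrite heat_kernelE /= /GRing.scale/= fct_sumE.
  congr (_ * expR _); rewrite mulNr mulrC -mulNr; congr (_ * _).
  by apply: eq_bigr => i _; rewrite !mxE expr2.
rewrite e; apply: (is_derive_eq d5).
rewrite /GRing.scale/= mulrA.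
have -> : (4 * pi * t) `^ (- (N%:R / 2)) * expR (- (4 * t)^-1 *
    (\sum_(i < N) (fun s : R => (s * v ord0 i + z ord0 i) * (s * v ord0 i + z ord0 i))) r) =
    heat_kernel t (r *: v + z) by exact/esym/(congr1 (@^~ r) e).
rewrite !mulr_sumr; apply: eq_bigr => i _; rewrite /heat_kernel_dx !mxE.
by field; rewrite gt_eqF.
Qed.

Lemma normr_heat_kernel_dx_le i t z : 0 < t ->
  `|heat_kernel_dx i t z| <= dimc N * t `^ (- 2^-1) * heat_kernel (2 * t) z.
Proof.
move=> t0; rewrite /heat_kernel_dx normrM normrN normr_heat_kernel normrM (normfV (2 * t)).
rewrite [`|2 * t|]ger0_norm ?mulr_ge0 ?(ltW t0)// mulrAC.
rewrite ler_pdivrMr ?mulr_gt0//; apply: le_trans (coord_heat_kernel_le _ _ t0) _.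
rewrite le_eqVlt; apply/orP; left; apply/eqP.
rewrite powRN powR12_sqrt ?ltW//.
rewrite -[X in _ = _ * (2 * X)](sqr_sqrtr (ltW t0)).
have : Num.sqrt t != 0 by rewrite gt_eqF// sqrtr_gt0.
by move=> h; field.
Qed.

(** A bound free of r: the derivative costs a passage from time t to 2t, and the shift by r v
    another one from 2t to 4t. *)
Lemma normr_heat_kernel_dv_le t v z r : 0 < t -> `|r| <= 1 ->
  `|\sum_i v ord0 i * heat_kernel_dx i t (r *: v + z)| <=
  norm1 v * (dimc N * t `^ (- 2^-1)) * (dimc N * expR (sqnorm v / (8 * t)) * heat_kernel (4 * t) z).
Proof.
move=> t0 r1; have t20 : 0 < 2 * t by rewrite mulr_gt0.
apply: le_trans (ler_norm_sum _ _ _) _.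
rewrite /norm1 -mulrA mulr_suml; apply: ler_sum => i _; rewrite normrM; apply: ler_wpM2l => //.
apply: le_trans (normr_heat_kernel_dx_le _ _ t0) _.
rewrite ler_wpM2l ?mulr_ge0 ?dimc_ge0 ?powR_ge0// addrC.
apply: le_trans (heat_kernel_shift _ _ t20) _.
have -> : 2 * (2 * t) = 4 * t by ring.
have -> : 4 * (2 * t) = 8 * t by ring.
rewrite ler_wpM2r ?heat_kernel_ge0// ler_wpM2l ?dimc_ge0// ler_expR.
rewrite ler_wpM2r ?invr_ge0 ?mulr_ge0 ?(ltW t0)//.
apply: ler_sum => j _; rewrite mxE exprMn ler_piMl ?sqr_ge0//.
by rewrite -(real_normK (num_real r)) expr_le1.
Qed.

Lemma measurable_heat_kernel_dx i : measurable_fun setT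
  (fun z : R * 'rV[R]_N => heat_kernel_dx i z.1 z.2).
Proof.
apply: measurable_funM; last exact: measurable_heat_kernel.
apply: measurable_funN; apply: measurable_funM.
  exact: (measurableT_comp (measurable_coord_rV i) measurable_snd).
apply: (measurableT_comp measurable_invr_fun).
by apply: measurable_funM; [exact: measurable_cst|exact: measurable_fst].
Qed.

Lemma measurable_heat_dx_param i d (T : measurableType d) (a : T -> R)
    (b : T -> 'rV[R]_N) (F : T -> 'rV[R]_N -> R) :
  measurable_fun setT a -> measurable_fun setT b ->
  measurable_fun setT (fun z : T * 'rV[R]_N => F z.1 z.2) ->
  measurable_fun setT (fun z : T => heat_dx i (a z) (F z) (b z)).
Proof.
move=> ma mb mF; apply: (@measurable_fun_Rintegral _ _ _ _ _ _
  (fun (z : T) (y : 'rV[R]_N) => heat_kernel_dx i (a z) (b z - y) * F z y)).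
apply: measurable_funM => //.
apply: (measurableT_comp (measurable_heat_kernel_dx i) (measurable_fun_pair _ _)).
  exact: (measurableT_comp ma measurable_fst).
apply: measurable_fun_rV => j; under eq_fun do rewrite !mxE.
apply: measurable_funB.
  exact: (measurableT_comp (measurable_coord_rV j) (measurableT_comp mb measurable_fst)).
exact: (measurableT_comp (measurable_coord_rV j) measurable_snd).
Qed.

Lemma measurable_heat_dx i t f : measurable_fun setT f -> measurable_fun setT (heat_dx i t f).
Proof.
move=> mf; apply: (@measurable_heat_dx_param i _ _ (fun=> t) id (fun=> f)) => //.
exact: (measurableT_comp mf measurable_snd).
Qed.

Section bounded_data.
Variables (f : 'rV[R]_N -> R) (M : R).
Hypotheses (mf : measurable_fun setT f) (fM : forall y, `|f y| <= M).

Let M0 : 0 <= M. Proof. exact: le_trans (normr_ge0 _) (fM 0). Qed.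

Let measurable_dx i t x : measurable_fun setT (fun y => heat_kernel_dx i t (x - y) * f y).
Proof.
apply: measurable_funM => //.
exact: (measurableT_comp (measurable_heat_kernel_dx i)
  (measurable_fun_pair (measurable_cst t) (measurable_rVB x))).
Qed.

Let normr_dx_le i t x y : 0 < t -> `|heat_kernel_dx i t (x - y) * f y| <=
  dimc N * t `^ (- 2^-1) * M * heat_kernel (2 * t) (x - y).
Proof.
move=> t0; rewrite normrM mulrAC; apply: ler_pM => //; exact: normr_heat_kernel_dx_le.
Qed.

Lemma integrable_heat_dx i t x : 0 < t ->
  leb.-integrable setT (EFin \o (fun y => heat_kernel_dx i t (x - y) * f y)).
Proof.
move=> t0; apply: (integrable_le _ _ (g := fun y => dimc N * t `^ (- 2^-1) * M * heat_kernel (2 * t) (x - y))) => //.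
  by apply: integrable_scale => //; apply: integrable_heat_kernelB; rewrite mulr_gt0.
by move=> y _; exact: normr_dx_le.
Qed.

Lemma normr_heat_dx_le i t x : 0 < t -> `|heat_dx i t f x| <= dimc N * t `^ (- 2^-1) * M.
Proof.
move=> t0; have t20 : 0 < 2 * t by rewrite mulr_gt0.
apply: (le_trans (normr_Rintegral_le (g := fun y => dimc N * t `^ (- 2^-1) * M * heat_kernel (2 * t) (x - y)) _ _ _ _)) => //.
- by apply: integrable_scale => //; exact: integrable_heat_kernelB.
- by move=> y _; exact: normr_dx_le.
rewrite RintegralZl//; last exact: integrable_heat_kernelB.
by rewrite Rintegral_heat_kernelB// mulr1.
Qed.

Lemma is_derive_heat_semigroup t x v : 0 < t ->
  is_derive x v (heat_semigroup t f) (\sum_i v ord0 i * heat_dx i t f x).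
Proof.
move=> t0; have t40 : 0 < 4 * t by rewrite mulr_gt0.
suff : is_derive ((0 : R) *: v + x) v (heat_semigroup t f) (\sum_i v ord0 i * heat_dx i t f x).
  by rewrite scale0r add0r.
apply/is_derive_line.
pose C := norm1 v * (dimc N * t `^ (- 2^-1)) * (dimc N * expR (sqnorm v / (8 * t))) * M.
have C0 : 0 <= C by rewrite /C !mulr_ge0 ?norm1_ge0 ?dimc_ge0 ?powR_ge0 ?expR_ge0.
have := @is_derive_Rintegral R _ _ leb setT
  (fun (r : R) y => heat_kernel t (r *: v + (x - y)) * f y)
  (fun r y => (\sum_i v ord0 i * heat_kernel_dx i t (r *: v + (x - y))) * f y)
  (fun y => C * heat_kernel (4 * t) (x - y)) measurableT.
set P := (X in (_ -> _ -> _ -> _ -> _ -> X) -> _); move=> H.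
have {H} : P.
  apply: H.
  - move=> r _; have := integrable_heat (r *: v + x) t0 mf fM.
    by congr (_.-integrable _ _); apply/funext => y /=; rewrite addrA.
  - move=> r y _ _.
    have h := is_deriveM (is_derive_heat_kernel_line v (x - y) r t0) (is_derive_cst (f y) r (1 : R)).
    by apply: (is_derive_eq h); rewrite scaler0 add0r /GRing.scale/= mulrC.
  - by move=> y; rewrite mulr_ge0// heat_kernel_ge0.
  - by apply: integrable_scale => //; exact: integrable_heat_kernelB.
  move=> r y /andP[r1 r2] _; rewrite normrM /C mulrAC; apply: ler_pM => //.
  rewrite -[leRHS]mulrA; apply: normr_heat_kernel_dv_le => //.
  by rewrite ler_norml !ltW.
rewrite /P => {P} h.
have e : (fun r : R => \int[leb]_y (heat_kernel t (r *: v + (x - y)) * f y)) =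
    (fun r : R => heat_semigroup t f (r *: v + x)).
  by apply/funext => r; rewrite heat_semigroupE; apply: eq_Rintegral => y _; rewrite addrA.
have [_ s2] := @Rintegral_sum_ord R _ _ leb setT N
  (fun i y => v ord0 i * (heat_kernel_dx i t (x - y) * f y)) measurableT
  (fun i => integrable_scale measurableT (v ord0 i) (integrable_heat_dx i x t0)).
have vE : \int[leb]_y ((\sum_i v ord0 i * heat_kernel_dx i t (0 *: v + (x - y))) * f y) =
    \sum_i v ord0 i * heat_dx i t f x.
  transitivity (\int[leb]_y (\sum_i v ord0 i * (heat_kernel_dx i t (x - y) * f y))).
    apply: eq_Rintegral => y _; rewrite scale0r add0r mulr_suml.
    by apply: eq_bigr => i _; rewrite mulrA.
  rewrite s2; apply: eq_bigr => i _.
  exact: (RintegralZl (v ord0 i) measurableT (integrable_heat_dx i x t0)).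
exact: (eq_is_derive e vE h).
Qed.

End bounded_data.

Lemma sum_basis (F : 'I_N -> R) i : \sum_j basis_rV R i ord0 j * F j = F i.
Proof.
rewrite (bigD1 i)//= mxE !eqxx mul1r big1 ?addr0// => j ji.
by rewrite mxE (negbTE ji) andbF mul0r.
Qed.

(** Here the derivative falls on the function instead of the kernel: with z = x - y as integration
    variable the kernel does not involve x, and no negative power of t appears. *)
Lemma heat_semigroup_derive G (Gv : 'rV[R]_N -> R) v M C t x : 0 < t -> measurable_fun setT G ->
  (forall y, `|G y| <= M) -> (forall y, is_derive y v G (Gv y)) ->
  measurable_fun setT Gv -> (forall y, `|Gv y| <= C) ->
  is_derive x v (heat_semigroup t G) (heat_semigroup t Gv x).
Proof.
move=> t0 mG GM dG mGv GC.
suff : is_derive ((0 : R) *: v + x) v (heat_semigroup t G) (heat_semigroup t Gv x).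
  by rewrite scale0r add0r.
apply/is_derive_line.
have C0 : 0 <= C := le_trans (normr_ge0 _) (GC 0).
have SE (H : 'rV[R]_N -> R) K w : measurable_fun setT H -> (forall y, `|H y| <= K) ->
    leb.-integrable setT (EFin \o (fun z => heat_kernel t z * H (w - z))) /\
    heat_semigroup t H w = \int[leb]_z (heat_kernel t z * H (w - z)).
  move=> mH HK; have iH := integrable_heat w t0 mH HK.
  have e : (fun y => heat_kernel t (w - y) * H y) =
      (fun y => (fun z => heat_kernel t z * H (w - z)) (w - y)).
    by apply/funext => y; rewrite subKr.
  have := integrable_rVB w iH.
  have e2 : (EFin \o (fun y => heat_kernel t (w - y) * H y)) \o (fun y => w - y) =
     EFin \o (fun z => heat_kernel t z * H (w - z)).
    by apply/funext => y /=; rewrite subKr.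
  move=> i2.
  have i3 : leb.-integrable setT (EFin \o (fun z => heat_kernel t z * H (w - z))).
    by move: i2; congr (_.-integrable _ _).
  split=> //; rewrite heat_semigroupE e; exact: Rintegral_rVB.
have := @is_derive_Rintegral R _ _ leb setT
  (fun (r : R) z => heat_kernel t z * G (r *: v + x - z))
  (fun r z => heat_kernel t z * Gv (r *: v + x - z))
  (fun z => C * heat_kernel t z) measurableT.
set P := (X in (_ -> _ -> _ -> _ -> _ -> X) -> _); move=> H.
have {H} : P.
  apply: H.
  - by move=> r _; have [] := SE G M (r *: v + x) mG GM.
  - move=> r z _ _.
    have hl : is_derive r (1 : R) (fun s : R => G (s *: v + (x - z))) (Gv (r *: v + (x - z))).
      exact/is_derive_line.
    have h := is_deriveZ (heat_kernel t z) hl.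
    have e : (fun s : R => heat_kernel t z * G (s *: v + x - z)) =
        heat_kernel t z \*: (fun s : R => G (s *: v + (x - z))).
      by apply/funext => s /=; rewrite addrA.
    by rewrite e; apply: (is_derive_eq h); rewrite /GRing.scale/= addrA.
  - by move=> z; rewrite mulr_ge0// heat_kernel_ge0.
  - by apply: integrable_scale => //; exact: integrable_heat_kernel.
  move=> r z _ _; rewrite normrM normr_heat_kernel mulrC.
  by apply: ler_wpM2r => //; exact: heat_kernel_ge0.
rewrite /P => {P} h.
have e : (fun r : R => \int[leb]_z (heat_kernel t z * G (r *: v + x - z))) =
    (fun r : R => heat_semigroup t G (r *: v + x)).
  by apply/funext => r; have [_ ->] := SE G M (r *: v + x) mG GM.
move: h; rewrite e => h; apply: (is_derive_eq h).
have [_ ->] := SE Gv C x mGv GC.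
by apply: eq_Rintegral => z _; rewrite scale0r add0r.
Qed.

(** Both sides are the same derivative of the flow at time t + s, computed on the kernel and on the
    function. *)
Lemma heat_dx_semigroup i t s f M x : 0 < t -> 0 < s -> measurable_fun setT f ->
  (forall y, `|f y| <= M) -> heat_dx i (t + s) f x = heat_semigroup t (heat_dx i s f) x.
Proof.
move=> t0 s0 mf fM.
have d1 := is_derive_heat_semigroup mf fM x (basis_rV R i) (addr_gt0 t0 s0).
have d y := is_derive_heat_semigroup mf fM y (basis_rV R i) s0.
rewrite sum_basis in d1.
have d2 := @heat_semigroup_derive _ (heat_dx i s f) (basis_rV R i) M _ t x t0
  (measurable_heat_semigroup s mf) (normr_heat_semigroup_le s0 mf fM) _
  (measurable_heat_dx i s mf) (fun y => normr_heat_dx_le mf fM i y s0).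
apply: (is_derive_unique d1).
have e : heat_semigroup (t + s) f = heat_semigroup t (heat_semigroup s f).
  by apply/funext => y; rewrite (heat_semigroup_add t0 s0 mf fM).
by rewrite e; apply: d2 => y; have := d y; rewrite sum_basis.
Qed.

End heat_kernel_derivative.

Section uniform_convergence.
Context {R : realType}.

Lemma uniform_cvgP (U : choiceType) (A : set U) (T : Type) (F : set_system T) (FF : Filter F)
    (u : T -> U -> R) (f : U -> R) :
  {uniform A, u i @[i --> F] --> f} <->
  forall e : R, 0 < e -> \forall i \near F, forall x, A x -> `|f x - u i x| < e.
Proof.
split=> [uf e e0|uf].
  apply: (uf [set g : U -> R | forall x, A x -> `|f x - g x| < e]); apply/uniform_nbhs.
  exists [set xy | ball xy.1 e xy.2]; split=> //.
  exact: (@entourage_ball R R (PosNum e0)).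
move=> P /uniform_nbhs[E [+ EP]].
rewrite -entourage_ballE => -[e /= e0 eE].
have := uf e e0; apply: filterS => i hi; apply: EP => x Ax; apply: eE; exact: hi.
Qed.

Lemma unif_modulus_continuous (V : normedModType R) (f : V -> R) (w : R -> R) :
  (forall x v, `|f (v + x) - f x| <= w `|v|) ->
  (forall e : R, 0 < e -> exists2 d : R, 0 < d & forall r, 0 <= r -> r < d -> w r < e) ->
  unif_continuous f.
Proof.
move=> fw w0 E; rewrite -entourage_ballE => -[e /= e0 eE].
have [d d0 wd] := w0 e e0.
rewrite -entourage_ballE; exists d => //= -[x y] /= xy; apply: eE => /=.
rewrite /ball/= distrC -{1}(subrK x y); apply: le_lt_trans (fw x (y - x)) _.
apply: wd; first exact: normr_ge0.
by rewrite distrC; move: xy; rewrite -ball_normE.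
Qed.

Lemma modulus_continuous (V : normedModType R) (f : V -> R) (w : R -> R) :
  (forall x v, `|f (v + x) - f x| <= w `|v|) ->
  (forall e : R, 0 < e -> exists2 d : R, 0 < d & forall r, 0 <= r -> r < d -> w r < e) ->
  continuous f.
Proof.
move=> fw w0 x; apply/cvgrPdist_lt => e e0; have [d d0 wd] := w0 e e0; near=> y.
rewrite distrC -{1}(subrK x y); apply: le_lt_trans (fw x (y - x)) _.
apply: wd; first exact: normr_ge0.
by rewrite distrC; near: y; apply: cvgr_dist_lt.
Unshelve. all: by end_near. Qed.

Lemma unif_continuous_continuous (V : normedModType R) (f : V -> R) :
  unif_continuous f -> continuous f.
Proof.
move=> uf x; apply/cvgrPdist_lt => e e0.
have := uf _ (@entourage_ball R R (PosNum e0)); rewrite -entourage_ballE => -[d /= d0 dE].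
by apply: filterS (nbhsx_ballx x d d0) => y xy; exact: (dE (x, y)).
Qed.

Lemma linear_modulus (c : R) (e : R) : 0 < e ->
  exists2 d : R, 0 < d & forall r, 0 <= r -> r < d -> c * r < e.
Proof.
move=> e0; exists (e / (`|c| + 1)) => [|r r0]; first by rewrite divr_gt0// ltr_wpDl.
rewrite ltr_pdivlMr ?ltr_wpDl// => re; apply: le_lt_trans re.
by rewrite mulrC; apply: ler_wpM2l => //; apply: le_trans (ler_norm _) _; rewrite lerDl.
Qed.

Lemma sqrt_modulus (c : R) (e : R) : 0 < e ->
  exists2 d : R, 0 < d & forall r, 0 <= r -> r < d -> c * Num.sqrt r < e.
Proof.
move=> e0; have [d d0 dE] := linear_modulus c e0; exists (d ^+ 2) => [|r r0 rd].
  by rewrite exprn_gt0.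
apply: dE; first exact: sqrtr_ge0.
by rewrite -[ltRHS]ger0_norm ?ltW// -sqrtr_sqr ltr_sqrt// exprn_gt0.
Qed.

End uniform_convergence.

(** * Spatial derivatives of Duhamel integrals *)

Section duhamel_derivative.
Context {R : realType} (N : nat).
Notation mu := (@lebesgue_measure R).
Implicit Types (f : 'rV[R]_N -> R) (F G : R -> 'rV[R]_N -> R) (x y z v : 'rV[R]_N)
  (t s r M : R) (i j : 'I_N).

Lemma duhamel0E F t x :
  duhamel 0 F t x = \int[mu]_(s in `]0, t[) heat_semigroup (t - s) (F s) x.
Proof.
by rewrite duhamelE; apply: eq_Rintegral_itv => s _; rewrite mul0r oppr0 expR0 mul1r.
Qed.

Lemma integrable_duhamel0 M F t x : bounded_field M F ->
  mu.-integrable `]0, t[ (EFin \o (fun s => heat_semigroup (t - s) (F s) x)).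
Proof.
move=> FM; have := integrable_duhamel FM (lexx 0) t x.
by congr (_.-integrable _ _); apply/funext => s /=; rewrite mul0r oppr0 expR0 mul1r.
Qed.

Lemma norm1_le v : norm1 v <= N%:R * `|v|.
Proof.
apply: (@le_trans _ _ (\sum_(i < N) `|v|)); first by apply: ler_sum => i _; exact: le_coord_norm.
by rewrite sumr_const card_ord mulr_natl.
Qed.

Lemma normr_dirsum_le v (P : 'I_N -> R) C : (forall i, `|P i| <= C) ->
  `|\sum_i v ord0 i * P i| <= norm1 v * C.
Proof.
move=> PC; apply: le_trans (ler_norm_sum _ _ _) _; rewrite /norm1 mulr_suml.
by apply: ler_sum => i _; rewrite normrM ler_wpM2l.
Qed.

Definition duhamel_dx i F t x := \int[mu]_(s in `]0, t[) heat_dx i (t - s) (F s) x.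

Definition sing_int (b t : R) := \int[mu]_(s in `]0, t[) (t - s) `^ (- b).

Let half01 : 0 < (2^-1 : R) < 1.
Proof. by apply/andP; split; lra. Qed.

Lemma measurable_duhamel_dx_integrand M i F t x : bounded_field M F ->
  measurable_fun setT (fun s => heat_dx i (t - s) (F s) x).
Proof.
move=> [mF _]; apply: (@measurable_heat_dx_param R N i _ _ (fun s => t - s) (fun=> x) F) => //.
exact: measurable_funB.
Qed.

Lemma normr_duhamel_dx_integrand_le M i F t s x : bounded_field M F -> 0 < s -> s < t ->
  `|heat_dx i (t - s) (F s) x| <= dimc N * M * (t - s) `^ (- 2^-1).
Proof.
move=> FM s0 st; rewrite mulrAC; have ts0 : 0 < t - s by rewrite subr_gt0.
exact: (normr_heat_dx_le (bounded_field_measurable s FM) (fun y => FM.2 s y s0) i x ts0).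
Qed.

Lemma integrable_duhamel_dx M i F t x : 0 <= t -> bounded_field M F ->
  mu.-integrable `]0, t[ (EFin \o (fun s => heat_dx i (t - s) (F s) x)).
Proof.
move=> t0 FM.
have mI : measurable (`]0, t[%classic : set R) by [].
apply: (@integrable_le _ _ R mu _ mI _ (fun s : R => dimc N * M * (t - s) `^ (- 2^-1))).
- by apply: measurable_funTS; exact: measurable_duhamel_dx_integrand FM.
- apply: integrable_scale => //; exact: integrable_powR_singular.
by move=> s; rewrite /= in_itv/= => /andP[s0 st]; exact: normr_duhamel_dx_integrand_le.
Qed.

Lemma normr_duhamel_dx_le M i F t x : 0 <= t -> bounded_field M F ->
  `|duhamel_dx i F t x| <= dimc N * M * sing_int 2^-1 t.
Proof.
move=> t0 FM.
have iP := @integrable_powR_singular R 2^-1 t half01 t0.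
have mI : measurable (`]0, t[%classic : set R) by [].
apply: (le_trans (@normr_Rintegral_le _ _ R mu _ mI _ (fun s : R => dimc N * M * (t - s) `^ (- 2^-1)) _ _ _)).
- by apply: measurable_funTS; exact: measurable_duhamel_dx_integrand FM.
- exact: integrable_scale.
- by move=> s; rewrite /= in_itv/= => /andP[s0 st]; exact: normr_duhamel_dx_integrand_le.
by rewrite (RintegralZl _ _ iP).
Qed.

(** One derivative on the kernel costs (t - s)^(-1/2), which is integrable up to s = t and serves as
    dominating function. *)
Lemma is_derive_duhamel M F t x v : 0 <= t -> bounded_field M F ->
  is_derive x v (duhamel 0 F t) (\sum_i v ord0 i * duhamel_dx i F t x).
Proof.
move=> t0 FM.
suff : is_derive ((0 : R) *: v + x) v (duhamel 0 F t) (\sum_i v ord0 i * duhamel_dx i F t x).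
  by rewrite scale0r add0r.
apply/is_derive_line.
have M0 := bounded_field_ge0 FM.
have mI : measurable (`]0, t[%classic : set R) by [].
have iP := @integrable_powR_singular R 2^-1 t half01 t0.
have H := @is_derive_Rintegral R _ _ mu `]0, t[%classic
  (fun (r : R) s => heat_semigroup (t - s) (F s) (r *: v + x))
  (fun (r : R) s => \sum_i v ord0 i * heat_dx i (t - s) (F s) (r *: v + x))
  (fun s => norm1 v * (dimc N * M) * (t - s) `^ (- 2^-1)) mI.
have {}H := H (fun r _ => integrable_duhamel0 t (r *: v + x) FM).
move: H; set P := (X in (_ -> _ -> _ -> _ -> X) -> _) => H.
have {H} : P.
apply: H.
- move=> r s _; rewrite /= in_itv/= => /andP[s0 st].
  apply/is_derive_line; apply: (is_derive_heat_semigroup (M := M)).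
  + exact: bounded_field_measurable FM.
  + by move=> y; exact: FM.2.
  by rewrite subr_gt0.
- by move=> s; rewrite mulr_ge0 ?powR_ge0// mulr_ge0 ?norm1_ge0// mulr_ge0 ?dimc_ge0.
- exact: integrable_scale.
- move=> r s _; rewrite /= in_itv/= => /andP[s0 st]; rewrite -mulrA.
  by apply: normr_dirsum_le => i; exact: normr_duhamel_dx_integrand_le.
rewrite /P => {P} h; apply: eq_is_derive h; first by apply/funext => r; rewrite duhamel0E.
have iS i : mu.-integrable `]0, t[ (EFin \o (fun s => v ord0 i * heat_dx i (t - s) (F s) x)).
  by apply: integrable_scale => //; exact: integrable_duhamel_dx FM.
have [_ s2] := @Rintegral_sum_ord R _ _ mu `]0, t[%classic N _ mI iS.
rewrite scale0r add0r s2; apply: eq_bigr => i _.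
by rewrite (RintegralZl _ _ (integrable_duhamel_dx i x t0 FM)).
Qed.

Lemma duhamel_derive M C F G t x v : 0 <= t -> bounded_field M F -> bounded_field C G ->
  (forall s y, 0 < s -> is_derive y v (F s) (G s y)) ->
  is_derive x v (duhamel 0 F t) (duhamel 0 G t x).
Proof.
move=> t0 FM GC dFG.
suff : is_derive ((0 : R) *: v + x) v (duhamel 0 F t) (duhamel 0 G t x).
  by rewrite scale0r add0r.
apply/is_derive_line.
have C0 := bounded_field_ge0 GC.
have mI : measurable (`]0, t[%classic : set R) by [].
have H := @is_derive_Rintegral R _ _ mu `]0, t[%classic
  (fun (r : R) s => heat_semigroup (t - s) (F s) (r *: v + x))
  (fun (r : R) s => heat_semigroup (t - s) (G s) (r *: v + x))
  (fun s => C) mI.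
have {}H := H (fun r _ => integrable_duhamel0 t (r *: v + x) FM).
move: H; set P := (X in (_ -> _ -> _ -> _ -> X) -> _) => H.
have {H} : P.
apply: H.
- move=> r s _; rewrite /= in_itv/= => /andP[s0 st].
  apply/is_derive_line; apply: (heat_semigroup_derive (M := M) (C := C)).
  + by rewrite subr_gt0.
  + exact: bounded_field_measurable FM.
  + by move=> y; exact: FM.2.
  + by move=> y; exact: dFG.
  + exact: bounded_field_measurable GC.
  by move=> y; exact: GC.2.
- by [].
- apply: (@integrable_itv_bounded _ _ _ _ C) => //.
  by move=> s _; rewrite ger0_norm.
- move=> r s _; rewrite /= in_itv/= => /andP[s0 st]; exact: (normr_heat_field_le GC).
rewrite /P => {P} h; apply: eq_is_derive h; first by apply/funext => r; rewrite duhamel0E.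
by rewrite scale0r add0r duhamel0E.
Qed.

(** Each half of the time t pays for one derivative, so two of them cost a multiple of t^(-1). *)
Lemma heat_dx_lipschitz i t f M x v : 0 < t -> measurable_fun setT f ->
  (forall y, `|f y| <= M) ->
  `|heat_dx i t f (v + x) - heat_dx i t f x| <= norm1 v * (dimc N * dimc N * 2 * M * t^-1).
Proof.
move=> t0 mf fM; have t20 : 0 < t / 2 by rewrite divr_gt0.
have e y : heat_dx i t f y = heat_semigroup (t / 2) (heat_dx i (t / 2) f) y.
  by rewrite -(heat_dx_semigroup i y t20 t20 mf fM) -splitr.
have mg := measurable_heat_dx i (t / 2) mf.
have gM y := normr_heat_dx_le mf fM i y t20.
rewrite !e; apply: (@directional_lipschitz R 'rV[R]_N (heat_semigroup (t / 2) (heat_dx i (t / 2) f))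
  (fun y => \sum_j v ord0 j * heat_dx j (t / 2) (heat_dx i (t / 2) f) y)).
  by move=> y; exact: (is_derive_heat_semigroup mg gM).
move=> y; apply: normr_dirsum_le => j; apply: le_trans (normr_heat_dx_le mg gM j y t20) _.
have -> : dimc N * (t / 2) `^ (- 2^-1) * (dimc N * (t / 2) `^ (- 2^-1) * M) =
    dimc N * dimc N * M * ((t / 2) `^ (- 2^-1) * (t / 2) `^ (- 2^-1)) by ring.
rewrite -powRD ?(gt_eqF t20) ?implybT//.
have -> : - 2^-1 - 2^-1 = -1 :> R by lra.
rewrite powRN powRr1 ?(ltW t20)// invf_div.
by rewrite le_eqVlt; apply/orP; left; apply/eqP; ring.
Qed.

(** Product of the trivial bound, of weight t^(-1/2), and of the Lipschitz bound, of weight t^(-1),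
    followed by a square root: exponent 1/2 in v and the integrable weight t^(-3/4). The factor
    [dimc N + 1] stands for the square root of [dimc N]. *)
Lemma heat_dx_holder i t f M x v : 0 < t -> measurable_fun setT f ->
  (forall y, `|f y| <= M) ->
  `|heat_dx i t f (v + x) - heat_dx i t f x| <=
  2 * dimc N * (dimc N + 1) * M * Num.sqrt (norm1 v) * t `^ (- (3 / 4)).
Proof.
move=> t0 mf fM; set X := `|_|.
have M0 : 0 <= M := le_trans (normr_ge0 _) (fM 0).
have D0 : 0 <= dimc N :> R := dimc_ge0 N.
have b1 : X <= 2 * (dimc N * t `^ (- 2^-1) * M).
  rewrite mulr2n mulrDl mul1r; apply: le_trans (ler_normB _ _) _.
  by apply: lerD; exact: (normr_heat_dx_le mf fM).
have b2 : X <= norm1 v * (dimc N * dimc N * 2 * M * t^-1) by exact: heat_dx_lipschitz.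
have X0 : 0 <= X by exact: normr_ge0.
set n := Num.sqrt _; have n0 : 0 <= n by exact: sqrtr_ge0.
set A := t `^ _; have A0 : 0 <= A by exact: powR_ge0.
have n2 : norm1 v = n * n by rewrite -expr2 sqr_sqrtr ?norm1_ge0.
have A2 : t `^ (- 2^-1) * t^-1 = A * A.
  rewrite -{2}(powRr1 (ltW t0)) -powRN -!powRD ?(gt_eqF t0) ?implybT//.
  by congr (_ `^ _); lra.
set Z := _ * A; have Z0 : 0 <= Z by rewrite /Z !mulr_ge0// addr_ge0.
rewrite -ler_sqr ?nnegrE// !expr2; apply: le_trans (ler_pM X0 X0 b1 b2) _.
have -> : 2 * (dimc N * t `^ (- 2^-1) * M) * (norm1 v * (dimc N * dimc N * 2 * M * t^-1)) =
    4 * (M * M) * (n * n) * (dimc N * dimc N) * (t `^ (- 2^-1) * t^-1) * dimc N.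
  by rewrite n2; ring.
have -> : Z * Z = 4 * (M * M) * (n * n) * (dimc N * dimc N) * (A * A) * ((dimc N + 1) * (dimc N + 1)).
  by rewrite /Z; ring.
rewrite A2; apply: ler_wpM2l; first by rewrite !mulr_ge0.
by nra.
Qed.

Lemma duhamel_dx_holder i M F t x v : 0 <= t -> bounded_field M F ->
  `|duhamel_dx i F t (v + x) - duhamel_dx i F t x| <=
  2 * dimc N * (dimc N + 1) * M * sing_int (3 / 4) t * Num.sqrt (norm1 v).
Proof.
move=> t0 FM.
have b01 : 0 < (3 / 4 : R) < 1 by apply/andP; split; lra.
have iP := @integrable_powR_singular R (3 / 4) t b01 t0.
have mI : measurable (`]0, t[%classic : set R) by [].
rewrite /duhamel_dx -RintegralB//; [|exact: integrable_duhamel_dx FM|exact: integrable_duhamel_dx FM].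
pose c := 2 * dimc N * (dimc N + 1) * M * Num.sqrt (norm1 v).
apply: (le_trans (@normr_Rintegral_le _ _ R mu _ mI _ (fun s : R => c * (t - s) `^ (- (3 / 4))) _ _ _)).
- apply: measurable_funTS; apply: measurable_funB; exact: measurable_duhamel_dx_integrand FM.
- exact: integrable_scale.
- move=> s; rewrite /= in_itv/= => /andP[s0 st].
  apply: heat_dx_holder; [by rewrite subr_gt0|exact: bounded_field_measurable FM|].
  by move=> y; exact: FM.2.
by rewrite (RintegralZl _ _ iP)// /c mulrAC.
Qed.

End duhamel_derivative.

(** * Gaussian moments and the short-time behaviour of the heat semigroup *)

Section heat_asymptotics.
Context {R : realType} (N : nat).
Notation leb := (lebesgue_rV R N).
Implicit Types (f g : 'rV[R]_N -> R) (x y z v : 'rV[R]_N) (t s r l M C : R) (i j : 'I_N).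

Lemma integrable_heat_shift t f M x : 0 < t -> measurable_fun setT f -> (forall y, `|f y| <= M) ->
  leb.-integrable setT (EFin \o (fun z => heat_kernel t z * f (x - z))).
Proof.
move=> t0 mf fM; have := integrable_rVB x (integrable_heat x t0 mf fM).
by congr (_.-integrable _ _); apply/funext => y /=; rewrite subKr.
Qed.

Lemma heat_semigroup_shiftE t f M x : 0 < t -> measurable_fun setT f -> (forall y, `|f y| <= M) ->
  heat_semigroup t f x = \int[leb]_z (heat_kernel t z * f (x - z)).
Proof.
move=> t0 mf fM; rewrite heat_semigroupE.
rewrite -(Rintegral_rVB x (integrable_heat_shift x t0 mf fM)).
by apply: eq_Rintegral => z _; rewrite subKr.
Qed.

Lemma measurable_comp_scale f l x : measurable_fun setT f ->
  measurable_fun setT (fun z => f (x - l *: z)).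
Proof.
move=> mf; apply: (measurableT_comp mf); apply: measurable_fun_rV => i.
under eq_fun do rewrite !mxE.
apply: measurable_funB; first exact: measurable_cst.
by apply: measurable_funM; [exact: measurable_cst|exact: measurable_coord_rV].
Qed.

(** The kernel is kept at time 1 and the small time moves into the argument of f, which is the form
    needed for dominated convergence as l tends to 0. *)
Lemma heat_semigroup_unitE l f M x : 0 < l -> measurable_fun setT f -> (forall y, `|f y| <= M) ->
  heat_semigroup (l ^+ 2) f x = \int[leb]_z (heat_kernel 1 z * f (x - l *: z)).
Proof.
move=> l0 mf fM; have l1 : l != 0 by rewrite gt_eqF.
have := heat_semigroup_scale ltr01 l0 mf fM (l^-1 *: x).
rewrite mulr1 scalerA mulfV// scale1r => ->.
have ms : measurable_fun setT (fun y => f (l *: y)).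
  have := measurable_comp_scale (- l) 0 mf; congr (measurable_fun _ _).
  by apply/funext => z; rewrite scaleNr opprK add0r.
rewrite (heat_semigroup_shiftE _ ltr01 ms (fun y => fM (l *: y))).
by apply: eq_Rintegral => z _; rewrite scalerBr scalerA mulfV// scale1r.
Qed.

Let measurable_kernel1 : measurable_fun setT (fun z : 'rV[R]_N => heat_kernel 1 z).
Proof.
by apply: (@measurable_heat_kernel_comp R N _ _ (cst 1) (fun z => z)).
Qed.

Lemma integrable_coord i : leb.-integrable setT (EFin \o (fun z => heat_kernel 1 z * z ord0 i)).
Proof.
apply: (@integrable_le _ _ R leb setT measurableT _
  (fun z => dimc N * 2 * Num.sqrt 1 * heat_kernel (2 * 1) z)).
- by apply: measurable_funM; [exact: measurable_kernel1|exact: measurable_coord_rV].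
- by apply: integrable_scale => //; apply: integrable_heat_kernel; rewrite mulr1.
by move=> z _; rewrite normrM normr_heat_kernel mulrC; exact: coord_heat_kernel_le.
Qed.

Lemma integrable_sqnorm : leb.-integrable setT (EFin \o (fun z => heat_kernel 1 z * sqnorm z)).
Proof.
apply: (@integrable_le _ _ R leb setT measurableT _
  (fun z => 8 * 1 * dimc N * heat_kernel (2 * 1) z)).
- by apply: measurable_funM; [exact: measurable_kernel1|exact: measurable_sqnorm].
- by apply: integrable_scale => //; apply: integrable_heat_kernel; rewrite mulr1.
move=> z _; rewrite normrM normr_heat_kernel mulrC ger0_norm ?sqnorm_ge0//.
exact: sqnorm_heat_kernel_le.
Qed.

Lemma normr_coordM_le z i j : `|z ord0 i * z ord0 j| <= sqnorm z.
Proof.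
rewrite normrM; have := sqr_coord_le z i; have := sqr_coord_le z j.
rewrite -(real_normK (num_real (z ord0 i))) -(real_normK (num_real (z ord0 j))).
have := normr_ge0 (z ord0 i); have := normr_ge0 (z ord0 j).
move: `|_| `|_| (sqnorm z) => p q S p0 q0 h1 h2.
have : 0 <= (p - q) ^+ 2 by exact: sqr_ge0.
move: h1 h2; rewrite !expr2; nra.
Qed.

Lemma integrable_coordM i j :
  leb.-integrable setT (EFin \o (fun z => heat_kernel 1 z * (z ord0 i * z ord0 j))).
Proof.
apply: (@integrable_le _ _ R leb setT measurableT _ (fun z => heat_kernel 1 z * sqnorm z)).
- apply: measurable_funM; first exact: measurable_kernel1.
  by apply: measurable_funM; exact: measurable_coord_rV.
- exact: integrable_sqnorm.
by move=> z _; rewrite normrM normr_heat_kernel ler_wpM2l ?heat_kernel_ge0// normr_coordM_le.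
Qed.

Let odd_integral i f : leb.-integrable setT (EFin \o f) ->
  (forall z, f (reflection i z) = - f z) -> \int[leb]_z f z = 0.
Proof.
move=> iF fN; have := Rintegral_reflection i iF.
have -> : \int[leb]_y f (reflection i y) = - \int[leb]_y f y.
  rewrite -mulN1r -RintegralZl//; apply: eq_Rintegral => z _; rewrite fN mulN1r.
  by [].
by move=> h; lra.
Qed.

Lemma Rintegral_coord i : \int[leb]_z (heat_kernel 1 z * z ord0 i) = 0.
Proof.
apply: (@odd_integral i); first exact: integrable_coord.
by move=> z; rewrite heat_kernel_reflection mxE eqxx mulrN.
Qed.

Lemma Rintegral_coordM i j : i != j ->
  \int[leb]_z (heat_kernel 1 z * (z ord0 i * z ord0 j)) = 0.
Proof.
move=> ij; apply: (@odd_integral i); first exact: integrable_coordM.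
by move=> z; rewrite heat_kernel_reflection !mxE eqxx eq_sym (negbTE ij) mulNr mulrN.
Qed.

(* Stretching the i-th coordinate by s and 1 - r <= exp (- r) give
   1 / s >= 1 - (s^2 - 1) sigma / 4 for every s > 0, with equality at s = 1. *)
Lemma Rintegral_coord_sqr i : \int[leb]_z (heat_kernel 1 z * (z ord0 i * z ord0 i)) = 2.
Proof.
set sigma := \int[leb]_z _.
have key s : 0 < s -> s * (1 - (s ^+ 2 - 1) / 4 * sigma) <= 1.
  move=> s0; pose b (j : 'I_N) := if j == i then s else 1.
  have b0 j : b j != 0 by rewrite /b; case: ifP => _; rewrite ?oner_eq0 ?gt_eqF.
  have bp : \prod_j `|b j| = s.
    rewrite (bigD1 i)//= /b eqxx big1 => [|j /negbTE ->]; last by rewrite normr1.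
    by rewrite mulr1 ger0_norm ?ltW.
  have iK := @integrable_heat_kernel R N 1 ltr01.
  have KE z : heat_kernel 1 (\row_j (b j * z ord0 j + 0)) =
      heat_kernel 1 z * expR (- ((s ^+ 2 - 1) / 4 * (z ord0 i * z ord0 i))).
    rewrite !heat_kernelE -[RHS]mulrA -expRD; congr (_ * expR _).
    rewrite /sqnorm (bigD1 i)//= [in RHS](bigD1 i)//= !mxE /b eqxx addr0.
    rewrite (eq_bigr (fun j => z ord0 j ^+ 2)); first by field.
    by move=> j /negbTE ji; rewrite !mxE ji mul1r addr0.
  have iKb := @integrable_rV_affine R N b (fun=> 0) _ b0 iK.
  have := @Rintegral_rV_affine R N b (fun=> 0) s _ b0 bp iK.
  rewrite Rintegral_heat_kernel// => E; rewrite [leRHS]E ler_pM2l//.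
  have -> : 1 - (s ^+ 2 - 1) / 4 * sigma =
      \int[leb]_z (heat_kernel 1 z + - ((s ^+ 2 - 1) / 4) * (heat_kernel 1 z * (z ord0 i * z ord0 i))).
    rewrite RintegralD//; last by apply: integrable_scale => //; exact: integrable_coordM.
    by rewrite Rintegral_heat_kernel// (RintegralZl _ _ (integrable_coordM i i))// mulNr.
  apply: le_Rintegral => //.
    by apply: integrable_add => //; apply: integrable_scale => //; exact: integrable_coordM.
  move=> z _; rewrite KE; have := expR_ge1Dx (- ((s ^+ 2 - 1) / 4 * (z ord0 i * z ord0 i))).
  move=> /(ler_wpM2l (heat_kernel_ge0 1 z)); apply: le_trans.
  by rewrite le_eqVlt; apply/orP; left; apply/eqP; ring.
have sigma0 : 0 <= sigma.
  by apply: Rintegral_ge0 => z _; rewrite mulr_ge0 ?heat_kernel_ge0// -expr2 sqr_ge0.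
apply/eqP; rewrite eq_le; apply/andP; split.
  (* At s = 1 - d the gain d (sigma - 2) / 2 must beat the quadratic loss 3 d^2 sigma / 4; this d
     makes the loss half of the gain. *)
  rewrite leNgt; apply/negP => s2; pose d := (sigma - 2) / (3 * sigma).
  have sg0 : 0 < sigma by rewrite (lt_trans _ s2).
  have d0 : 0 < d by rewrite divr_gt0 ?mulr_gt0// subr_gt0.
  have dE : 3 * sigma * d = sigma - 2 by rewrite /d; field; rewrite gt_eqF.
  have d1 : d < 1 / 3 by rewrite ltr_pdivrMr ?mulr_gt0//; lra.
  have := key (1 - d); rewrite subr_gt0 (lt_trans d1) ?ltr_pdivrMr//; last by lra.
  move=> /(_ isT); rewrite expr2; clearbody d sigma; nra.
(* At s = 1 + d the gain d (2 - sigma) / 2 equals 4 d^2, which exceeds the quadratic loss 3 d^2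
   sigma / 4 since sigma < 2. *)
rewrite leNgt; apply/negP => s2; pose d := (2 - sigma) / 8.
have d0 : 0 < d by rewrite divr_gt0// subr_gt0.
have dE : 8 * d = 2 - sigma by rewrite /d; field.
have := key (1 + d); rewrite ltr_wpDr ?(ltW d0)// => /(_ isT).
have sE : sigma = 2 - 8 * d by rewrite dE; ring.
have d2 : 0 < d * d by exact: mulr_gt0.
have d3 : 0 < d * d * d by exact: mulr_gt0.
have d4 : 0 < d * d * (d * d) by exact: mulr_gt0.
rewrite expr2 sE; clearbody d; clear -d2 d3 d4; lra.
Qed.

(** The auxiliary function q adds (1 - r)^2 times the Taylor defect E, so that q 0 = q 1; the mean
    value theorem then gives a zero of q', where E = p'' / 2. *)
Lemma taylor_lagrange (p dp ddp : R -> R) :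
  (forall r : R, is_derive r (1 : R) p (dp r)) -> (forall r : R, is_derive r (1 : R) dp (ddp r)) ->
  exists2 c : R, 0 <= c <= 1 & p 1 = p 0 + dp 0 + ddp c / 2.
Proof.
move=> d1 d2; pose E := p 1 - p 0 - dp 0.
pose q r := p r + (1 - r) * dp r + (1 - r) * (1 - r) * E.
have dq r : is_derive r (1 : R) q ((1 - r) * (ddp r - 2 * E)).
  have l : is_derive r (1 : R) (fun s : R => 1 - s) (-1).
    by apply: (is_derive_eq (is_deriveB (is_derive_cst (1 : R) r (1 : R)) (is_derive_id r (1 : R)))); rewrite sub0r.
  have h := is_deriveD (is_deriveD (d1 r) (is_deriveM l (d2 r)))
    (is_deriveM (is_deriveM l l) (is_derive_cst E r (1 : R))).
  by apply: (is_derive_eq h); rewrite /GRing.scale/=; ring.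
have cq : {within `[0, 1], continuous q}.
  apply: continuous_subspaceT => r; apply/differentiable_continuous/derivable1_diffP.
  exact: (@ex_derive _ _ _ _ _ _ _ (dq r)).
have [c] := @MVT R q _ 0 1 ltr01 (fun r _ => dq r) cq.
rewrite in_itv/= => /andP[c0 c1] qE; exists c; first by rewrite !ltW.
have c10 : 1 - c != 0 by rewrite subr_eq0 gt_eqF.
have : (1 - c) * (ddp c - 2 * E) = 0.
  have : q 1 - q 0 = 0 by rewrite /q /E; ring.
  by rewrite qE subr0 mulr1.
by move/eqP; rewrite mulf_eq0 (negbTE c10)/= => /eqP; rewrite /E => h; lra.
Qed.

Lemma cvg_sum_ord n (T : Type) (F : set_system T) (FF : Filter F) (u : 'I_n -> T -> R)
    (c : 'I_n -> R) :
  (forall p : 'I_n, u p k @[k --> F] --> c p) -> \sum_p u p k @[k --> F] --> \sum_p c p.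
Proof.
move=> uc; have H (s : seq 'I_n) : \sum_(p <- s) u p k @[k --> F] --> \sum_(p <- s) c p.
  elim: s => [|p s IH].
    by rewrite big_nil; under eq_fun do rewrite big_nil; exact: cvg_cst.
  by rewrite big_cons; under eq_fun do rewrite big_cons; apply: cvgD.
exact: H.
Qed.

Section second_order.
Variables (g : 'rV[R]_N -> R) (P : 'I_N -> 'rV[R]_N -> R) (Q : 'I_N -> 'I_N -> 'rV[R]_N -> R) (M C : R).
Hypotheses (mg : measurable_fun setT g) (gM : forall y, `|g y| <= M).
Hypothesis dg : forall x v, is_derive x v g (\sum_i v ord0 i * P i x).
Hypothesis dP : forall i x v, is_derive x v (P i) (\sum_j v ord0 j * Q i j x).
Hypotheses (cQ : forall i j, continuous (Q i j)) (QC : forall i j x, `|Q i j x| <= C).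

Let taylor x v : exists2 c : R, 0 <= c <= 1 &
  g (v + x) = g x + \sum_i v ord0 i * P i x +
    (\sum_i \sum_j v ord0 i * v ord0 j * Q i j (c *: v + x)) / 2.
Proof.
have d1 (r : R) : is_derive r (1 : R) (fun s : R => g (s *: v + x)) (\sum_i v ord0 i * P i (r *: v + x)).
  exact/is_derive_line.
have d2 (r : R) : is_derive r (1 : R) (fun s : R => \sum_i v ord0 i * P i (s *: v + x))
    (\sum_i \sum_j v ord0 i * v ord0 j * Q i j (r *: v + x)).
  have h i : is_derive r (1 : R) (fun s : R => v ord0 i * P i (s *: v + x))
      (\sum_j v ord0 i * v ord0 j * Q i j (r *: v + x)).
    have hl : is_derive r (1 : R) (fun s : R => P i (s *: v + x)) (\sum_j v ord0 j * Q i j (r *: v + x)).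
      exact/is_derive_line.
    apply: (is_derive_eq (is_deriveZ (v ord0 i) hl)); rewrite /GRing.scale/= mulr_sumr.
    by apply: eq_bigr => j _; rewrite mulrA.
  apply: eq_is_derive (is_derive_sum h) => //.
  by apply/funext => s; rewrite fct_sumE.
have [c c01] := taylor_lagrange d1 d2; rewrite scale1r scale0r add0r => E.
by exists c.
Qed.

Lemma heat_second_order (l : nat -> R) x : (forall n, 0 < l n) -> l n @[n --> \oo] --> (0 : R) ->
  (l n ^+ 2)^-1 * (heat_semigroup (l n ^+ 2) g x - g x) @[n --> \oo] --> \sum_i Q i i x.
Proof.
move=> l0 lc.
(* The first-order Taylor term, whose Gaussian integral vanishes by oddness, is cancelled in the
   integrand; what remains is of second order and can be dominated. *)
pose I n z := heat_kernel 1 z *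
  ((l n ^+ 2)^-1 * (g (x - l n *: z) - g x + l n * \sum_i z ord0 i * P i x)).
pose J z := heat_kernel 1 z * ((\sum_i \sum_j z ord0 i * z ord0 j * Q i j x) / 2).
(* The intermediate points come from choice and carry no measurability; they serve for the bound and
   the pointwise limit of [I n], whose measurability is read from its definition. *)
have [cc ccP] : exists cc : nat -> 'rV[R]_N -> R, forall n z, 0 <= cc n z <= 1 /\
    I n z = heat_kernel 1 z *
      ((\sum_i \sum_j z ord0 i * z ord0 j * Q i j (- (cc n z * l n) *: z + x)) / 2).
  have h (q : nat * 'rV[R]_N) : exists c : R, 0 <= c <= 1 /\ I q.1 q.2 = heat_kernel 1 q.2 *
      ((\sum_i \sum_j q.2 ord0 i * q.2 ord0 j * Q i j (- (c * l q.1) *: q.2 + x)) / 2).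
    case: q => n z /=; have [c c01 E] := taylor x (- l n *: z); exists c; split=> //.
    rewrite /I; congr (_ * _).
    rewrite -scaleNr [x + _]addrC E.
    have -> : \sum_i (- l n *: z) ord0 i * P i x = - (l n * \sum_i z ord0 i * P i x).
      rewrite mulr_sumr -sumrN; apply: eq_bigr => i _; rewrite mxE; ring.
    have -> : \sum_i \sum_j (- l n *: z) ord0 i * (- l n *: z) ord0 j * Q i j (c *: (- l n *: z) + x) =
        l n ^+ 2 * \sum_i \sum_j z ord0 i * z ord0 j * Q i j (- (c * l n) *: z + x).
      rewrite mulr_sumr; apply: eq_bigr => i _; rewrite mulr_sumr; apply: eq_bigr => j _.
      rewrite !mxE scalerA mulrN; ring.
    have ln0 : l n != 0 by rewrite gt_eqF.
    by field.
  have [cc ccP] := choice h; exists (fun n z => cc (n, z)) => n z; exact: (ccP (n, z)).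
have iK := @integrable_heat_kernel R N 1 ltr01.
have sumI (P' : 'I_N -> R) := @Rintegral_sum_ord R _ _ leb setT N
   (fun i z => P' i * (heat_kernel 1 z * z ord0 i)) measurableT
   (fun i => integrable_scale measurableT (P' i) (integrable_coord i)).
have IE n : \int[leb]_z I n z = (l n ^+ 2)^-1 * (heat_semigroup (l n ^+ 2) g x - g x).
  have ms := measurable_comp_scale (l n) x mg.
  have i1 : leb.-integrable setT (EFin \o (fun z => heat_kernel 1 z * g (x - l n *: z))).
    apply: (@integrable_le _ _ R leb setT measurableT _ (fun z => M * heat_kernel 1 z)).
    - by apply: measurable_funM.
    - exact: integrable_scale.
    by move=> z _; rewrite normrM normr_heat_kernel mulrC ler_wpM2r ?heat_kernel_ge0.
  have [i3 i3E] := sumI (fun i => P i x).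
  have e : I n = (fun z => (l n ^+ 2)^-1 * ((heat_kernel 1 z * g (x - l n *: z) + (- g x) * heat_kernel 1 z) +
     l n * (\sum_i P i x * (heat_kernel 1 z * z ord0 i)))).
    apply/funext => z; rewrite /I.
    have -> : \sum_i P i x * (heat_kernel 1 z * z ord0 i) = heat_kernel 1 z * \sum_i z ord0 i * P i x.
      by rewrite mulr_sumr; apply: eq_bigr => i _; ring.
    by ring.
  have i2 : leb.-integrable setT (EFin \o (fun z => (- g x) * heat_kernel 1 z)) by exact: integrable_scale.
  have i12 := integrable_add measurableT i1 i2.
  have i3' := integrable_scale measurableT (l n) i3.
  rewrite e (RintegralZl _ measurableT (integrable_add measurableT i12 i3')).
  rewrite (RintegralD measurableT i12 i3') (RintegralD measurableT i1 i2).
  rewrite (RintegralZl _ measurableT iK) (RintegralZl _ measurableT i3) i3E.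
  rewrite Rintegral_heat_kernel// mulr1 -(heat_semigroup_unitE x (l0 n) mg gM).
  rewrite big1 ?mulr0 ?addr0// => i _.
  by rewrite (RintegralZl _ measurableT (integrable_coord i)) Rintegral_coord mulr0.
(* Mixed second moments vanish, and the diagonal ones equal 2, which cancels the 1/2 of Taylor's
   formula. *)
have JE : \int[leb]_z J z = \sum_i Q i i x.
  have inner i := @Rintegral_sum_ord R _ _ leb setT N
    (fun j z => Q i j x / 2 * (heat_kernel 1 z * (z ord0 i * z ord0 j))) measurableT
    (fun j => integrable_scale measurableT (Q i j x / 2) (integrable_coordM i j)).
  have [_ outer] := @Rintegral_sum_ord R _ _ leb setT N _ measurableT (fun i => (inner i).1).
  transitivity (\int[leb]_z (\sum_i \sum_j Q i j x / 2 * (heat_kernel 1 z * (z ord0 i * z ord0 j)))).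
    apply: eq_Rintegral => z _; rewrite /J mulrA mulr_sumr mulr_suml; apply: eq_bigr => i _.
    by rewrite mulr_sumr mulr_suml; apply: eq_bigr => j _; ring.
  rewrite outer; apply: eq_bigr => i _; rewrite (inner i).2 (bigD1 i)//= big1 => [|j ji].
    by rewrite (RintegralZl _ measurableT (integrable_coordM i i)) Rintegral_coord_sqr addr0; field.
  by rewrite (RintegralZl _ measurableT (integrable_coordM i j)) Rintegral_coordM ?mulr0// eq_sym.
rewrite -JE; under eq_fun do rewrite -IE.
apply: (@cvg_Rintegral _ _ R leb setT measurableT I J
  (fun z => (N%:R * (N%:R * C) / 2) * (heat_kernel 1 z * sqnorm z))).
- move=> n; apply: measurable_funM => //; apply: measurable_funM; first exact: measurable_cst.
  apply: measurable_funD.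
    by apply: measurable_funB; [exact: measurable_comp_scale|exact: measurable_cst].
  apply: measurable_funM; first exact: measurable_cst.
  apply: measurable_fun_sum_ord => i.
  by apply: measurable_funM; [exact: measurable_coord_rV|exact: measurable_cst].
- by apply: integrable_scale => //; exact: integrable_sqnorm.
- move=> n z _; have [_ ->] := ccP n z; rewrite normrM normr_heat_kernel mulrCA.
  apply: ler_wpM2l; first exact: heat_kernel_ge0.
  rewrite normrM [`|2^-1|]ger0_norm ?invr_ge0// mulrAC ler_wpM2r ?invr_ge0//.
  have b i : `|\sum_j z ord0 i * z ord0 j * Q i j (- (cc n z * l n) *: z + x)| <= N%:R * (sqnorm z * C).
    apply: le_trans (ler_norm_sum _ _ _) _.
    apply: (@le_trans _ _ (\sum_(j < N) (sqnorm z * C))).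
      by apply: ler_sum => j _; rewrite normrM ler_pM// normr_coordM_le.
    by rewrite sumr_const card_ord mulr_natl.
  apply: le_trans (ler_norm_sum _ _ _) _.
  apply: (@le_trans _ _ (\sum_(j < N) (N%:R * (sqnorm z * C)))); first by apply: ler_sum.
  rewrite sumr_const card_ord -mulr_natl le_eqVlt; apply/orP; left; apply/eqP; ring.
move=> z _; under eq_fun do rewrite (ccP _ z).2.
apply: cvgM; first exact: cvg_cst.
apply: cvgM; last exact: cvg_cst.
apply: cvg_sum_ord => i; apply: cvg_sum_ord => j; apply: cvgM; first exact: cvg_cst.
apply: (@continuous_cvg _ _ _ _ _ (fun n => - (cc n z * l n) *: z + x) (Q i j)); first exact: cQ.
rewrite -[X in _ --> X]add0r -(scale0r z); apply: cvgD; last exact: cvg_cst.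
apply: cvgZ; last exact: cvg_cst.
rewrite -oppr0; apply: cvgN; apply: (@squeeze_cvgr _ \oo _ R (cst 0) l (fun n => cc n z * l n)).
- near=> n; have [/andP[c0 c1] _] := ccP n z; have ln := ltW (l0 n).
  by rewrite mulr_ge0//= ler_piMl.
- exact: cvg_cst.
- exact: lc.
Unshelve. all: by end_near. Qed.

End second_order.

End heat_asymptotics.

(** * Space derivatives of bounded mild solutions *)

Section mild_regularity.
Context {R : realType} (N : nat).
Variables (a : R) (a0 : 0 < a).
Notation f := (nonlinearity a).
Notation leb := (lebesgue_rV R N).
Implicit Types (w : 'rV[R]_N -> R) (u F G : R -> 'rV[R]_N -> R) (x y z v : 'rV[R]_N)
  (t s r l tau M C : R) (i j : 'I_N).

Definition form_dx i t w F x := heat_dx i t w x + duhamel_dx i F t x.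

Lemma is_derive_comp_dir (V : normedModType R) (k : R -> R) (g : V -> R) (x v : V) (dk dg : R) :
  is_derive (g x) (1 : R) k dk -> is_derive x v g dg -> is_derive x v (fun y : V => k (g y)) (dk * dg).
Proof.
move=> hk hg.
have hl : is_derive (0 : R) (1 : R) (fun r : R => g (r *: v + x)) dg.
  by apply/is_derive_line; rewrite scale0r add0r.
suff : is_derive ((0 : R) *: v + x) v (fun y : V => k (g y)) (dk * dg) by rewrite scale0r add0r.
apply/is_derive_line.
apply: (@is_derive1_comp R k (fun r : R => g (r *: v + x))) hl.
by rewrite scale0r add0r.
Qed.

Section form.
Variables (w : 'rV[R]_N -> R) (M0 M : R) (F : R -> 'rV[R]_N -> R) (t : R).
Hypotheses (mw : measurable_fun setT w) (wM : forall y, `|w y| <= M0).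
Hypotheses (FM : bounded_field M F) (t0 : 0 < t).

Lemma is_derive_form x v : is_derive x v (fun y => heat_semigroup t w y + duhamel 0 F t y)
  (\sum_i v ord0 i * form_dx i t w F x).
Proof.
have h := is_deriveD (is_derive_heat_semigroup mw wM x v t0) (is_derive_duhamel x v (ltW t0) FM).
apply: eq_is_derive h => //; rewrite -big_split/=.
by apply: eq_bigr => i _; rewrite mulrDr.
Qed.

Lemma normr_form_dx_le i x : `|form_dx i t w F x| <=
  dimc N * t `^ (- 2^-1) * M0 + dimc N * M * sing_int 2^-1 t.
Proof.
apply: le_trans (ler_normD _ _) _; apply: lerD; first exact: normr_heat_dx_le.
exact: normr_duhamel_dx_le (ltW t0) FM.
Qed.

Lemma continuous_form_dx i : continuous (form_dx i t w F).
Proof.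
have M00 : 0 <= M0 := le_trans (normr_ge0 _) (wM 0).
have M10 := bounded_field_ge0 FM.
have D0 : 0 <= dimc N :> R := dimc_ge0 N.
pose c := 2 * dimc N * (dimc N + 1) * M0 * t `^ (- (3 / 4)) +
  2 * dimc N * (dimc N + 1) * M * sing_int (3 / 4) t.
have s0 : 0 <= sing_int (3 / 4) t by apply: Rintegral_ge0 => s _; exact: powR_ge0.
have c0 : 0 <= c by rewrite addr_ge0 ?mulr_ge0 ?addr_ge0 ?powR_ge0.
apply: (@modulus_continuous R 'rV[R]_N _ (fun r => c * Num.sqrt N%:R * Num.sqrt r)); last exact: sqrt_modulus.
move=> x v; rewrite -mulrA -sqrtrM ?ler0n//.
apply: (@le_trans _ _ (c * Num.sqrt (norm1 v))); last first.
  by rewrite ler_wpM2l// ler_wsqrtr// norm1_le.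
rewrite /form_dx opprD addrACA; apply: le_trans (ler_normD _ _) _.
rewrite /c mulrDl; apply: lerD.
  by rewrite [leRHS]mulrAC; exact: heat_dx_holder.
exact: duhamel_dx_holder (ltW t0) FM.
Qed.

Lemma measurable_form_dx i d (T : measurableType d) (p : T -> R) (q : T -> 'rV[R]_N) :
  measurable_fun setT p -> measurable_fun setT q ->
  measurable_fun setT (fun z : T => form_dx i (p z) w F (q z)).
Proof.
move=> mp mq; apply: measurable_funD.
  apply: (@measurable_heat_dx_param R N i _ _ p q (fun=> w)) => //.
  exact: (measurableT_comp mw measurable_snd).
apply: (@measurable_Rintegral_itv R _ _ (fun=> 0) p
  (fun (z : T) (s : R) => heat_dx i (p z - s) (F s) (q z))) => //.
apply: (@measurable_heat_dx_param R N i _ _ (fun z : T * R => p z.1 - z.2) (fun z : T * R => q z.1)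
  (fun z : T * R => F z.2)).
- by apply: measurable_funB; [exact: (measurableT_comp mp measurable_fst)|exact: measurable_snd].
- exact: (measurableT_comp mq measurable_fst).
apply: (measurableT_comp FM.1 (measurable_fun_pair _ _)).
  exact: (measurableT_comp measurable_snd measurable_fst).
exact: measurable_snd.
Qed.

End form.

Notation source u := (fun s y => - f (u s y)).

Lemma mild_eq M w u t : bounded_mild a M w u -> 0 < t ->
  u t = fun y => heat_semigroup t w y + duhamel 0 (source u) t y.
Proof. by move=> [_ _ _ uE] t0; apply/funext => y; rewrite uE. Qed.

Lemma is_derive_mild M w u t x v : bounded_mild a M w u -> 0 < t ->
  is_derive x v (u t) (\sum_i v ord0 i * form_dx i t w (source u) x).
Proof.
move=> H t0; rewrite (mild_eq H t0); have [mw wM uM _] := H.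
exact: (is_derive_form mw wM (bounded_field_nonlinearity a0 uM) t0).
Qed.

(** The gradient bound after time tau for data of size M. Restarting at t - tau makes it valid at
    every time t > tau, with a constant free of t. *)
Definition gradient_bound tau M :=
  dimc N * tau `^ (- 2^-1) * M + dimc N * (M `^ a * M) * sing_int 2^-1 tau.

Lemma normr_mild_dx_le M w u tau t i x : bounded_mild a M w u -> 0 < tau -> tau < t ->
  `|form_dx i t w (source u) x| <= gradient_bound tau M.
Proof.
move=> H tau0 taut; have t0 : 0 < t by rewrite (lt_trans tau0).
have tt0 : 0 < t - tau by rewrite subr_gt0.
have H' := bounded_mild_restart a0 tt0 H.
have d1 := is_derive_mild x (basis_rV R i) H t0.
have d2 := is_derive_mild x (basis_rV R i) H' tau0.
rewrite /= subrK in d2; rewrite !sum_basis in d1 d2.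
rewrite (is_derive_unique d1 d2); have [mw wM uM _] := H'.
exact: normr_form_dx_le mw wM (bounded_field_nonlinearity a0 uM) tau0 _ _.
Qed.

Lemma mild_lipschitz M w u tau t x v : bounded_mild a M w u -> 0 < tau -> tau < t ->
  `|u t (v + x) - u t x| <= norm1 v * gradient_bound tau M.
Proof.
move=> H tau0 taut; have t0 : 0 < t by rewrite (lt_trans tau0).
apply: (@directional_lipschitz R 'rV[R]_N _
  (fun y => \sum_i v ord0 i * form_dx i t w (source u) y)) => y.
  exact: is_derive_mild H t0.
by apply: normr_dirsum_le => i; exact: normr_mild_dx_le H tau0 taut.
Qed.

Lemma gradient_bound_ge0 tau M : 0 <= M -> 0 <= gradient_bound tau M.
Proof.
move=> M0; have s0 : 0 <= sing_int 2^-1 tau by apply: Rintegral_ge0 => s _; exact: powR_ge0.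
by rewrite /gradient_bound addr_ge0// !mulr_ge0 ?dimc_ge0 ?powR_ge0.
Qed.

(** An upper bound for the Gaussian mean of [norm1 z], through |z_i| <= 1 + |z|^2 in each of the N
    coordinates. *)
Definition moment_bound : R :=
  \int[leb]_z (N%:R * (heat_kernel 1 z + heat_kernel 1 z * sqnorm z)).

(** Restart at t: the heat flow over time s moves points by about sqrt s, which the Lipschitz bound
    in space converts into a modulus, and the Duhamel integral is of size s. *)
Lemma mild_time_modulus M w u tau t s x : bounded_mild a M w u -> 0 < tau -> tau < t -> 0 < s ->
  `|u (t + s) x - u t x| <= gradient_bound tau M * moment_bound * Num.sqrt s + M `^ a * M * s.
Proof.
move=> H tau0 taut s0; have t0 : 0 < t by rewrite (lt_trans tau0).
have H' := bounded_mild_restart a0 t0 H; have [mw wM uM uE] := H'.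
have M0 := bounded_field_ge0 uM.
set B := gradient_bound tau M; have B0 : 0 <= B := gradient_bound_ge0 tau M0.
rewrite (uE s x s0) addrAC; apply: le_trans (ler_normD _ _) _; apply: lerD; last first.
  by apply: (normr_duhamel_le (bounded_field_nonlinearity a0 uM)) => //; exact: ltW.
have l0 : 0 < Num.sqrt s by rewrite sqrtr_gt0.
rewrite -{1}(sqr_sqrtr (ltW s0)); set l := Num.sqrt s in l0 *.
have iK := @integrable_heat_kernel R N 1 ltr01.
have i1 : leb.-integrable setT (EFin \o (fun z => heat_kernel 1 z * u t (x - l *: z))).
  apply: (@integrable_le _ _ R leb setT measurableT _ (fun z => M * heat_kernel 1 z)).
  - apply: measurable_funM; last exact: measurable_comp_scale.
    by apply: (@measurable_heat_kernel_comp R N _ _ (cst 1) (fun z => z)).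
  - exact: integrable_scale.
  by move=> z _; rewrite normrM normr_heat_kernel mulrC ler_wpM2r ?heat_kernel_ge0.
have i2 : leb.-integrable setT (EFin \o (fun z => (- u t x) * heat_kernel 1 z)) by exact: integrable_scale.
have i3 : leb.-integrable setT (EFin \o (fun z => N%:R * (heat_kernel 1 z + heat_kernel 1 z * sqnorm z))).
  by apply: integrable_scale => //; apply: integrable_add => //; exact: integrable_sqnorm.
have -> : heat_semigroup (l ^+ 2) (u t) x - u t x =
    \int[leb]_z (heat_kernel 1 z * u t (x - l *: z) + (- u t x) * heat_kernel 1 z).
  rewrite (RintegralD measurableT i1 i2) (RintegralZl _ measurableT iK) Rintegral_heat_kernel// mulr1.
  by rewrite -(heat_semigroup_unitE x l0 mw wM).
rewrite -mulrA [moment_bound * _]mulrC mulrA.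
rewrite -(RintegralZl (B * l) measurableT i3).
have mI := measurable_int _ (integrable_add measurableT i1 i2).
apply: (@normr_Rintegral_le _ _ R leb setT measurableT).
- exact/measurable_EFinP.
- exact: integrable_scale.
move=> z _; have -> : heat_kernel 1 z * u t (x - l *: z) + (- u t x) * heat_kernel 1 z =
    heat_kernel 1 z * (u t (- l *: z + x) - u t x).
  by rewrite scaleNr addrC [- _ + x]addrC; ring.
rewrite normrM normr_heat_kernel.
have -> : B * l * (N%:R * (heat_kernel 1 z + heat_kernel 1 z * sqnorm z)) =
    heat_kernel 1 z * (l * (N%:R * (1 + sqnorm z)) * B) by ring.
apply: ler_wpM2l; first exact: heat_kernel_ge0.
apply: le_trans (mild_lipschitz _ _ H tau0 taut) _; apply: ler_wpM2r => //.
rewrite /norm1; apply: (@le_trans _ _ (\sum_(i < N) (l * (1 + sqnorm z)))).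
  apply: ler_sum => i _; rewrite mxE normrM normrN (gtr0_norm l0); apply: ler_wpM2l; first exact: ltW.
  have := sqr_coord_le z i; rewrite -(real_normK (num_real (z ord0 i))) expr2.
  by have := normr_ge0 (z ord0 i); move: `|_| => p p0; nra.
by rewrite sumr_const card_ord -mulr_natl le_eqVlt; apply/orP; left; apply/eqP; ring.
Qed.

Lemma mild_C2 M w u t : bounded_mild a M w u -> 0 < t ->
  exists (P : 'I_N -> 'rV[R]_N -> R) (Q : 'I_N -> 'I_N -> 'rV[R]_N -> R) (B C : R),
  [/\ forall x v, is_derive x v (u t) (\sum_i v ord0 i * P i x),
      forall i x v, is_derive x v (P i) (\sum_j v ord0 j * Q i j x),
      forall i j, continuous (Q i j),
      forall i x, `|P i x| <= B &
      forall i j x, `|Q i j x| <= C].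
Proof.
(* The gradient is bounded at times greater than tau, so the equation it satisfies is started at 2
   tau and run for the last third of [0, t]. *)
move=> H t0; pose tau := t / 3.
have tau0 : 0 < tau by rewrite divr_gt0.
have tau20 : 0 < 2 * tau by rewrite mulr_gt0.
have tE : t = 2 * tau + tau by rewrite /tau; field.
have [mw wM uM _] := H; have M0 := bounded_field_ge0 uM.
have Fu := bounded_field_nonlinearity a0 uM.
pose P i s x := form_dx i s w (source u) x.
have H2 := bounded_mild_restart a0 tau20 H; have [mw2 wM2 uM2 uE2] := H2.
pose B := gradient_bound tau M; have B0 : 0 <= B := gradient_bound_ge0 tau M0.
have PB i s x : tau < s -> `|P i s x| <= B by move=> ts; exact: normr_mild_dx_le H tau0 ts.
have tau2 : tau < 2 * tau by rewrite ltr_pMl// ltr1n.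
have dP s x v : 0 < s -> is_derive x v (u s) (\sum_i v ord0 i * P i s x) by exact: is_derive_mild H.
(* The source -f'(u) d_i u of the equation for d_i u. It is bounded, so the kernel may take a
   further derivative. *)
pose Fi i s x := - ((a + 1) * `|u (2 * tau + s) x| `^ a * P i (2 * tau + s) x).
have FiB i : bounded_field ((a + 1) * M `^ a * B) (Fi i).
  split.
    apply: measurable_funN; apply: measurable_funM.
      apply: measurable_funM; first exact: measurable_cst.
      apply: (measurableT_comp (measurable_powR a)); apply: (measurableT_comp (@normr_measurable R setT)).
      exact: uM2.1.
    have mp : measurable_fun setT (fun z : R * 'rV[R]_N => 2 * tau + z.1).
      by apply: measurable_funD; [exact: measurable_cst|exact: measurable_fst].
    rewrite /P; exact: (measurable_form_dx mw Fu i mp measurable_snd).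
  move=> s y s0; rewrite /Fi normrN normrM; apply: ler_pM => //; last first.
    by apply: PB; rewrite (lt_trans tau2)// ltrDl.
  rewrite normrM (ger0_norm (powR_ge0 _ _)) (@ger0_norm _ (a + 1)) ?addr_ge0 ?(ltW a0)//.
  rewrite ler_wpM2l ?addr_ge0 ?(ltW a0)//.
  apply: ge0_ler_powR; rewrite ?nnegrE ?(ltW a0)//; exact: uM2.2.
have mP i s : measurable_fun setT (P i s).
  rewrite /P; apply: (measurable_form_dx mw Fu i (p := fun=> s) (q := fun z => z)) => //.
have PE i x : P i t x = heat_semigroup tau (P i (2 * tau)) x + duhamel 0 (Fi i) tau x.
  have d1 := dP t x (basis_rV R i) t0; rewrite sum_basis in d1.
  apply: (is_derive_unique d1).
  have -> : u t = fun y => heat_semigroup tau (u (2 * tau)) y +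
      duhamel 0 (fun s y => - f (u (2 * tau + s) y)) tau y.
    by rewrite {1}tE; exact: (mild_eq H2 tau0).
  have dG y : is_derive y (basis_rV R i) (u (2 * tau)) (P i (2 * tau) y).
    by have := dP (2 * tau) y (basis_rV R i) tau20; rewrite sum_basis.
  apply: is_deriveD.
    exact: (heat_semigroup_derive x tau0 mw2 wM2 dG (mP i _) (fun y => PB i _ y tau2)).
  apply: (duhamel_derive x (ltW tau0) (bounded_field_nonlinearity a0 uM2) (FiB i)).
  move=> s y s0; have s20 : 0 < 2 * tau + s by exact: addr_gt0.
  have h := dP (2 * tau + s) y (basis_rV R i) s20; rewrite sum_basis in h.
  have h2 := is_deriveN (is_derive_comp_dir (is_derive_nonlinearity a0 (u (2 * tau + s) y)) h).
  by apply: eq_is_derive h2.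
exists (fun i => P i t), (fun i j => form_dx j tau (P i (2 * tau)) (Fi i)), B,
  (dimc N * tau `^ (- 2^-1) * B + dimc N * ((a + 1) * M `^ a * B) * sing_int 2^-1 tau); split.
- by move=> x v; exact: dP.
- move=> i x v; have -> : P i t = fun y => heat_semigroup tau (P i (2 * tau)) y + duhamel 0 (Fi i) tau y.
    by apply/funext => y; exact: PE.
  by apply: (is_derive_form (M0 := B) (mP i _) _ (FiB i) tau0) => y; exact: PB.
- by move=> i j; apply: (continuous_form_dx (M0 := B) (mP i _) _ (FiB i) tau0) => y; exact: PB.
- by move=> i x; apply: PB; rewrite tE ltrDr.
by move=> i j x; apply: (normr_form_dx_le (mP i _) _ (FiB i) tau0) => y; exact: PB.
Qed.

End mild_regularity.

(** * The self-similar solution is classical *)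

Section selfsimilar_classical.
Context {R : realType} (N : nat).
Variables (a : R) (a0 : 0 < a) (V : R -> 'rV[R]_N -> R).
Notation f := (nonlinearity a).
Notation mu := (@lebesgue_measure R).
Notation leb := (lebesgue_rV R N).
Implicit Types (x y z v : 'rV[R]_N) (t s r tau M : R) (i j : 'I_N).
Hypothesis VE : forall t x, 0 < t -> V t x = t `^ (- a^-1) * V 1 (t `^ (- 2^-1) *: x).
Hypothesis Vmild : forall tau, 0 < tau ->
  exists M, bounded_mild a M (V tau) (fun s => V (tau + s)).

Lemma continuous_powR_gt0 (b t : R) : 0 < t -> {for t, continuous (fun s : R => s `^ b)}.
Proof.
move=> t0; apply/differentiable_continuous/derivable1_diffP.
exact: (@ex_derive _ _ _ _ _ _ _ (is_derive1_powR b t0)).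
Qed.

Lemma near_fst_gt0 t x : 0 < t -> \forall p \near (t, x), 0 < (p : R * 'rV[R]_N).1.
Proof.
move=> t0; have h : (fun p : R * 'rV[R]_N => p.1) p @[p --> (t, x)] --> t by exact: cvg_fst.
exact: (h [set s | 0 < s] (lt_nbhsr t0)).
Qed.

(** V and its derivatives in t and x all have this form, so joint continuity reduces to that of
    functions of the space variable. *)
Lemma continuous_pos_selfsimilar (b : R) (phi : 'rV[R]_N -> R) (u : R -> 'rV[R]_N -> R) :
  continuous phi -> (forall t x, 0 < t -> u t x = t `^ b * phi (t `^ (- 2^-1) *: x)) ->
  continuous_pos u.
Proof.
move=> cphi uE t x t0.
have E : \forall p \near (t, x), (p : R * 'rV[R]_N).1 `^ b * phi (p.1 `^ (- 2^-1) *: p.2) = u p.1 p.2.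
  by apply: filterS (near_fst_gt0 x t0) => p p0; rewrite uE.
apply: (cvg_trans (near_eq_cvg E)); rewrite /= uE//.
have c1 (c : R) : (p : R * 'rV[R]_N).1 `^ c @[p --> (t, x)] --> t `^ c.
  apply: (@continuous_cvg _ _ _ _ _ (fun p : R * 'rV[R]_N => p.1) (fun s => s `^ c)).
    exact: continuous_powR_gt0.
  exact: cvg_fst.
apply: cvgM; first exact: c1.
apply: (@continuous_cvg _ _ _ _ _ (fun p : R * 'rV[R]_N => p.1 `^ (- 2^-1) *: p.2) phi).
  exact: cphi.
by apply: cvgZ; [exact: c1|exact: cvg_snd].
Qed.

Lemma is_derive_scale_arg (g : 'rV[R]_N -> R) (c : R) x v (d : R) :
  is_derive (c *: x) (c *: v) g d -> is_derive x v (fun y => g (c *: y)) d.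
Proof.
move=> h; suff : is_derive ((0 : R) *: v + x) v (fun y => g (c *: y)) d by rewrite scale0r add0r.
apply/is_derive_line.
have e : (fun s : R => g (s *: (c *: v) + c *: x)) = (fun s : R => g (c *: (s *: v + x))).
  by apply/funext => s; rewrite scalerDr !scalerA [s * c]mulrC.
rewrite -e; apply/is_derive_line.
by rewrite scale0r add0r.
Qed.

Lemma is_derive_cvg_seq (p : R -> R) (t d : R) (e : nat -> R) : is_derive t (1 : R) p d ->
  (forall n, e n != 0) -> e n @[n --> \oo] --> (0 : R) ->
  (e n)^-1 * (p (t + e n) - p t) @[n --> \oo] --> d.
Proof.
move=> [/cvg_ex[d' pd'] pd] e0 ec.
have dd : d' = d by rewrite -pd; apply/esym/cvg_lim.
rewrite dd in pd'; move/cvgr_dnbhsP: pd' => /(_ e (conj e0 ec)).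
by under eq_fun do rewrite /= scaler1 /GRing.scale/= [e _ + t]addrC.
Qed.

Section duhamel_average.
Variables (t : R) (x : 'rV[R]_N) (M : R).
Hypothesis H : bounded_mild a M (V t) (fun s => V (t + s)).
Hypothesis cV : {for (t, x), continuous (fun p : R * 'rV[R]_N => V p.1 p.2)}.
Variable l : nat -> R.
Hypotheses (l0 : forall n, 0 < l n) (lc : l n @[n --> \oo] --> (0 : R)).

Let F s y := - f (V (t + s) y).
Let FM : bounded_field (M `^ a * M) F.
Proof. by have [_ _ uM _] := H; exact: bounded_field_nonlinearity uM. Qed.

Let cvgF (r : nat -> R) (y : nat -> 'rV[R]_N) : r n @[n --> \oo] --> (0 : R) ->
  y n @[n --> \oo] --> x -> F (r n) (y n) @[n --> \oo] --> - f (V t x).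
Proof.
move=> rc yc; apply: cvgN.
apply: (@continuous_cvg _ _ _ _ _ (fun n => V (t + r n) (y n)) f).
  exact: continuous_nonlinearity.
have pc : (t + r n, y n) @[n --> \oo] --> (t, x).
  have c1 : t + r n @[n --> \oo] --> t.
    by rewrite -[X in _ --> X]addr0; apply: cvgD; [exact: cvg_cst|exact: rc].
  exact: (cvg_pair c1 yc).
exact: (@continuous_cvg _ _ _ _ _ (fun n => (t + r n, y n)) (fun p : R * 'rV[R]_N => V p.1 p.2) _ cV pc).
Qed.

Let heat_avg (r : R) : 0 < r -> r < 1 ->
  heat_semigroup (l n ^+ 2 * (1 - r)) (F (l n ^+ 2 * r)) x @[n --> \oo] --> - f (V t x).
Proof.
move=> r0 r1; have r10 : 0 < 1 - r by rewrite subr_gt0.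
have q0 : 0 < Num.sqrt (1 - r) by rewrite sqrtr_gt0.
have ln2 n : 0 < l n ^+ 2 by rewrite exprn_gt0.
have E n : heat_semigroup (l n ^+ 2 * (1 - r)) (F (l n ^+ 2 * r)) x =
    \int[leb]_z (heat_kernel 1 z * F (l n ^+ 2 * r) (x - (l n * Num.sqrt (1 - r)) *: z)).
  rewrite -{1}(sqr_sqrtr (ltW r10)) -exprMn.
  apply: (heat_semigroup_unitE (M := M `^ a * M)); first exact: mulr_gt0.
    exact: bounded_field_measurable FM.
  by move=> y; apply: FM.2; rewrite mulr_gt0.
under eq_fun do rewrite E.
have iK := @integrable_heat_kernel R N 1 ltr01.
have -> : - f (V t x) = \int[leb]_z (heat_kernel 1 z * - f (V t x)).
  under eq_Rintegral do rewrite mulrC.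
  by rewrite (RintegralZl _ measurableT iK) Rintegral_heat_kernel// mulr1.
apply: (@cvg_Rintegral _ _ R leb setT measurableT _ _ (fun z => M `^ a * M * heat_kernel 1 z)).
- move=> n; apply: measurable_funM.
    by apply: (@measurable_heat_kernel_comp R N _ _ (cst 1) (fun z => z)).
  by apply: measurable_comp_scale; exact: bounded_field_measurable FM.
- exact: integrable_scale.
- move=> n z _; rewrite normrM normr_heat_kernel mulrC ler_wpM2r ?heat_kernel_ge0//.
  by apply: FM.2; rewrite mulr_gt0.
move=> z _; apply: cvgM; first exact: cvg_cst.
apply: cvgF.
  have h : l n * l n * r @[n --> \oo] --> (0 * 0 * r : R).
    by apply: cvgM; [apply: cvgM|exact: cvg_cst].
  by rewrite !mul0r in h; under eq_fun do rewrite expr2.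
rewrite -[X in _ --> X]subr0; apply: cvgB; first exact: cvg_cst.
rewrite -(scale0r z); apply: cvgZ; last exact: cvg_cst.
by rewrite -(mul0r (Num.sqrt (1 - r))); apply: cvgM => //; exact: cvg_cst.
Qed.

(** With s = l^2 r the mean becomes an integral over r in ]0, 1[, in which the heat time l^2 (1 - r)
    shrinks to 0; continuity of V at (t, x) and the uniform bound give the limit. *)
Lemma cvg_duhamel_average :
  (l n ^+ 2)^-1 * duhamel 0 F (l n ^+ 2) x @[n --> \oo] --> - f (V t x).
Proof.
have ln2 n : 0 < l n ^+ 2 by rewrite exprn_gt0.
have mI : measurable (`]0, 1[%classic : set R) by [].
have E n : (l n ^+ 2)^-1 * duhamel 0 F (l n ^+ 2) x =
    \int[mu]_(r in `]0, 1[) heat_semigroup (l n ^+ 2 * (1 - r)) (F (l n ^+ 2 * r)) x.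
  have h := @Rintegral_itv_affine R 0 1 (l n ^+ 2) 0
    (fun s => heat_semigroup (l n ^+ 2 - s) (F s) x) (ln2 n).
  rewrite mulr0 mulr1 !addr0 in h.
  rewrite duhamel0E h; last exact: integrable_duhamel0 FM.
  rewrite mulrA mulVf ?mul1r ?gt_eqF//; apply: eq_Rintegral_itv => r _.
  by rewrite addr0 mulrBr mulr1.
under eq_fun do rewrite E.
have -> : - f (V t x) = \int[mu]_(r in `]0, 1[) (- f (V t x)).
  by rewrite Rintegral_itv_cst// subr0 mulr1.
apply: (@cvg_Rintegral _ _ R mu _ mI _ _ (fun=> M `^ a * M)).
- move=> n; apply: measurable_funTS.
  apply: (@measurable_heat_semigroup_param R N _ _ (fun r : R => l n ^+ 2 * (1 - r)) (fun=> x)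
    (fun r : R => F (l n ^+ 2 * r))) => //.
    apply: measurable_funM; first exact: measurable_cst.
    exact: measurable_funB.
  apply: (measurableT_comp FM.1 (measurable_fun_pair _ _)); last exact: measurable_snd.
  by apply: measurable_funM; [exact: measurable_cst|exact: measurable_fst].
- apply: (@integrable_itv_bounded _ _ _ _ (M `^ a * M)) => //.
  by move=> s _; rewrite ger0_norm// (bounded_field_ge0 FM).
- move=> n r; rewrite /= in_itv/= => /andP[r0 r1].
  apply: normr_heat_semigroup_le; first by rewrite mulr_gt0// subr_gt0.
    exact: bounded_field_measurable FM.
  by move=> y; apply: FM.2; rewrite mulr_gt0.
by move=> r; rewrite /= in_itv/= => /andP[r0 r1]; exact: heat_avg.
Qed.

End duhamel_average.

Lemma selfsimilar_classical : classical_solution a V.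
Proof.
have h20 : 0 < 2^-1 :> R by rewrite invr_gt0.
have [M0 H0] := Vmild h20.
have [P [Q [B [C [dg dP cQ PB QC]]]]] := mild_C2 a0 H0 h20.
(* The profile is the solution restarted at time 1/2 and observed after a further time 1/2. *)
have E1 : V (2^-1 + 2^-1) = V 1 by congr V; lra.
rewrite /= E1 in dg.
have cg : continuous (V 1).
  apply: (@modulus_continuous R 'rV[R]_N _ (fun r => N%:R * `|B| * r)); last exact: linear_modulus.
  move=> x v; apply: (le_trans (directional_lipschitz (C := norm1 v * `|B|) (fun y => dg y v) _ x)).
    by move=> y; apply: normr_dirsum_le => i; apply: le_trans (PB i y) (ler_norm _).
  by rewrite mulrAC ler_wpM2r// norm1_le.
have cP i : continuous (P i).
  apply: (@modulus_continuous R 'rV[R]_N _ (fun r => N%:R * `|C| * r)); last exact: linear_modulus.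
  move=> x v; apply: (le_trans (directional_lipschitz (C := norm1 v * `|C|) (fun y => dP i y v) _ x)).
    by move=> y; apply: normr_dirsum_le => j; apply: le_trans (QC i j y) (ler_norm _).
  by rewrite mulrAC ler_wpM2r// norm1_le.
pose b : R := - a^-1.
have bE : b - 1 = b - 2^-1 - 2^-1 by lra.
pose P' i t x := t `^ (b - 2^-1) * P i (t `^ (- 2^-1) *: x).
pose Q' i j t x := t `^ (b - 1) * Q i j (t `^ (- 2^-1) *: x).
have VtE t : 0 < t -> V t = fun x => t `^ b * V 1 (t `^ (- 2^-1) *: x).
  by move=> t0; apply/funext => x; exact: VE.
have powD (r s t : R) : 0 < t -> t `^ (r + s) = t `^ r * t `^ s.
  by move=> t0; rewrite powRD// (gt_eqF t0) implybT.
have dV t x v : 0 < t -> is_derive x v (V t) (\sum_i v ord0 i * P' i t x).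
  move=> t0; rewrite VtE//.
  have h := is_deriveZ (t `^ b) (is_derive_scale_arg (dg (t `^ (- 2^-1) *: x) (t `^ (- 2^-1) *: v))).
  apply: eq_is_derive h => //; rewrite /GRing.scale/= mulr_sumr; apply: eq_bigr => i _.
  by rewrite mxE /P' powD//; ring.
have dP' i t x v : 0 < t -> is_derive x v (P' i t) (\sum_j v ord0 j * Q' i j t x).
  move=> t0.
  have h := is_deriveZ (t `^ (b - 2^-1)) (is_derive_scale_arg (dP i (t `^ (- 2^-1) *: x) (t `^ (- 2^-1) *: v))).
  apply: eq_is_derive h => //; rewrite /GRing.scale/= mulr_sumr; apply: eq_bigr => j _.
  rewrite mxE /Q' bE; by rewrite [in RHS]powD//; ring.
have dxE i t x : 0 < t -> dx i V t x = P' i t x.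
  move=> t0; have h := dV t x (basis_rV R i) t0; rewrite sum_basis in h.
  by rewrite /dx; case: h.
have dxxE i j t x : 0 < t -> dx j (dx i V) t x = Q' i j t x.
  move=> t0; have h := dP' i t x (basis_rV R j) t0; rewrite sum_basis in h.
  have e : dx i V t = P' i t by apply/funext => y; exact: dxE.
  by rewrite /dx -/(dx i V t) e; case: h.
(* With g = V 1 and b = -1/a, the time derivative of t^b g(x / sqrt t) is t^(b - 1) (b g - y . grad
   g / 2) at y = x / sqrt t: regularity in time is inherited from space. *)
pose psi y := - a^-1 * V 1 y - 2^-1 * \sum_i y ord0 i * P i y.
have dtV t x : 0 < t -> is_derive t (1 : R) (V ^~ x) (t `^ (b - 1) * psi (t `^ (- 2^-1) *: x)).
  move=> t0.
  have h0 : is_derive (t `^ (- 2^-1)) (1 : R) (fun r : R => V 1 (r *: x))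
      (\sum_i x ord0 i * P i (t `^ (- 2^-1) *: x)).
    have e : (fun r : R => V 1 (r *: x)) = (fun r : R => V 1 (r *: x + 0)).
      by apply/funext => r; rewrite addr0.
    rewrite e; apply/is_derive_line; rewrite addr0; exact: dg.
  have h1 := @is_derive1_comp R (fun r : R => V 1 (r *: x)) (@powR R ^~ (- 2^-1)) t _ _
    h0 (is_derive1_powR (- 2^-1) t0).
  have h2 := is_deriveM (is_derive1_powR b t0) h1.
  have near_eq : \forall s \near t, s `^ b * V 1 (s `^ (- 2^-1) *: x) = V s x.
    by near=> s; rewrite [in RHS]VE//; near: s; exact: lt_nbhsr.
  apply: (near_eq_is_derive near_eq); apply: (is_derive_eq h2).
  rewrite /GRing.scale/= /psi.
  have -> : \sum_i (t `^ (- 2^-1) *: x) ord0 i * P i (t `^ (- 2^-1) *: x) =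
      t `^ (- 2^-1) * \sum_i x ord0 i * P i (t `^ (- 2^-1) *: x).
    by rewrite mulr_sumr; apply: eq_bigr => i _; rewrite mxE mulrA.
  rewrite (powD b (-1))// (powD (- 2^-1) (-1))// /b; ring.
have dtE t x : 0 < t -> dt V t x = t `^ (b - 1) * psi (t `^ (- 2^-1) *: x).
  by move=> t0; rewrite /dt; case: (dtV t x t0).
have cpsi : continuous psi.
  have cs : continuous (fun y => \sum_i y ord0 i * P i y).
    have cc i : continuous (fun z : 'rV[R]_N => z ord0 i).
      apply: (@modulus_continuous R 'rV[R]_N _ (fun r => 1 * r)); last exact: linear_modulus.
      by move=> z v; rewrite mxE addrK mul1r; exact: le_coord_norm.
    move=> y; exact: (@cvg_sum_ord R N _ (nbhs y) (nbhs_filter y) (fun i z => z ord0 i * P i z)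
      (fun i => y ord0 i * P i y) (fun i => cvgM (cc i y) (cP i y))).
  move=> y; exact: (cvgB (cvgM (cvg_cst (- a^-1)) (cg y)) (cvgM (cvg_cst (2^-1 : R)) (cs y))).
have cV : continuous_pos V by exact: (continuous_pos_selfsimilar cg VE).
split; first split.
- exact: cV.
- split; first exact: (continuous_pos_selfsimilar cpsi dtE).
  by move=> t x t0; have [] := dtV t x t0.
- move=> i; split; first exact: (continuous_pos_selfsimilar (cP i) (dxE i)).
  move=> t x t0; have h := dV t x (basis_rV R i) t0; exact: (@ex_derive _ _ _ _ _ _ _ h).
- move=> i j; split; first exact: (continuous_pos_selfsimilar (cQ i j) (dxxE i j)).
  move=> t x t0; have h := dP' i t x (basis_rV R j) t0.
  have e : dx i V t = P' i t by apply/funext => y; exact: dxE.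
  rewrite e; exact: (@ex_derive _ _ _ _ _ _ _ h).
move=> t x t0; have [M H] := Vmild t0.
have [mVt VtM VM' Veq] := H.
(* V is already differentiable in t, so the equation may be read along the single sequence of time
   steps l_n^2. *)
pose l n : R := harmonic n.
have l0 n : 0 < l n by rewrite /l /harmonic /= invr_gt0 ltr0n.
have lc : l n @[n --> \oo] --> (0 : R) by exact: cvg_harmonic.
have c1 := heat_second_order mVt VtM (fun y v => dV t y v t0) (fun i y v => dP' i t y v t0).
have c2 := cvg_duhamel_average H (cV t x t0) l0 lc.
have c3 := is_derive_cvg_seq (dtV t x t0) (fun n => lt0r_neq0 (exprn_gt0 2 (l0 n))).
have l2c : l n ^+ 2 @[n --> \oo] --> (0 : R).
  have h : l n * l n @[n --> \oo] --> (0 * 0 : R) by exact: cvgM.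
  by rewrite mulr0 in h; under eq_fun do rewrite expr2.
have {}c3 := c3 l2c.
have cQ' i j : continuous (Q' i j t).
  move=> y; have sc : (fun z : 'rV[R]_N => t `^ (- 2^-1) *: z) z @[z --> y] --> t `^ (- 2^-1) *: y.
    exact: (cvgZ (cvg_cst _) cvg_id).
  have qc := continuous_cvg _ (cQ i j (t `^ (- 2^-1) *: y)) sc.
  exact: (cvgM (cvg_cst (t `^ (b - 1))) (qc (nbhs_filter y))).
have QC' i j y : `|Q' i j t y| <= t `^ (b - 1) * C.
  by rewrite normrM ger0_norm ?powR_ge0// ler_wpM2l ?powR_ge0.
have {}c1 := c1 _ cQ' QC' l x l0 lc.
have c12 : (l n ^+ 2)^-1 * (V (t + l n ^+ 2) x - V t x) @[n --> \oo] -->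
    \sum_i Q' i i t x + - f (V t x).
  rewrite (_ : (fun n => _) = (fun n => (l n ^+ 2)^-1 * (heat_semigroup (l n ^+ 2) (V t) x - V t x) +
      (l n ^+ 2)^-1 * duhamel 0 (fun s y => - f (V (t + s) y)) (l n ^+ 2) x)); first exact: cvgD.
  apply/funext => n; rewrite Veq ?exprn_gt0//; ring.
have := cvg_unique _ c3 c12 => /(_ _) E.
rewrite dtE// E//.
have lE : laplacian V t x = \sum_i Q' i i t x by apply: eq_bigr => i _; rewrite dxxE.
by rewrite lE /nonlinearity; ring.
Unshelve. all: by end_near. Qed.

End selfsimilar_classical.

(** * Mild solutions with data h and convergence *)

Section conclusion.
Context {R : realType} (N m : nat).
Variables (a : R) (a0 : 0 < a) (h : 'rV[R]_N -> R).
Notation f := (nonlinearity a).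
Notation mu := (@lebesgue_measure R).
Implicit Types (u w : R -> 'rV[R]_N -> R) (t s L M l T : R) (x y : 'rV[R]_N).
Hypotheses (mh : measurable_fun setT h) (ah : antisymmetric_upto m h).
Hypothesis hp : forall x, orthant m x -> h x = 1.
Let h1 := normr_indicator_le1 ah hp.
Notation v := (limit_mild a h).
Notation V := (selfsim a h).

Lemma Cbu_mild M (w0 : 'rV[R]_N -> R) u t : bounded_mild a M w0 u -> 0 < t -> Cbu (u t).
Proof.
move=> H t0; have [_ _ uM _] := H; split.
  exists M; split; first exact: num_real.
  by move=> K MK y _; apply: le_trans (uM.2 t y t0) (ltW MK).
have t20 : 0 < t / 2 by rewrite divr_gt0.
have t2t : t / 2 < t by rewrite ltr_pdivrMr// ltr_pMr// ltr1n.
have B0 : 0 <= gradient_bound N a (t / 2) M by exact: gradient_bound_ge0 (bounded_field_ge0 uM).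
apply: (@unif_modulus_continuous R 'rV[R]_N _ (fun r => N%:R * gradient_bound N a (t / 2) M * r));
  last exact: linear_modulus.
move=> x z; apply: le_trans (mild_lipschitz a0 x z H t20 t2t) _.
by rewrite mulrAC ler_wpM2r// norm1_le.
Qed.

Lemma mild_time_continuous M (w0 : 'rV[R]_N -> R) u t : bounded_mild a M w0 u -> 0 < t ->
  {uniform, u s @[s --> t] --> u t}.
Proof.
move=> H t0; apply/uniform_cvgP => e e0.
pose tau := t / 4; have tau0 : 0 < tau by rewrite divr_gt0.
have taut : tau < t / 2 by rewrite /tau; lra.
pose A := gradient_bound N a tau M * moment_bound N; pose K := M `^ a * M.
(* The modulus looks forward in time. For s < t it is started at s, which stays above t / 2 > tau,
   so that one constant serves both sides. *)
have mod1 s r x : t / 2 < s -> s < r -> `|u r x - u s x| <= A * Num.sqrt (r - s) + K * (r - s).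
  move=> ts sr; have rs0 : 0 < r - s by rewrite subr_gt0.
  have := mild_time_modulus a0 x H tau0 (lt_trans taut ts) rs0.
  by rewrite [s + _]addrC subrK.
have [d1 d10 d1E] := sqrt_modulus A (divr_gt0 e0 (ltr0n R 2)).
have [d2 d20 d2E] := linear_modulus K (divr_gt0 e0 (ltr0n R 2)).
near=> s => x _.
have st2 : t / 2 < s by near: s; apply: lt_nbhsr; rewrite ltr_pdivrMr// ltr_pMr// ltr1n.
have dst : `|t - s| < Num.min d1 d2.
  by near: s; apply: (@cvgr_dist_lt _ _ _ (nbhs t) _ id t) => //; rewrite lt_min d10.
have bnd r : 0 <= r -> r < Num.min d1 d2 -> A * Num.sqrt r + K * r < e.
  move=> r0; rewrite lt_min => /andP[r1 r2]; have := d1E r r0 r1; have := d2E r r0 r2; lra.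
have [st|ts|->] := ltgtP s t; last by rewrite subrr normr0.
  apply: le_lt_trans (mod1 s t x st2 st) _; apply: bnd; first by rewrite subr_ge0 ltW.
  by apply: le_lt_trans dst; exact: ler_norm.
rewrite distrC; apply: le_lt_trans (mod1 t s x _ ts) _.
  by rewrite ltr_pdivrMr// ltr_pMr// ltr1n.
apply: bnd; first by rewrite subr_ge0 ltW.
by apply: le_lt_trans dst; rewrite distrC; exact: ler_norm.
Unshelve. all: by end_near. Qed.

Lemma mild_solution_exists : mild_solution a h v.
Proof.
have H := limit_mildP a0 mh ah hp; have [_ _ vM vE] := H.
have bf := bounded_field_nonlinearity a0 vM.
have bfp : bounded_field (1 `^ a * 1) (fun s y => f (v s y)).
  split; last by move=> s y s0; rewrite -normrN; exact: bf.2.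
  by have := measurable_funN bf.1; congr (measurable_fun _ _); apply/funext => z /=; rewrite opprK.
split.
- by move=> t t0; split; [exact: Cbu_mild H t0|exact: mild_time_continuous H t0].
- move=> t x t0; split; first exact: integrable_duhamel0 bfp.
  rewrite vE//; congr (_ + _).
  rewrite -[X in - X](duhamel0E (fun s y => f (v s y))).
  rewrite -mulN1r -(duhamelZ (-1) t x (lexx 0) bfp); apply: eq_duhamel => s y _.
  by rewrite mulN1r.
apply/uniform_cvgP => e e0; near=> t => x _.
have t0 : 0 < t by near: t; exact: nbhs_right_gt.
rewrite [X in `|X|](_ : _ = - duhamel 0 (fun s y => - f (v s y)) t x); last first.
  by rewrite vE//=; ring.
rewrite normrN.
apply: le_lt_trans (normr_duhamel_le bf (lexx 0) x (ltW t0)) _.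
have p1 : 1 `^ a = 1 :> R by rewrite powR1.
by rewrite p1 !mul1r; near: t; exact: nbhs_right_lt.
Unshelve. all: by end_near. Qed.

Lemma unif_continuous_measurable (g : 'rV[R]_N -> R) : unif_continuous g -> measurable_fun setT g.
Proof.
move=> ug; apply: continuous_measurable_rV; exact: unif_continuous_continuous.
Qed.

(** Near time 0 the initial condition keeps w within 1 of the heat flow of [h], itself bounded by 1;
    away from 0 the bound follows from continuity in the sup norm on a compact interval. *)
Lemma mild_solution_bounded w T : mild_solution a h w -> 0 < T ->
  exists K, forall s y, 0 < s -> s <= T -> `|w s y| <= K.
Proof.
move=> [wC _ w0] T0.
have /uniform_cvgP/(_ 1 ltr01) := w0.
case=> d /= d0 dE.
have small s y : 0 < s -> s < d -> `|w s y| <= 2.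
  move=> s0 sd; have sI : ball_ [eta Num.Def.normr] 0 d s by rewrite /ball_/= sub0r normrN gtr0_norm.
  have := dE s sI s0 y I; rewrite sub0r normrN => h2.
  have h3 := normr_heat_semigroup_le s0 mh h1 y.
  rewrite -[w s y](subrK (heat_semigroup s h y)); apply: le_trans (ler_normD _ _) _; lra.
(* The segment starts at d / 2, which is positive and leaves no gap with the times s < d already
   treated. *)
have /compact_near_coveringP nc := @segment_compact R (d / 2) T.
have [|K0 [K0r K0E]] := nc R (pinfty_nbhs R) (fun K s => forall y, `|w s y| <= K) _ _.
  move=> t; rewrite /= in_itv/= => /andP[dt tT].
  have t0 : 0 < t by rewrite (lt_le_trans _ dt)// divr_gt0.
  have [[[B [Br BE]] _] /uniform_cvgP/(_ 1 ltr01) uc] := wC t t0.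
  have Bb y : `|w t y| <= `|B| + 1 by apply: BE => //; rewrite (le_lt_trans (ler_norm B))// ltrDl.
  exists ([set s | forall y, setT y -> `|w t y - w s y| < 1], [set k | `|B| + 2 < k]).
    split=> //=; exists (`|B| + 2); split=> //; exact: num_real.
  case=> s k /= [hs hk] y; have := hs y I; have := Bb y => b1 b2.
  rewrite -[w s y](subrK (w t y)); apply: le_trans (ler_normD _ _) _.
  by rewrite distrC; lra.
exists (Num.max 2 (`|K0| + 1)) => s y s0 sT.
have [sd|ds] := ltP s d; first by rewrite le_max small.
rewrite le_max; apply/orP; right.
apply: (K0E (`|K0| + 1)); first by rewrite (le_lt_trans (ler_norm K0))// ltrDl.
by rewrite /= in_itv/= sT andbT; apply: le_trans ds; rewrite ler_pdivrMr// ler_pMr// ler1n.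
Qed.

(* Weighting by exp (2 L t) makes the integral operator a contraction of ratio 1/2. *)
Lemma mild_solution_unique w : mild_solution a h w -> forall t x, 0 < t -> w t x = v t x.
Proof.
move=> Hw T X T0; have [K0 K0E] := mild_solution_bounded Hw T0.
have [vC vE' _] := mild_solution_exists; have [_ _ vM _] := limit_mildP a0 mh ah hp.
have [wC wE _] := Hw.
pose K := Num.max K0 1.
have wK s y : 0 < s -> s <= T -> `|w s y| <= K by move=> s0 sT; rewrite le_max K0E.
have vK s y : 0 < s -> `|v s y| <= K by move=> s0; rewrite le_max (vM.2 s y s0) orbT.
pose L := (a + 1) * K `^ a.
(* Taking K >= 1 makes the Lipschitz constant L of f on [-K, K] positive. *)
have L0 : 0 < L by rewrite mulr_gt0 ?powR_gt0 ?lt_max ?ltr01 ?orbT// addr_gt0.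
have mw s : 0 < s -> measurable_fun setT (w s).
  by move=> s0; have [[_ uc] _] := wC s s0; exact: unif_continuous_measurable.
have step n : forall t x, 0 < t -> t <= T ->
    `|w t x - v t x| <= 2 * K * 2^-1 ^+ n * expR (2 * L * t + 0).
  elim: n => [|n IH] t x t0 tT.
    rewrite expr0 mulr1; apply: (@le_trans _ _ (2 * K)).
      apply: le_trans (ler_normB _ _) _; have := wK t x t0 tT; have := vK t x t0; lra.
    rewrite ler_peMr//; last first.
      by apply: le_trans (expR_ge1Dx _); rewrite addr0 lerDl; apply: mulr_ge0; [apply: mulr_ge0|]; rewrite // ltW.
    by rewrite mulr_ge0// le_max ler01 orbT.
  have [iw ->] := wE t x t0; have [iv ->] := vE' t x t0.
  set C := 2 * K * 2^-1 ^+ n.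
  have C0 : 0 <= C by rewrite mulr_ge0 ?exprn_ge0 ?invr_ge0// mulr_ge0// le_max ler01 orbT.
  set Iw := \int[mu]_(s in _) _; set Iv := \int[mu]_(s in _) _.
  have -> : heat_semigroup t h x - Iw - (heat_semigroup t h x - Iv) = Iv - Iw by ring.
  have mI : measurable (`]0, t[%classic : set R) by [].
  (* The weight grows at twice the Lipschitz rate, so a primitive of L C exp (2 L s) is (C / 2) exp
     (2 L s): the constant is halved at each step. *)
  have [||iF FE] := @Rintegral_FTC R (fun s => L * C * expR (2 * L * s + 0))
    (fun s => C / 2 * expR (2 * L * s + 0)) 0 t (ltW t0).
  - by move=> s _; exact: (cvgM (cvg_cst (L * C)) (@continuous_expR_affine R (2 * L) 0 s)).
  - move=> s _; apply: (is_derive_eq (is_deriveZ (C / 2) (is_derive_expR_affine (2 * L) 0 s))).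
    by rewrite /GRing.scale/=; field.
  rewrite /Iw /Iv -RintegralB//.
  apply: (le_trans (@normr_Rintegral_le _ _ R mu _ mI _ (fun s : R => L * C * expR (2 * L * s + 0)) _ iF _)).
  - by apply: measurable_funB; apply/measurable_EFinP; [exact: measurable_int iv|exact: measurable_int iw].
  - move=> s; rewrite /= in_itv/= => /andP[s0 st]; have ts0 : 0 < t - s by rewrite subr_gt0.
    have sT := le_trans (ltW st) tT.
    have mfw : measurable_fun setT (f \o w s) := measurableT_comp (measurable_nonlinearity a0) (mw s s0).
    have mfv : measurable_fun setT (f \o v s).
      exact: measurableT_comp (measurable_nonlinearity a0) (bounded_field_measurable s vM).
    have fwK y : `|(f \o w s) y| <= K `^ a * K by apply: normr_nonlinearity_le => //; exact: wK.
    have fvK y : `|(f \o v s) y| <= K `^ a * K by apply: normr_nonlinearity_le => //; exact: vK.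
    rewrite -(heat_semigroupB ts0 mfv fvK mfw fwK).
    apply: normr_heat_semigroup_le => //; first exact: measurable_funB.
    move=> y; apply: le_trans (nonlinearity_lipschitz a0 (vK s y s0) (wK s y s0 sT)) _.
    rewrite -[leRHS]mulrA; apply: ler_wpM2l; first exact: ltW.
    by rewrite distrC; exact: IH.
  rewrite FE lerBlDr; apply: (@le_trans _ _ (C / 2 * expR (2 * L * t + 0))).
    by [].
  have -> : 2 * K * 2^-1 ^+ n.+1 = C / 2 by rewrite /C exprSr; ring.
  by rewrite lerDl mulr_ge0 ?expR_ge0// divr_ge0.
apply/eqP; rewrite -subr_eq0 -normr_le0.
have qn : 2 * K * 2^-1 ^+ n * expR (2 * L * T + 0) @[n --> \oo] --> (2 * K * 0 * expR (2 * L * T + 0) : R).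
  apply: cvgM; last exact: cvg_cst.
  apply: cvgM; first exact: cvg_cst.
  by apply: cvg_expr; rewrite ger0_norm ?invr_ge0// invf_lt1// ltr1n.
rewrite mulr0 mul0r in qn; apply: (ler_cvg_to (cvg_cst _) qn); near=> n; exact: step.
Unshelve. all: by end_near. Qed.

(** Self-similarity with l = t^(-1/2), the dilation that brings time t to time 1. *)
Lemma selfsim_formula t x : 0 < t -> V t x = t `^ (- a^-1) * V 1 (t `^ (- 2^-1) *: x).
Proof.
move=> t0; have l0 : 0 < t `^ (- 2^-1) by rewrite powR_gt0.
rewrite -(selfsim_self_similar a0 mh ah hp l0 x t0) /dilation -powRrM.
have -> : t `^ (- 2^-1) ^+ 2 * t = 1.
  rewrite -powR_mulrn ?powR_ge0// -powRrM -{2}(powRr1 (ltW t0)) -powRD ?(gt_eqF t0) ?implybT//.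
  by rewrite (_ : - 2^-1 * 2%:R + 1 = 0) ?powRr0//; lra.
by congr (_ `^ _ * _); field; rewrite gt_eqF.
Qed.

Lemma selfsim_classical : classical_solution a V.
Proof.
apply: selfsimilar_classical => //; first by move=> t x t0; exact: selfsim_formula.
by move=> tau tau0; exists ((a * tau) `^ (- a^-1)); exact: (selfsim_restart a0 mh ah hp tau0).
Qed.

Lemma Cbu_selfsim : Cbu (V 1).
Proof.
have h20 : 0 < 2^-1 :> R by rewrite invr_gt0.
have := Cbu_mild (selfsim_restart a0 mh ah hp h20) h20.
by rewrite (_ : 2^-1 + 2^-1 = 1) //; lra.
Qed.

Lemma dilation_selfsim_le l t x : 0 < l -> 0 < t ->
  `|V t x - dilation a l v t x| <= `|V t x - V (l ^- 2 / a + t) x|.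
Proof.
move=> l0 t0; have lt0 : 0 < l ^- 2 / a + t by rewrite addr_gt0// divr_gt0// invr_gt0 exprn_gt0.
rewrite -[leRHS]addr0.
apply: (@antisymmetric_normr_le R N m (fun x => V t x - dilation a l v t x)
  (fun x => V t x - V (l ^- 2 / a + t) x)) => //.
- move=> i im y; rewrite (antisymmetric_selfsim a0 mh ah hp t0 im).
  by rewrite (antisymmetric_dilation a0 mh ah hp l0 t0 im); ring.
- move=> i im y; rewrite (antisymmetric_selfsim a0 mh ah hp t0 im).
  by rewrite (antisymmetric_selfsim a0 mh ah hp lt0 im); ring.
move=> y ym; rewrite addr0.
have b1 := dilation_le_selfsim a0 mh ah hp l0 t0 ym.
have b2 := selfsim_delay a0 mh ah hp l0 t0 ym.
rewrite !ger0_norm ?subr_ge0//; last exact: le_trans b1.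
by rewrite lerD2l lerN2.
Qed.

(** Uniqueness replaces w by the constructed solution, and [dilation_selfsim_le] bounds the error by
    an increment of V alone over the delay l^(-2) / a; continuity of V and compactness of K
    conclude. *)
Lemma dilation_cvg_selfsim w : mild_solution a h w ->
  cvg_loc_unif (fun l => dilation a l w) V.
Proof.
move=> Hw K cK Kpos; apply/uniform_cvgP => e e0.
have [[cV _ _ _] _] := selfsim_classical.
have /compact_near_coveringP nc := cK.
have near_cov : \forall l \near +oo, K `<=` [set p | 0 < l -> 0 < p.1 ->
    `|V p.1 p.2 - V (l ^- 2 / a + p.1) p.2| < e].
  apply: (nc R (pinfty_nbhs R) (fun l p => 0 < l -> 0 < p.1 -> `|V p.1 p.2 - V (l ^- 2 / a + p.1) p.2| < e)).
  move=> [t x] Kp; have t0 : 0 < t := Kpos _ Kp.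
  have e20 : 0 < e / 2 by rewrite divr_gt0.
  have /cvgrPdist_lt/(_ (e / 2) e20) := cV t x t0.
  case=> -[A B] /= [[d d0 dA] nB] AB.
  have {}d0 : 0 < d := d0.
  (* For l > 1 and l > 2 / (a d) one has l^2 > l > 2 / (a d), so the delay l^(-2) / a is below d /
     2. *)
  pose b := Num.max 1 (2 / (a * d)).
  exists ([set p | `|t - p.1| < d / 2 /\ B p.2], [set l | b < l]).
    split; last by exists b; split=> //; exact: num_real.
    exists ([set s | `|t - s| < d / 2], B) => /=; last by move=> [s y] [].
    split=> //; exists (d / 2) => //; exact: divr_gt0.
  case=> -[s y] l /= [[ts By] bl] l0 s0.
  have [l1 l2] : 1 < l /\ 2 / (a * d) < l by apply/andP; move: bl; rewrite gt_max.
  have ad0 : 0 < a * d by exact: mulr_gt0.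
  have ll : l ^- 2 / a < d / 2.
    have l20 : 0 < l ^+ 2 by exact: exprn_gt0.
    rewrite -invfM invf_plt ?posrE ?mulr_gt0// ?divr_gt0// invf_div.
    move: l2; rewrite ltr_pdivrMr// => l2; rewrite ltr_pdivrMr// expr2.
    have : l * (a * d) < l * l * (a * d) by rewrite ltr_pM2r// ltr_pMr.
    by move: l2; set p := l * (a * d); rewrite (_ : l * l * (a * d) = l * l * a * d)//; [lra|ring].
  have h1' : `|V t x - V s y| < e / 2.
    by apply: (AB (s, y)); split=> //=; apply: dA => /=; apply: lt_le_trans ts _; lra.
  have h2' : `|V t x - V (l ^- 2 / a + s) y| < e / 2.
    apply: (AB (l ^- 2 / a + s, y)); split=> //=; apply: dA => /=.
    have lp : 0 <= l ^- 2 / a by rewrite divr_ge0 ?invr_ge0 ?exprn_ge0// ltW.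
    rewrite opprD addrCA; apply: le_lt_trans (ler_normD _ _) _.
    by rewrite normrN (ger0_norm lp); lra.
  rewrite -[V s y](subrK (V t x)) -addrA; apply: le_lt_trans (ler_normD _ _) _.
  by rewrite distrC; lra.
near=> l => -[t x] Kp.
have l0 : 0 < l by near: l; exact: nbhs_pinfty_gt.
have t0 : 0 < t := Kpos _ Kp.
have -> : dilation a l w t x = dilation a l v t x.
  by rewrite /dilation (mild_solution_unique Hw)// mulr_gt0 ?exprn_gt0.
apply: le_lt_trans (dilation_selfsim_le x l0 t0) _.
have : K `<=` [set p | 0 < l -> 0 < p.1 -> `|V p.1 p.2 - V (l ^- 2 / a + p.1) p.2| < e].
  by near: l; exact: near_cov.
by move/(_ _ Kp); apply.
Unshelve. all: by end_near. Qed.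

End conclusion.

Theorem proposition7p3 (R : realType) (N m : nat) (alpha : R)
    (h : 'rV[R]_N -> R) :
  (1 <= m <= N)%N -> 0 < alpha ->
  h \in Lfun (lebesgue_rV R N) +oo%E ->
  antisymmetric_upto m h ->
  (forall x, orthant m x -> h x = 1) ->
  exists (V : R -> 'rV[R]_N -> R) (g : 'rV[R]_N -> R),
    [/\ classical_solution alpha V,
        self_similar alpha V,
        (forall (t : R) x, 0 < t ->
          V t x = t `^ (- alpha^-1) * g ((Num.sqrt t)^-1 *: x)),
        Cbu g & antisymmetric_upto m g] /\
    [/\ (forall eps : R, 0 < eps < 1 -> forall x, orthant m x ->
          alpha `^ (- alpha^-1) * heat_semigroup 1 h x <= g x <=
          (alpha * eps) `^ (- alpha^-1) * heat_semigroup (1 - eps) h x),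
        (exists v, mild_solution alpha h v) &
        (forall v, mild_solution alpha h v ->
          cvg_loc_unif (fun lam => dilation alpha lam v) V)].
Proof.
move=> _ a0 hL ah hp.
(* Membership in L^oo supplies measurability; the pointwise bound by 1 comes from antisymmetry and
   the value on the orthant. *)
have mh : measurable_fun setT h by move: hL; rewrite inE => /andP[/[!inE]].
exists (selfsim alpha h), (selfsim alpha h 1); split; split.
- exact: (selfsim_classical a0 mh ah hp).
- exact: (selfsim_self_similar a0 mh ah hp).
- move=> t x t0; rewrite -(powR12_sqrt (ltW t0)) -powRN.
  exact: (selfsim_formula a0 mh ah hp x t0).
- exact: (Cbu_selfsim a0 mh ah hp).
- exact: (antisymmetric_selfsim a0 mh ah hp ltr01).
- move=> eps eps01 x xm; apply/andP; split; first exact: (selfsim_ge a0 mh ah hp xm).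
  exact: (selfsim_le a0 mh ah hp eps01 xm).
- by exists (limit_mild alpha h); exact: (mild_solution_exists a0 mh ah hp).
by move=> v Hv; exact: (dilation_cvg_selfsim a0 mh ah hp Hv).
Qed.
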